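(* Let $\lambda\in(0,\infty)$ and suppose that the random variable $\alpha$ with values in $(0,1)$ has a probability density of the form $\psi(x)(1-x)^{\beta}$, $x\in(0,1)$, where $\psi$ is a function on $(0,1)$ having a limit $\lim_{x\uparrow 1}\psi(x)=\psi_1\in(0,\infty)$. Let $S^{(N,n)}$ be the doubly aggregated partial sum process, centered by expectation, of independent copies of the randomized INAR(1) process with Poisson innovations (defined in the context). If $\beta\in(1,\infty)$, then $$\mathcal D_{\mathrm f}\text{-}\lim_{n\to\infty}\ \mathcal D_{\mathrm f}\text{-}\lim_{N\to\infty}\ n^{-1}N^{-\frac12}S^{(N,n)}=\mathcal D_{\mathrm f}\text{-}\lim_{N\to\infty}\ \mathcal D_{\mathrm f}\text{-}\lim_{n\to\infty}\ n^{-1}N^{-\frac12}S^{(N,n)}=\bigl(W_{\lambda^2\operatorname{Var}((1-\alpha)^{-1})}\,t\bigr)_{t\in[0,\infty)},$$ where $W_{\lambda^2\operatorname{Var}((1-\alpha)^{-1})}$ is a normally distributed random variable with mean zero and variance $\lambda^2\operatorname{Var}((1-\alpha)^{-1})$.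
   Context: Randomized INAR(1) process: let $\lambda\in(0,\infty)$ and let $\alpha$ be a random variable with values in $(0,1)$. Let $X_0$, $\xi_{k,j}$, $\varepsilon_k$ ($k,j\in\mathbb N=\{1,2,\dots\}$) be random variables which are conditionally independent given $\alpha$ and such that, conditionally on $\alpha$, each $\xi_{k,j}$ is Bernoulli with $\mathbb P(\xi_{k,j}=1\mid\alpha)=\alpha=1-\mathbb P(\xi_{k,j}=0\mid\alpha)$, each $\varepsilon_k$ is Poisson with parameter $\lambda$, and $X_0$ is Poisson with parameter $\lambda/(1-\alpha)$. Define $X_k=\sum_{j=1}^{X_{k-1}}\xi_{k,j}+\varepsilon_k$, $k\in\mathbb N$ (with $\sum_{j=1}^0:=0$). Let $(\alpha^{(j)},(X^{(j)}_k)_{k\in\mathbb Z_+})$, $j\in\mathbb N$, be independent copies of $(\alpha,(X_k)_{k\in\mathbb Z_+})$, where $\mathbb Z_+=\{0,1,2,\dots\}$. For $N,n\in\mathbb N$ set $S^{(N,n)}_t:=\sum_{j=1}^N\sum_{k=1}^{\lfloor nt\rfloor}\bigl(X^{(j)}_k-\mathbb E(X^{(j)}_k)\bigr)$, $t\in[0,\infty)$; here $\mathbb E(X^{(j)}_k)=\mathbb E\bigl(\frac{\lambda}{1-\alpha}\bigr)$, which is finite when $\beta>0$. $\mathcal D_{\mathrm f}\text{-}\lim$ denotes weak convergence of finite dimensional distributions. In an iterated limit the inner (right-hand) limit is taken first with the other index fixed (and is asserted to exist), and then the resulting limit processes converge in finite dimensional distributions, as the outer index tends to infinity, to the stated process.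 *)

(* Defs.v *)
From HB Require Import structures.
From mathcomp Require Import all_boot all_order all_algebra.
From mathcomp Require Import all_classical all_reals all_analysis.
From mathcomp Require Import measurable_realfun.

Set Implicit Arguments.
Unset Strict Implicit.
Unset Printing Implicit Defensive.

Import Order.TTheory GRing.Theory Num.Theory.
Import numFieldNormedType.Exports.

Local Open Scope classical_set_scope.
Local Open Scope ring_scope.

(** * Conditioning and independence *)

(* [g \o alpha] is a version of the conditional probability P(E | alpha):
   every version, being sigma(alpha)-measurable, has this form. *)
Definition is_cond_prob d (T : measurableType d) (R : realType)
    (P : probability T R) (alpha : T -> R) (E : set T) (g : R -> R) : Prop :=
  measurable_fun setT g /\
  forall A : set R, measurable A ->
    (P (alpha @^-1` A `&` E) = \int[P]_(w in alpha @^-1` A) (g (alpha w))%:E)%E.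

(* Conditional mutual independence given alpha of nat-valued random variables:
   for distinct indices i_0, ..., i_(m-1),
     P(Y_(i_0) \in B_0, ..., Y_(i_(m-1)) \in B_(m-1) | alpha)
       = \prod_k P(Y_(i_k) \in B_k | alpha)  almost surely,
   whichever versions g_k of the factors are chosen. *)
Definition cond_independent d (T : measurableType d) (R : realType)
    (P : probability T R) (alpha : T -> R) (I : Type) (Y : I -> T -> nat)
    : Prop :=
  forall (m : nat) (i : 'I_m -> I) (B : 'I_m -> set nat) (g : 'I_m -> R -> R),
    injective i ->
    (forall k, is_cond_prob P alpha (Y (i k) @^-1` B k) (g k)) ->
    is_cond_prob P alpha
      [set w | forall k, B k (Y (i k) w)] (fun a => \prod_(k < m) g k a).

(* Mutual independence of random elements Z_i of a set S, endowed with the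
   sigma-algebra F. *)
Definition independent d (T : measurableType d) (R : realType)
    (P : probability T R) (S : Type) (F : set (set S)) (I : Type)
    (Z : I -> T -> S) : Prop :=
  forall (m : nat) (i : 'I_m -> I) (C : 'I_m -> set S),
    injective i -> (forall k, F (C k)) ->
    (P [set w | forall k, C k (Z (i k) w)] =
     \prod_(k < m) P (Z (i k) @^-1` C k))%E.

Definition has_density d (T : measurableType d) (R : realType)
    (P : probability T R) (X : T -> R) (D : set R) (f : R -> R) : Prop :=
  [/\ measurable_fun D f,
      forall x, D x -> 0 <= f x &
      forall A : set R, measurable A ->
        (P (X @^-1` A) = \int[lebesgue_measure]_(x in A `&` D) (f x)%:E)%E].

(* The normal law with mean m and variance v, the degenerate case v = 0 being
   the Dirac mass at m. Pitfall: [normal_prob m 0] is the uniform law on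
   [0, 1]. *)
Definition normally_distributed d (T : measurableType d) (R : realType)
    (P : probability T R) (X : T -> R) (m v : R) : Prop :=
  forall A : set R, measurable A ->
    P (X @^-1` A) = if 0 < v then normal_prob m (Num.sqrt v) A else \d_m A.

(** * The randomized INAR(1) process *)

(* Time is shifted by one: [xi k l] and [eps k] stand for the thinning variable
   \xi_(k+1,l+1) and the innovation \varepsilon_(k+1). *)
Fixpoint inar (T : Type) (X0 : T -> nat) (xi : nat -> nat -> T -> nat)
    (eps : nat -> T -> nat) (k : nat) (w : T) : nat :=
  if k is k'.+1
  then (\sum_(l < inar X0 xi eps k' w) xi k' l w + eps k' w)%N
  else X0 w.

Inductive inar_index := Initial | Thinning of nat & nat | Innovation of nat.

Definition inar_input (T : Type) (X0 : T -> nat) (xi : nat -> nat -> T -> nat)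
    (eps : nat -> T -> nat) (i : inar_index) : T -> nat :=
  match i with
  | Initial => X0
  | Thinning k l => xi k l
  | Innovation k => eps k
  end.

Record randomized_inar d (T : measurableType d) (R : realType)
    (P : probability T R) (lambda : R) (alpha : T -> R) (X0 : T -> nat)
    (xi : nat -> nat -> T -> nat) (eps : nat -> T -> nat) : Prop := {
  inar_alpha01 : forall w, 0 < alpha w < 1 ;
  inar_cond_indep : cond_independent P alpha (inar_input X0 xi eps) ;
  inar_thinning1 : forall k l,
    is_cond_prob P alpha [set w | xi k l w = 1%N] (fun a => a) ;
  inar_thinning0 : forall k l,
    is_cond_prob P alpha [set w | xi k l w = 0%N] (fun a => 1 - a) ;
  inar_innovation : forall k m,
    is_cond_prob P alpha [set w | eps k w = m] (fun=> poisson_pmf lambda m) ;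
  inar_initial : forall m,
    is_cond_prob P alpha [set w | X0 w = m]
      (fun a => poisson_pmf (lambda / (1 - a)) m) }.

(** * Independent copies *)

(* Product sigma-algebra on R x nat^nat, the space of values of
   (alpha, (X_k)_k). *)
Definition path_sigma_algebra (R : realType) : set (set (R * (nat -> nat))) :=
  <<s [set C | (exists2 A : set R, measurable A & C = fst @^-1` A) \/
               (exists k (B : set nat), C = [set z | B (z.2 k)])] >>.

Definition alpha_path (T R : Type) (alpha : T -> R) (X : nat -> T -> nat)
    (w : T) : R * (nat -> nat) := (alpha w, X ^~ w).

Record independent_copies d0 (T0 : measurableType d0) d (T : measurableType d)
    (R : realType) (P0 : probability T0 R) (alpha : T0 -> R)
    (X : nat -> T0 -> nat) (P : probability T R) (alphas : nat -> T -> R)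
    (Xs : nat -> nat -> T -> nat) : Prop := {
  copies_law : forall (j : nat) (C : set (R * (nat -> nat))),
    path_sigma_algebra C ->
    P (alpha_path (alphas j) (Xs j) @^-1` C) = P0 (alpha_path alpha X @^-1` C) ;
  copies_indep : independent P (@path_sigma_algebra R)
    (fun j => alpha_path (alphas j) (Xs j)) }.

(** * Real-valued processes indexed by [0, oo[ *)

(* Each process lives on its own probability space; only its values at times
   [0 <= t] are meaningful. *)
Record process (R : realType) := Process {
  proc_disp : measure_display ;
  proc_space : measurableType proc_disp ;
  proc_prob : probability proc_space R ;
  proc_val :> R -> proc_space -> R ;
  proc_meas : forall t, 0 <= t -> measurable_fun setT (proc_val t) }.

(* Weak convergence of the finite dimensional distributions. *)
Definition Df_lim (R : realType) (Y : nat -> process R) (Z : process R)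
    : Prop :=
  forall (m : nat) (t : 'I_m -> R), (forall i, 0 <= t i) ->
  forall f : 'rV[R]_m -> R, continuous f -> (exists M, forall x, `|f x| <= M) ->
    ('E_(proc_prob (Y n)) [fun w => f (\row_i Y n (t i) w)] @[n --> \oo]
      --> 'E_(proc_prob Z) [fun w => f (\row_i Z (t i) w)])%E.

(* Inner limit along b for every fixed a >= 1, then limit along a. *)
Definition iterated_Df_lim (R : realType) (Y : nat -> nat -> process R)
    (Z : process R) : Prop :=
  exists V : nat -> process R,
    (forall a, (0 < a)%N -> Df_lim (fun b => Y a b) (V a)) /\ Df_lim V Z.

Section concrete_processes.
Context d (T : measurableType d) (R : realType) (P : probability T R).
Variable Xs : nat -> nat -> {RV P >-> nat}.

(* The copies are numbered from 0, so that the sum over j = 1, ..., N becomes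
   a sum over j < N. *)
Definition aggregated_sum (N n : nat) (t : R) (w : T) : R :=
  \sum_(j < N) \sum_(1 <= k < (Num.truncn (n%:R * t)).+1)
    ((Xs j k w)%:R - fine ('E_P[fun w' => (Xs j k w')%:R])%E).

Lemma measurable_aggregated_sum N n t :
  measurable_fun setT (aggregated_sum N n t).
Proof.
apply: measurable_sum => j; apply: measurable_sum => k.
apply: measurable_funB => //.
by apply: (@measurableT_comp _ _ _ _ _ _ (fun m : nat => m%:R : R)).
Qed.

(* n^-1 N^(-1/2) S^(N,n) *)
Program Definition normalized_sum (N n : nat) : process R :=
  @Process R d T P
    (fun t w => n%:R^-1 * N%:R `^ (- 2^-1) * aggregated_sum N n t w) _.
Next Obligation.
by move=> N n t _; apply: measurable_funM => //; exact: measurable_aggregated_sum.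
Qed.

Program Definition linear_process (W : {RV P >-> R}) : process R :=
  @Process R d T P (fun t w => W w * t) _.
Next Obligation. by move=> W t _; exact: measurable_funM. Qed.

End concrete_processes.

(* Main.v *)
Require Import Defs.
From HB Require Import structures.
From mathcomp Require Import all_boot all_order all_algebra.
From mathcomp Require Import all_classical all_reals all_analysis.
From mathcomp Require Import measurable_realfun zify ring lra.

Set Implicit Arguments.
Unset Strict Implicit.
Unset Printing Implicit Defensive.

Import Order.TTheory GRing.Theory Num.Theory.
Import numFieldNormedType.Exports.

Local Open Scope classical_set_scope.
Local Open Scope ring_scope.

(** Conditionally on alpha, the process is a stationary autoregression with
    Poisson marginals of mean M = lambda / (1 - alpha), and the covariance of
    X_k and X_(k+m) is alpha^m M.  These covariances are summable in m, so that
    the time average n^-1 \sum_(k <= nt) X_k converges to t M in mean square,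
    with a squared error of order n^-1 E((1 - alpha)^-2).  The second moment of
    1 / (1 - alpha) is finite because the density of alpha is of order
    (1 - x)^beta with beta > 1 near 1 ([integrable_inv_sqr]).  Only the
    randomness of alpha survives the time average: the centred average tends to
    t L with L = M - E M, and E L^2 = lambda^2 Var(1 / (1 - alpha)) is the
    variance of W.

    If n tends to infinity first, the limit over n is the random line
    t N^(-1/2) \sum_(j < N) L_j with independent copies L_j of L, and the
    central limit theorem turns it into the Gaussian line W t ([long_time_limit],
    [average_mean_limit]).  If N tends to infinity first, the central limit
    theorem for vectors yields a centred Gaussian process with the covariances
    of the time average up to n, and these covariances tend to E(L^2) s t
    ([many_copies_limit], [gaussian_average_limit]).

    Three tools carry these steps.

    Convergence of finite dimensional distributions reduces to the convergence
    of the characteristic functions of linear combinations, provided that the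
    second moments stay bounded ([Df_lim_criterion]).  The characteristic
    function is kept real: E cos(Y + c) for all shifts c contains the real part
    (c = 0) and the imaginary part (c = - pi / 2) of E exp(i Y).  A bounded
    continuous function is approximated on a large box by a polynomial in the
    sines of the coordinates; expanding the products of sines and cosines leaves
    only cosines of linear combinations, and the second moments control what
    happens outside the box.

    The Gaussian process of the intermediate limit has to live on some
    probability space.  The law of alpha has no atom, so a quantile transform
    makes a standard normal variable out of each copy of alpha
    ([gaussian_transform]), and a triangular linear transformation of these
    independent variables has the prescribed covariances
    ([cholesky_factorization], [gaussian_sequence_exists]).

    The moments of the process rest on one fact: given alpha and all the other
    inputs, the law of an input is its law given alpha ([cond_prob_other]).
    The recursion for X_k therefore yields recursions for E(h(alpha) X_k) and
    E(h(alpha) X_k X_(k+m)), valid for every weight h >= 0 ([expec_inar],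
    [expec_inarM]). *)

(** * Integrable and square-integrable functions on a probability space *)

Section real_expectations.
Context d (T : measurableType d) (R : realType) (P : probability T R).
Implicit Types (f g : T -> R) (c : R).

Local Notation L1 f := (P.-integrable setT (EFin \o f)).

Lemma eq_L1 f g : f =1 g -> L1 f -> L1 g.
Proof. by move=> /funext ->. Qed.

Lemma L1_bounded f (M : R) : measurable_fun setT f -> (forall w, `|f w| <= M) -> L1 f.
Proof.
move=> mf fM; apply: measurable_bounded_integrable => //.
  by rewrite (le_lt_trans (probability_le1 P measurableT))// ltry.
exists M; split; first exact: num_real.
by move=> x Mx w _ /=; rewrite (le_trans (fM w))// ltW.
Qed.

Lemma L1_cst c : L1 (fun=> c).
Proof. by apply: (@L1_bounded _ `|c|). Qed.

Lemma L1_D f g : L1 f -> L1 g -> L1 (fun w => f w + g w).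
Proof.
move=> If Ig; have := integrableD measurableT If Ig.
by apply: eq_integrable.
Qed.

Lemma L1_Z c f : L1 f -> L1 (fun w => c * f w).
Proof.
move=> If; have := @integrableZl _ _ _ _ _ measurableT c _ If.
by apply: eq_integrable.
Qed.

Lemma L1_N f : L1 f -> L1 (fun w => - f w).
Proof. by move/(L1_Z (-1)); apply: eq_L1 => w; rewrite mulN1r. Qed.

Lemma L1_B f g : L1 f -> L1 g -> L1 (fun w => f w - g w).
Proof. by move=> If Ig; apply: L1_D => //; exact: L1_N. Qed.

Lemma L1_sum I (s : seq I) (F : I -> T -> R) :
  (forall i, L1 (F i)) -> L1 (fun w => \sum_(i <- s) F i w).
Proof.
move=> IF; elim: s => [|i s ih].
  by apply: eq_L1 (L1_cst 0) => w; rewrite big_nil.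
by apply: eq_L1 (L1_D (IF i) ih) => w; rewrite big_cons.
Qed.

Lemma L1_le f g : measurable_fun setT f -> (forall w, `|f w| <= g w) ->
  L1 g -> L1 f.
Proof.
move=> mf fg; apply: le_integrable => //; first exact/measurable_EFinP.
by move=> w _; rewrite /= lee_fin (le_trans (fg w))// ler_norm.
Qed.

Lemma expec_eq f g : f =1 g -> \int[P]_w f w = \int[P]_w g w.
Proof. by move=> fg; apply: eq_Rintegral => w _; exact: fg. Qed.

Lemma expec_cst c : \int[P]_w c = c.
Proof. by rewrite Rintegral_cst//= probability_setT mulr1. Qed.

Lemma expecD f g : L1 f -> L1 g ->
  \int[P]_w (f w + g w) = (\int[P]_w f w) + (\int[P]_w g w).
Proof. by move=> ? ?; rewrite RintegralD. Qed.

Lemma expecB f g : L1 f -> L1 g ->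
  \int[P]_w (f w - g w) = (\int[P]_w f w) - (\int[P]_w g w).
Proof. by move=> ? ?; rewrite RintegralB. Qed.

Lemma expecZ c f : L1 f -> \int[P]_w (c * f w) = c * (\int[P]_w f w).
Proof. by move=> ?; rewrite RintegralZl. Qed.

Lemma expec_sum I (s : seq I) (F : I -> T -> R) : (forall i, L1 (F i)) ->
  \int[P]_w (\sum_(i <- s) F i w) = \sum_(i <- s) \int[P]_w F i w.
Proof.
move=> IF; elim: s => [|i s ih].
  by under expec_eq do rewrite big_nil; rewrite expec_cst big_nil.
under expec_eq do rewrite big_cons.
by rewrite expecD ?ih ?big_cons//; exact: L1_sum.
Qed.

Lemma le_expec f g : L1 f -> L1 g -> (forall w, f w <= g w) ->
  \int[P]_w f w <= \int[P]_w g w.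
Proof. by move=> If Ig fg; apply: le_Rintegral => // w _; exact: fg. Qed.

Lemma expec_ge0 f : (forall w, 0 <= f w) -> 0 <= \int[P]_w f w.
Proof. by move=> f0; apply: Rintegral_ge0 => w _; exact: f0. Qed.

Lemma normr_expec_le f g : L1 f -> L1 g -> (forall w, `|f w| <= g w) ->
  `|\int[P]_w f w| <= \int[P]_w g w.
Proof.
move=> If Ig fg; rewrite ler_norml -(mulN1r (\int[P]_w g w)) -expecZ//.
apply/andP; split; apply: le_expec => //; try exact: L1_Z.
- by move=> w; rewrite mulN1r lerNl (le_trans _ (fg w))// -normrN ler_norm.
- by move=> w; rewrite (le_trans _ (fg w))// ler_norm.
Qed.

Lemma EFin_expec f : L1 f -> ((\int[P]_w f w)%:E = \int[P]_w (f w)%:E)%E.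
Proof.
move=> If; rewrite /Rintegral fineK//.
exact: (integrable_fin_num measurableT If).
Qed.

Lemma expectationE f : L1 f -> ('E_P[f] = (\int[P]_w f w)%:E)%E.
Proof. by move=> If; rewrite unlock EFin_expec. Qed.

Lemma ge0_L1 f : measurable_fun setT f -> (forall w, 0 <= f w) ->
  (\int[P]_w (f w)%:E < +oo)%E -> L1 f.
Proof.
move=> mf f0 foo; apply/integrableP; split; first exact/measurable_EFinP.
by under eq_integral do rewrite /= ger0_norm//.
Qed.

Lemma L1_lty f : L1 f -> (forall w, 0 <= f w) -> (\int[P]_w (f w)%:E < +oo)%E.
Proof. by move=> If _; rewrite -EFin_expec// ltry. Qed.

Definition L2fun f := measurable_fun setT f /\ L1 (fun w => f w ^+ 2).

Lemma L2_measurable f : L2fun f -> measurable_fun setT f. Proof. by case. Qed.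

Lemma L2_sqr f : L2fun f -> L1 (fun w => f w ^+ 2). Proof. by case. Qed.

Lemma eq_L2 f g : f =1 g -> L2fun f -> L2fun g.
Proof. by move=> /funext ->. Qed.

Lemma L2_M f g : L2fun f -> L2fun g -> L1 (fun w => f w * g w).
Proof.
move=> [mf If] [mg Ig]; apply: L1_le (L1_D If Ig).
  exact: measurable_funM.
move=> w; rewrite ler_norml; apply/andP; split.
  by have := sqr_ge0 (f w + g w); have := sqr_ge0 (f w - g w);
    have := sqr_ge0 (f w); have := sqr_ge0 (g w); nra.
by have := sqr_ge0 (f w - g w); have := sqr_ge0 (f w); have := sqr_ge0 (g w); nra.
Qed.

Lemma L2_cst c : L2fun (fun=> c).
Proof. by split => //; exact: (L1_cst (c ^+ 2)). Qed.

Lemma L2_L1 f : L2fun f -> L1 f.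
Proof. by move=> /(L2_M (L2_cst 1)); apply: eq_L1 => w; rewrite mul1r. Qed.

Lemma L2_D f g : L2fun f -> L2fun g -> L2fun (fun w => f w + g w).
Proof.
move=> hf hg; have [mf If] := hf; have [mg Ig] := hg.
split; first exact: measurable_funD.
have := L1_D (L1_D If (L1_Z 2 (L2_M hf hg))) Ig.
by apply: eq_L1 => w; ring.
Qed.

Lemma L2_Z c f : L2fun f -> L2fun (fun w => c * f w).
Proof.
move=> [mf If]; split; first exact: measurable_funM.
by apply: eq_L1 (L1_Z (c ^+ 2) If) => w; ring.
Qed.

Lemma L2_B f g : L2fun f -> L2fun g -> L2fun (fun w => f w - g w).
Proof.
move=> hf /(L2_Z (-1)) /(L2_D hf); apply: eq_L2 => w; ring.
Qed.

Lemma L2_sum I (s : seq I) (F : I -> T -> R) :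
  (forall i, L2fun (F i)) -> L2fun (fun w => \sum_(i <- s) F i w).
Proof.
move=> IF; elim: s => [|i s ih].
  by apply: eq_L2 (L2_cst 0) => w; rewrite big_nil.
by apply: eq_L2 (L2_D (IF i) ih) => w; rewrite big_cons.
Qed.

(** The difference of the two sides is the variance of |f|. *)
Lemma normr_expec_sqr_le f : L2fun f ->
  (\int[P]_w `|f w|) ^+ 2 <= \int[P]_w (f w ^+ 2).
Proof.
move=> hf; have [mf If] := hf.
have Ia : L1 (fun w => `|f w|) by exact: (integrable_norm (L2_L1 hf)).
set m := \int[P]_w `|f w|.
rewrite -subr_ge0.
have -> : (\int[P]_w (f w ^+ 2)) - m ^+ 2 = \int[P]_w ((`|f w| - m) ^+ 2).
  transitivity (\int[P]_w (f w ^+ 2 - (2 * m * `|f w| - m ^+ 2))).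
    rewrite expecB//; last by apply: L1_B; [exact: L1_Z|exact: L1_cst].
    rewrite expecB; [|exact: L1_Z|exact: L1_cst].
    by rewrite expecZ// expec_cst -/m; ring.
  by apply: expec_eq => w; rewrite -(real_normK (num_real (f w))); ring.
by apply: expec_ge0 => w; exact: sqr_ge0.
Qed.

End real_expectations.

(** * Measures with a density, and weights that agree on a pi-system *)

(** The hypotheses [ma] and [a0] are arguments so that the measure structure
    below can be inferred from the term. *)
Definition density_measure d (T : measurableType d) (R : realType)
    (mu : {measure set T -> \bar R}) (a : T -> \bar R)
    (ma : measurable_fun setT a) (a0 : forall x, (0 <= a x)%E) (A : set T) :=
  (\int[mu]_(x in A) a x)%E.

Section density_measure.
Context d (T : measurableType d) (R : realType).
Variables (mu : {measure set T -> \bar R}) (a : T -> \bar R).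
Hypotheses (ma : measurable_fun setT a) (a0 : forall x, (0 <= a x)%E).

Local Notation density := (density_measure mu ma a0).

Let density0 : density set0 = 0%E.
Proof. by rewrite /density_measure integral_set0. Qed.

Let density_ge0 A : (0 <= density A)%E.
Proof. by apply: integral_ge0 => x _; exact: a0. Qed.

Let density_sigma_additive : semi_sigma_additive density.
Proof.
move=> A mA tA mUA; rewrite /density_measure ge0_integral_bigcup//; last first.
  exact: measurable_funTS.
by apply: is_cvg_ereal_nneg_natsum => n _; exact: density_ge0.
Qed.

HB.instance Definition _ := isMeasure.Build _ _ _
  density density0 density_ge0 density_sigma_additive.

End density_measure.

Section integral_density.
Context d (T : measurableType d) (R : realType).
Variables (mu : {measure set T -> \bar R}) (a : T -> R).
Hypotheses (ma : measurable_fun setT (EFin \o a)).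
Hypothesis a0 : forall x, (0 <= (EFin \o a) x)%E.

Import HBNNSimple.

(** Both sides are linear in H and commute with increasing limits, so it is
    enough to compare them on the simple functions that approximate H. *)
Lemma ge0_integral_density (H : T -> \bar R) :
  measurable_fun setT H -> (forall x, 0 <= H x)%E ->
  (\int[density_measure mu ma a0]_x H x = \int[mu]_x (H x * (a x)%:E))%E.
Proof.
move=> mH H0; pose h := nnsfun_approx measurableT mH.
have ar0 x : 0 <= a x by have := a0 x; rewrite lee_fin.
have hH x : (h n x)%:E @[n --> \oo] --> H x by apply: cvg_nnsfun_approx => // y _.
transitivity (limn (fun n => \int[density_measure mu ma a0]_x (h n x)%:E))%E.
  rewrite -monotone_convergence//.
  - by apply: eq_integral => x _; apply/esym/cvg_lim => //; exact: hH.
  - by move=> n; exact/measurable_EFinP.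
  - by move=> n x _; rewrite lee_fin.
  - by move=> x _ m n mn; rewrite lee_fin; exact/lefP/nd_nnsfun_approx.
transitivity (limn (fun n => \int[mu]_x ((h n x)%:E * (a x)%:E)))%E; last first.
  rewrite -monotone_convergence//; last 3 first.
  - by move=> n; apply: emeasurable_funM => //; exact/measurable_EFinP.
  - by move=> n x _; rewrite mule_ge0// lee_fin.
  - move=> x _ m n mn; rewrite lee_wpmul2r ?lee_fin//.
    exact/lefP/nd_nnsfun_approx.
  apply: eq_integral => x _; apply/cvg_lim => //.
  by apply: cvgeZr => //; exact: hH.
apply/congr_lim/funext => n.
have mhr r : measurable ((h n : T -> R) @^-1` [set r]) by [].
under [LHS]eq_integral do rewrite fimfunE -fsumEFin//.
rewrite ge0_integral_fsum//; last 2 first.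
- by move=> r; apply/measurable_EFinP; apply: measurable_funM.
- by move=> r x _; rewrite EFinM nnfun_muleindic_ge0.
transitivity (\int[mu]_x (\sum_(r \in range (h n))
    (r * \1_((h n : T -> R) @^-1` [set r]) x)%:E * (a x)%:E))%E; last first.
  apply: eq_integral => x _; rewrite [in RHS](fimfunE (h n)) -fsumEFin//.
  by rewrite ge0_mule_fsuml// => r; rewrite EFinM nnfun_muleindic_ge0.
rewrite ge0_integral_fsum//; last 2 first.
- move=> r; apply: emeasurable_funM => //; apply/measurable_EFinP => //.
  exact: measurable_funM.
- by move=> r x _; rewrite mule_ge0 ?lee_fin// -lee_fin EFinM nnfun_muleindic_ge0.
apply: eq_fsbigr => s /set_mem [x _ hs].
have s0 : 0 <= s by rewrite -hs.
rewrite integralZl_indic_nnsfun// integral_indic// setIT.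
under [RHS]eq_integral do rewrite EFinM -muleA.
rewrite ge0_integralZl//; last 2 first.
- by apply: emeasurable_funM => //; apply/measurable_EFinP.
- by move=> y _; rewrite mule_ge0// lee_fin.
congr (_ * _)%E; rewrite -[LHS]/(density_measure mu ma a0 _) /density_measure integral_mkcond.
apply: eq_integral => y _.
by rewrite /patch indicE /=; case: ifPn => _; rewrite ?mul1e ?mul0e.
Qed.

End integral_density.

Section weights.
Context d (T : measurableType d) (R : realType).
Variable mu : {measure set T -> \bar R}.
Variable G : set (set T).
Hypotheses (Gm : G `<=` measurable) (GT : G setT) (GI : setI_closed G).

Lemma sub_measurable_fun d' (T' : measurableType d') (H : T -> T') :
  measurable_fun (setT : set (g_sigma_algebraType G)) H -> measurable_fun setT H.
Proof.
move=> mH _ B mB; have := mH measurableT B mB.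
rewrite !setTI; apply: smallest_sub => //.
exact: sigma_algebra_measurable.
Qed.

(** The measures of densities a and b coincide on the pi-system G, hence on the
    sigma-algebra that it generates, hence they integrate alike the functions
    measurable for it.  Conditional probabilities enter in this form: the
    indicator of an event and a version of its conditional probability are two
    such weights. *)
Lemma eq_integral_weight (a b : T -> R) (H : T -> \bar R) :
  measurable_fun setT a -> (forall x, 0 <= a x) ->
  measurable_fun setT b -> (forall x, 0 <= b x) ->
  (\int[mu]_x (a x)%:E < +oo)%E ->
  (forall A, G A ->
    (\int[mu]_(x in A) (a x)%:E = \int[mu]_(x in A) (b x)%:E)%E) ->
  measurable_fun (setT : set (g_sigma_algebraType G)) H ->
  (forall x, 0 <= H x)%E ->
  (\int[mu]_x (H x * (a x)%:E) = \int[mu]_x (H x * (b x)%:E))%E.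
Proof.
move=> ma a0 mb b0 afin eqG mH H0.
have mEa : measurable_fun setT (EFin \o a) by exact/measurable_EFinP.
have mEb : measurable_fun setT (EFin \o b) by exact/measurable_EFinP.
have Ea0 x : (0 <= (EFin \o a) x)%E by rewrite lee_fin.
have Eb0 x : (0 <= (EFin \o b) x)%E by rewrite lee_fin.
pose ma' : {measure set T -> \bar R} := density_measure mu mEa Ea0.
pose mb' : {measure set T -> \bar R} := density_measure mu mEb Eb0.
have eq_sG A : <<s G >> A -> ma' A = mb' A.
  apply: (@g_sigma_algebra_measure_unique _ _ _ _ Gm (fun=> setT)) => //.
  by rewrite bigcup_const.
have mHT : measurable_fun setT H by exact: sub_measurable_fun.
rewrite -(ge0_integral_density _ mEa Ea0)// -(ge0_integral_density _ mEb Eb0)//.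
have mid : measurable_fun setT (idfun : T -> g_sigma_algebraType G).
  by apply: (@sub_measurable_fun _ (g_sigma_algebraType G) idfun); exact: measurable_id.
have push (m : {measure set T -> \bar R}) := @ge0_integral_pushforward _ _ T
  (g_sigma_algebraType G) R idfun mid m setT H measurableT mH (fun y _ => H0 y).
rewrite -(push ma') -(push mb'); apply: eq_measure_integral => A mA _.
exact: eq_sG.
Qed.

End weights.

(** * Products of independent variables *)

Section independent_pi_systems.
Context d (T : measurableType d) (R : realType) (P : probability T R).
Variables G1 G2 : set (set T).
Hypotheses (G1m : G1 `<=` measurable) (G1T : G1 setT) (G1I : setI_closed G1).
Hypotheses (G2m : G2 `<=` measurable) (G2T : G2 setT) (G2I : setI_closed G2).
Hypothesis G12 : forall A B, G1 A -> G2 B -> P (A `&` B) = (P A * P B)%E.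
Variables H K : T -> R.
Hypothesis mH : measurable_fun (setT : set (g_sigma_algebraType G1)) H.
Hypothesis mK : measurable_fun (setT : set (g_sigma_algebraType G2)) K.

(** Two applications of [eq_integral_weight]: the indicator of an event B of
    [G2] may be replaced by the constant P B against functions of H, and then
    f (H) by the constant E f(H) against functions of K. *)
Lemma ge0_independent_integralM (f g : R -> R) :
  measurable_fun setT f -> measurable_fun setT g ->
  (forall x, 0 <= f x) -> (forall x, 0 <= g x) ->
  (\int[P]_w (f (H w))%:E < +oo)%E ->
  (\int[P]_w (f (H w) * g (K w))%:E =
   \int[P]_w (f (H w))%:E * \int[P]_w (g (K w))%:E)%E.
Proof.
move=> mf mg f0 g0 fHoo.
have mfH : measurable_fun (setT : set (g_sigma_algebraType G1)) (f \o H).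
  exact: measurableT_comp.
have mgK : measurable_fun (setT : set (g_sigma_algebraType G2)) (g \o K).
  exact: measurableT_comp.
have mfHT : measurable_fun setT (f \o H) by exact: sub_measurable_fun mfH.
have mgKT : measurable_fun setT (g \o K) by exact: sub_measurable_fun mgK.
have finfH : (\int[P]_w (f (H w))%:E)%E \is a fin_num.
  by rewrite ge0_fin_numE// integral_ge0// => w _; rewrite lee_fin.
have PB B : G2 B ->
    (\int[P]_w ((f (H w))%:E * (\1_B w)%:E) =
     P B * \int[P]_w (f (H w))%:E)%E.
  move=> GB; have mB := G2m GB.
  rewrite (@eq_integral_weight _ _ _ P G1 _ _ _ (\1_B) (cst (fine (P B)))) //.
  - rewrite /= ge0_integralZr//; last 3 first.
    + exact/measurable_EFinP.
    + by move=> w _; rewrite lee_fin.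
    + by rewrite lee_fin fine_ge0.
    by rewrite fineK ?fin_num_measure// muleC.
  - by move=> w; rewrite fine_ge0.
  - by rewrite integral_indic// setIT (le_lt_trans (probability_le1 P mB))// ltry.
  - move=> A GA; have mA := G1m GA.
    transitivity (P (A `&` B)); first by rewrite integral_indic// setIC.
    rewrite G12//= integral_cst//= fineK ?fin_num_measure//.
    by rewrite muleC.
  - exact/measurable_EFinP.
  - by move=> w; rewrite lee_fin.
transitivity (\int[P]_w ((g (K w))%:E * (f (H w))%:E))%E.
  by apply: eq_integral => w _; rewrite mulrC EFinM.
rewrite (@eq_integral_weight _ _ _ P G2 _ _ _ (f \o H)
  (cst (fine (\int[P]_w (f (H w))%:E)%E))) //.
- rewrite /= ge0_integralZr//; last 3 first.
  + exact/measurable_EFinP.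
  + by move=> w _; rewrite lee_fin.
  + by rewrite lee_fin fine_ge0// integral_ge0// => w _; rewrite lee_fin.
  by rewrite fineK// muleC.
- by move=> w /=.
- by move=> w /=; rewrite fine_ge0// integral_ge0// => x _; rewrite lee_fin.
- move=> B GB; have mB := G2m GB.
  rewrite /= integral_cst//= fineK// muleC -PB//.
  rewrite integral_mkcond; apply: eq_integral => w _.
  by rewrite /patch indicE /=; case: ifPn => _; rewrite ?mule1 ?mule0.
- exact/measurable_EFinP.
- by move=> w; rewrite lee_fin.
Qed.

(** The case of nonnegative variables applies to the four products of positive
    and negative parts. *)
Lemma independent_expectationM :
  P.-integrable setT (EFin \o H) -> P.-integrable setT (EFin \o K) ->
  P.-integrable setT (EFin \o (fun w => H w * K w)) /\
  \int[P]_w (H w * K w) = (\int[P]_w H w) * (\int[P]_w K w).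
Proof.
move=> iH iK.
have mHT : measurable_fun setT H by exact: sub_measurable_fun mH.
have mKT : measurable_fun setT K by exact: sub_measurable_fun mK.
pose p (x : R) := Num.max x 0; pose q (x : R) := Num.max (- x) 0.
have mp : measurable_fun setT p by exact: measurable_maxr.
have mq : measurable_fun setT q by apply: measurable_maxr => //; exact: measurable_funN.
have p0 x : 0 <= p x by rewrite /p le_max lexx orbT.
have q0 x : 0 <= q x by rewrite /q le_max lexx orbT.
have pq x : x = p x - q x.
  by rewrite /p /q /Num.max; case: ltP => h1; case: ltP => h2; lra.
have pabs x : `|p x| <= `|x|.
  by rewrite ger0_norm// /p ge_max normr_ge0 ler_norm.
have qabs x : `|q x| <= `|x|.
  by rewrite ger0_norm// /q ge_max normr_ge0 -normrN ler_norm.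
have ic (f : R -> R) (V : T -> R) : measurable_fun setT f ->
    (forall x, `|f x| <= `|x|) -> measurable_fun setT V ->
    P.-integrable setT (EFin \o V) -> P.-integrable setT (EFin \o (f \o V)).
  move=> mf fle mV; apply: le_integrable => //.
    by apply/measurable_EFinP; exact: measurableT_comp.
  by move=> w _; rewrite /= lee_fin.
have fin (f : R -> R) (V : T -> R) : (forall x, 0 <= f x) ->
    P.-integrable setT (EFin \o (f \o V)) ->
    (\int[P]_w (f (V w))%:E < +oo)%E.
  move=> f0 /integrableP[_]; congr (_ < _)%E; apply: eq_integral => w _.
  by rewrite /= ger0_norm.
have prod (f g : R -> R) : measurable_fun setT f -> measurable_fun setT g ->
    (forall x, 0 <= f x) -> (forall x, 0 <= g x) ->
    (forall x, `|f x| <= `|x|) -> (forall x, `|g x| <= `|x|) ->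
    P.-integrable setT (EFin \o (fun w => f (H w) * g (K w))) /\
    \int[P]_w (f (H w) * g (K w)) =
    (\int[P]_w (f (H w))) * (\int[P]_w (g (K w))).
  move=> mf mg f0 g0 fle gle.
  have fHoo := fin f H f0 (ic f H mf fle mHT iH).
  have gKoo := fin g K g0 (ic g K mg gle mKT iK).
  have e := ge0_independent_integralM mf mg f0 g0 fHoo.
  have ffin : (\int[P]_w (f (H w))%:E)%E \is a fin_num.
    by rewrite ge0_fin_numE// integral_ge0// => w _; rewrite lee_fin.
  have gfin : (\int[P]_w (g (K w))%:E)%E \is a fin_num.
    by rewrite ge0_fin_numE// integral_ge0// => w _; rewrite lee_fin.
  split; last by rewrite /Rintegral e fineM.
  apply/integrableP; split.
    by apply/measurable_EFinP; apply: measurable_funM; exact: measurableT_comp.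
  under eq_integral do rewrite /= ger0_norm ?mulr_ge0//.
  by rewrite e lte_mul_pinfty// integral_ge0// => w _; rewrite lee_fin.
have [ipp epp] := prod p p mp mp p0 p0 pabs pabs.
have [ipq epq] := prod p q mp mq p0 q0 pabs qabs.
have [iqp eqp] := prod q p mq mp q0 p0 qabs pabs.
have [iqq eqq] := prod q q mq mq q0 q0 qabs qabs.
have HKE : (fun w => H w * K w) = (fun w => (p (H w) * p (K w) - p (H w) * q (K w)) - (q (H w) * p (K w) - q (H w) * q (K w))).
  by apply/funext => w; rewrite {1}(pq (H w)) {1}(pq (K w)); ring.
have i1 : P.-integrable setT (EFin \o (fun w => p (H w) * p (K w) - p (H w) * q (K w))).
  exact: L1_B.
have i2 : P.-integrable setT (EFin \o (fun w => q (H w) * p (K w) - q (H w) * q (K w))).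
  exact: L1_B.
have ipH := ic p H mp pabs mHT iH; have iqH := ic q H mq qabs mHT iH.
have ipK := ic p K mp pabs mKT iK; have iqK := ic q K mq qabs mKT iK.
split; rewrite HKE; first exact: L1_B.
rewrite RintegralB// RintegralB// RintegralB// epp epq eqp eqq.
have -> : \int[P]_w H w = (\int[P]_w p (H w)) - (\int[P]_w q (H w)).
  by rewrite -RintegralB//; apply: eq_Rintegral => w _; exact: pq.
have -> : \int[P]_w K w = (\int[P]_w p (K w)) - (\int[P]_w q (K w)).
  by rewrite -RintegralB//; apply: eq_Rintegral => w _; exact: pq.
ring.
Qed.

End independent_pi_systems.

Definition mutually_independent d (T : measurableType d) (R : realType)
    (P : probability T R) (Y : nat -> T -> R) : Prop :=
  forall (N : nat) (B : nat -> set R), (forall k, measurable (B k)) ->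
    (P [set w | forall k, (k < N)%N -> B k (Y k w)] =
     \prod_(k < N) P (Y k @^-1` B k))%E.

Section independent_sums.
Context d (T : measurableType d) (R : realType) (P : probability T R).
Variable Y : nat -> T -> R.
Hypothesis mY : forall k, measurable_fun setT (Y k).
Hypothesis indY : mutually_independent P Y.

Let cyl (N : nat) : set (set T) :=
  [set A | exists B : nat -> set R, (forall k, measurable (B k)) /\
     A = [set w | forall k, (k < N)%N -> B k (Y k w)]].

Let last (N : nat) : set (set T) :=
  [set A | exists2 B : set R, measurable B & A = Y N @^-1` B].

Let mpre k (B : set R) : measurable B -> measurable (Y k @^-1` B).
Proof. by move=> mB; rewrite -[X in measurable X]setTI; exact: mY. Qed.

Let cylE N (B : nat -> set R) :
  [set w | forall k, (k < N)%N -> B k (Y k w)] =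
  \bigcap_(k in [set k | (k < N)%N]) (Y k @^-1` B k).
Proof. by apply/seteqP; split => w h k kN; exact: h. Qed.

Let sum (N : nat) w := \sum_(k < N) Y k w.

(** The events that depend on the first N variables and those that depend on
    the next one form two independent pi-systems, and the sum is measurable for
    the first. *)
Lemma independent_sum_last N (f g : R -> R) :
  measurable_fun setT f -> measurable_fun setT g ->
  P.-integrable setT (EFin \o (fun w => f (sum N w))) ->
  P.-integrable setT (EFin \o (fun w => g (Y N w))) ->
  P.-integrable setT (EFin \o (fun w => f (sum N w) * g (Y N w))) /\
  \int[P]_w (f (sum N w) * g (Y N w)) =
  (\int[P]_w f (sum N w)) * (\int[P]_w g (Y N w)).
Proof.
move=> mf mg.
apply: (@independent_expectationM _ _ _ P (cyl N) (last N)).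
- move=> A [B [mB ->]]; rewrite cylE.
  by apply: bigcap_measurableType => k _; exact: mpre.
- by exists (fun=> setT); split => //; apply/seteqP.
- move=> A A' [B [mB ->]] [B' [mB' ->]].
  exists (fun k => B k `&` B' k); split=> [k|]; first exact: measurableI.
  by apply/seteqP; split => w /= => [[h h'] k kN|h]; [split; [exact: h|exact: h']|split=> k /h[]].
- by move=> A [B mB ->]; exact: mpre.
- by exists setT => //.
- by move=> A A' [B mB ->] [B' mB' ->]; exists (B `&` B') => //; exact: measurableI.
- move=> A A' [B [mB ->]] [B' mB' ->].
  pose C k := if (k < N)%N then B k else B'.
  have mC k : measurable (C k) by rewrite /C; case: ifP.
  transitivity (P [set w | forall k, (k < N.+1)%N -> C k (Y k w)]).
    congr (P _); apply/seteqP; split => w /=.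
      move=> [h h'] k; rewrite ltnS leq_eqVlt => /orP[/eqP ->|kN].
        by rewrite /C ltnn.
      by rewrite /C kN; exact: h.
    move=> h; split=> [k kN|]; last by have := h N (ltnSn N); rewrite /C ltnn.
    by have := h k (ltnW kN); rewrite /C kN.
  rewrite indY// indY// big_ord_recr/= {2}/C ltnn; congr (_ * _)%E.
  by apply: eq_bigr => k _; rewrite /C ltn_ord.
- apply: measurableT_comp => //.
  apply: (@measurable_sum _ (g_sigma_algebraType (cyl N)) R setT _ _ (fun k : 'I_N => Y k)) => k.
  move=> _ B mB; rewrite setTI; apply: sub_sigma_algebra.
  exists (fun l => if l == k :> nat then B else setT); split=> [l|]; first by case: ifP.
  apply/seteqP; split => w /= => [h l lN|h]; first by case: eqP => // ->.
  by have := h k (ltn_ord k); rewrite eqxx.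
- apply: measurableT_comp => //.
  by move=> _ B mB; rewrite setTI; apply: sub_sigma_algebra; exists B.
Qed.

End independent_sums.

(** * Characteristic functions and the central limit theorem *)

Section taylor_bounds.
Context {R : realType}.
Implicit Types x u : R.

Lemma normr_sin_le x : `|sin x| <= `|x|.
Proof.
wlog x0 : x / 0 <= x => [hw|].
  have [/hw//|/ltW x0] := leP 0 x.
  by rewrite -normrN -sinN -(normrN x); apply: hw; rewrite oppr_ge0.
have [c _ e] : exists2 c, c \in `[0, x] & sin x - sin 0 = cos c * (x - 0).
  apply: MVT_segment => //.
  by apply: continuous_subspaceT => y; exact: continuous_sin.
move: e; rewrite sin0 !subr0 => ->.
by rewrite normrM ler_piMl// cos_max.
Qed.

Lemma cos_half_sin x : 1 - cos x = 2 * sin (x / 2) ^+ 2.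
Proof.
have -> : cos x = cos ((x / 2) *+ 2) by congr cos; rewrite mulr2n; lra.
rewrite cos_mulr2n cos2sin2 mulr2n; ring.
Qed.

Lemma onem_cos_ge0 x : 0 <= 1 - cos x.
Proof. by rewrite cos_half_sin mulr_ge0// sqr_ge0. Qed.

Lemma onem_cos_le x : 1 - cos x <= x ^+ 2 / 2.
Proof.
rewrite cos_half_sin.
have : sin (x / 2) ^+ 2 <= (x / 2) ^+ 2.
  by rewrite -real_normK ?num_real// -[leRHS]real_normK ?num_real// ler_sqr ?nnegrE// normr_sin_le.
by move=> h; lra.
Qed.

Lemma sin_taylor1 x : `|sin x - x| <= `|x| ^+ 3 / 2.
Proof.
wlog x0 : x / 0 <= x => [hw|].
  have [/hw//|/ltW x0] := leP 0 x.
  have := hw (- x); rewrite oppr_ge0 sinN opprK => /(_ x0).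
  have e : - sin x + x = - (sin x - x) by ring.
  by rewrite e !normrN; apply.
have [c] : exists2 c, c \in `[0, x] & (sin x - x) - (sin 0 - 0) = (cos c - 1) * (x - 0).
  apply: (@MVT_segment _ (fun y => sin y - y) (fun y => cos y - 1)) => //.
  apply: continuous_subspaceT => y; apply: cvgB; last exact: cvg_id.
  exact: continuous_sin.
rewrite in_itv/= => /andP[c0 cx]; rewrite sin0 !subr0 => ->.
rewrite normrM (ger0_norm x0) distrC (ger0_norm (onem_cos_ge0 _)).
have h1 := onem_cos_le c.
have h2 : c ^+ 2 <= x ^+ 2 by rewrite ler_sqr.
rewrite exprS mulrC -mulrA ler_wpM2l//; lra.
Qed.

(** Cubic near 0 and linear at infinity, the error is bounded by a square
    everywhere: an integrable majorant for a variable with two moments. *)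
Lemma sin_taylor1_sqr x : `|sin x - x| <= x ^+ 2.
Proof.
have [x2|x2] := leP `|x| 2.
  rewrite (le_trans (sin_taylor1 x))// -[leRHS]real_normK ?num_real// exprS.
  have : 0 <= `|x| ^+ 2 by rewrite sqr_ge0.
  by nra.
rewrite (le_trans (ler_normB _ _))// -[leRHS]real_normK ?num_real//.
have := normr_sin_le x; nra.
Qed.

Lemma cos_taylor2_sqr x : `|cos x - 1 + x ^+ 2 / 2| <= x ^+ 2 / 2.
Proof.
have := onem_cos_ge0 x; have := onem_cos_le x => h1 h2.
by rewrite ler_norml; apply/andP; split; lra.
Qed.

Lemma cos_taylor2 x : `|cos x - 1 + x ^+ 2 / 2| <= x ^+ 4.
Proof.
have := onem_cos_le x; have := cos_half_sin x => h1 h2.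
rewrite ger0_norm; last lra.
have -> : cos x = 1 - 2 * sin (x / 2) ^+ 2 by lra.
set s := sin (x / 2).
have e1 : `|s - x / 2| <= `|x / 2| ^+ 3 / 2 by exact: sin_taylor1.
have e2 : `|s + x / 2| <= 2 * `|x / 2|.
  by rewrite (le_trans (ler_normD _ _))// mulr2n mulrDl mul1r lerD2r normr_sin_le.
have -> : 1 - 2 * s ^+ 2 - 1 + x ^+ 2 / 2 = - 2 * ((s - x / 2) * (s + x / 2)).
  by field.
rewrite (le_trans (ler_norm _))// normrM normrN (@ger0_norm _ 2)// (normrM (s - _)).
have h : `|s - x / 2| * `|s + x / 2| <= (`|x / 2| ^+ 3 / 2) * (2 * `|x / 2|).
  by apply: ler_pM.
have e4 : (`|x / 2| ^+ 3 / 2) * (2 * `|x / 2|) = x ^+ 4 / 16.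
  have -> : x ^+ 4 = `|x| ^+ 4 by rewrite -normrX ger0_norm// exprn_even_ge0.
  by rewrite normrM (@ger0_norm _ 2^-1)//; field.
have : 0 <= x ^+ 4 by rewrite exprn_even_ge0.
rewrite e4 in h; lra.
Qed.

Lemma expRN_taylor1 x : 0 <= x -> `|expR (- x) - 1 + x| <= x ^+ 2.
Proof.
move=> x0; have h1 := expR_ge1Dx (- x).
have h2 := expR_ge1Dx x.
have h3 : expR (- x) * expR x = 1 by rewrite -expRD addNr expR0.
have h4 := expR_gt0 (- x).
rewrite ger0_norm; last lra.
nra.
Qed.

End taylor_bounds.

Section characteristic_functions.
Context d (T : measurableType d) (R : realType) (P : probability T R).
Local Notation L1 f := (P.-integrable setT (EFin \o f)).

Lemma measurable_cos : measurable_fun setT (@cos R).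
Proof. by apply: continuous_measurable_fun; exact: continuous_cos. Qed.

Lemma measurable_sin : measurable_fun setT (@sin R).
Proof. by apply: continuous_measurable_fun; exact: continuous_sin. Qed.

Lemma L1_cos (f : T -> R) : measurable_fun setT f -> L1 (fun w => cos (f w)).
Proof.
move=> mf; apply: (@L1_bounded _ _ _ P _ 1) => [|w]; last exact: cos_max.
by apply: measurableT_comp => //; exact: measurable_cos.
Qed.

Lemma L1_sin (f : T -> R) : measurable_fun setT f -> L1 (fun w => sin (f w)).
Proof.
move=> mf; apply: (@L1_bounded _ _ _ P _ 1) => [|w]; last exact: sin_max.
by apply: measurableT_comp => //; exact: measurable_sin.
Qed.

Lemma normr_expec_le1 (f : T -> R) : measurable_fun setT f ->
  (forall w, `|f w| <= 1) -> `|\int[P]_w f w| <= 1.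
Proof.
move=> mf f1; have := @normr_expec_le _ _ _ P f (fun=> 1) (L1_bounded P mf f1) (L1_cst P 1) f1.
by rewrite expec_cst.
Qed.

Lemma expec_dominated_cvg (f_ : nat -> T -> R) (f g : T -> R) :
  (forall n, measurable_fun setT (f_ n)) ->
  (forall w, f_ n w @[n --> \oo] --> f w) ->
  L1 g -> (forall n w, `|f_ n w| <= g w) ->
  \int[P]_w f_ n w @[n --> \oo] --> \int[P]_w f w.
Proof.
move=> mf_ f_f Ig fg.
have mf : measurable_fun setT f.
  by apply: (measurable_fun_cvg mf_) => w _; exact: f_f.
have If : L1 f.
  apply: L1_le Ig => // w.
  apply: (@ler_cvg_to _ \oo _ _ (fun n => `|f_ n w|) (fun=> g w)).
  - by apply: cvg_norm; exact: f_f.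
  - exact: cvg_cst.
  - by apply: nearW => n; exact: fg.
apply: fine_cvg; rewrite -/(Rintegral _ _ _) EFin_expec//.
apply: (@dominated_cvg _ _ _ _ _ measurableT (fun n w => (f_ n w)%:E) _ (EFin \o g)) => //.
- by move=> n; exact/measurable_EFinP.
- by move=> w _; apply: cvg_EFin; [exact: nearW|exact: f_f].
- by move=> n w _; rewrite lee_fin.
Qed.

Lemma expec_cosD (f : T -> R) (th : R) : measurable_fun setT f ->
  \int[P]_w cos (f w + th) =
  cos th * (\int[P]_w cos (f w)) - sin th * (\int[P]_w sin (f w)).
Proof.
move=> mf; rewrite -!expecZ; [|exact: L1_sin|exact: L1_cos].
rewrite -expecB; [|apply: L1_Z; exact: L1_cos|apply: L1_Z; exact: L1_sin].
by apply: expec_eq => w; rewrite cosD mulrC [sin _ * _]mulrC.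
Qed.

End characteristic_functions.

Lemma mutually_independent_comp d (T : measurableType d) (R : realType)
    (P : probability T R) (Y : nat -> T -> R) (g : nat -> R -> R) :
  (forall k, measurable_fun setT (g k)) -> mutually_independent P Y ->
  mutually_independent P (fun k w => g k (Y k w)).
Proof.
move=> mg indY N B mB.
by apply: (indY N (fun k => g k @^-1` B k)) => k; rewrite -[X in measurable X]setTI; exact: mg.
Qed.

Section sums_of_independent_variables.
Context d (T : measurableType d) (R : realType) (P : probability T R).
Variable Y : nat -> T -> R.
Hypothesis mY : forall k, measurable_fun setT (Y k).
Hypothesis indY : mutually_independent P Y.

Let S N w := \sum_(k < N) Y k w.

Let mS N : measurable_fun setT (S N).
Proof. by apply: measurable_sum => k; exact: mY. Qed.

Lemma expec_cos_sum_recr N :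
  \int[P]_w cos (S N.+1 w) =
  (\int[P]_w cos (S N w)) * (\int[P]_w cos (Y N w)) -
  (\int[P]_w sin (S N w)) * (\int[P]_w sin (Y N w)).
Proof.
have [i1 <-] := independent_sum_last mY indY (N := N) (measurable_cos (R := R)) (measurable_cos (R := R))
  (L1_cos P (mS N)) (L1_cos P (mY N)).
have [i2 <-] := independent_sum_last mY indY (N := N) (measurable_sin (R := R)) (measurable_sin (R := R))
  (L1_sin P (mS N)) (L1_sin P (mY N)).
rewrite -expecB//; apply: expec_eq => w.
by rewrite /S big_ord_recr/= cosD.
Qed.

Lemma expec_sin_sum_recr N :
  \int[P]_w sin (S N.+1 w) =
  (\int[P]_w sin (S N w)) * (\int[P]_w cos (Y N w)) +
  (\int[P]_w cos (S N w)) * (\int[P]_w sin (Y N w)).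
Proof.
have [i1 <-] := independent_sum_last mY indY (N := N) (measurable_sin (R := R)) (measurable_cos (R := R))
  (L1_sin P (mS N)) (L1_cos P (mY N)).
have [i2 <-] := independent_sum_last mY indY (N := N) (measurable_cos (R := R)) (measurable_sin (R := R))
  (L1_cos P (mS N)) (L1_sin P (mY N)).
rewrite -expecD//; apply: expec_eq => w.
by rewrite /S big_ord_recr/= sinD.
Qed.

Let sum0 w : S 0 w = 0.
Proof. by rewrite /S big_ord0. Qed.

Lemma expec_sqr_sum (v : R) N : (forall k, L2fun P (Y k)) ->
  (forall k, \int[P]_w Y k w = 0) ->
  (forall k, \int[P]_w (Y k w ^+ 2) = v) ->
  \int[P]_w (S N w ^+ 2) = N%:R * v.
Proof.
move=> L2Y Y0 Yv; elim: N => [|N ih].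
  by under expec_eq do rewrite sum0 expr0n/=; rewrite expec_cst mul0r.
have L2S : L2fun P (S N) by apply: L2_sum.
have [i1 e1] := independent_sum_last mY indY (N := N) (@measurable_id _ R setT) (@measurable_id _ R setT)
  (L2_L1 L2S) (L2_L1 (L2Y N)).
under expec_eq => w.
  have -> : S N.+1 w ^+ 2 = (S N w ^+ 2 + 2 * (S N w * Y N w)) + Y N w ^+ 2.
    by rewrite /S big_ord_recr/=; ring.
  over.
rewrite expecD; [|apply: L1_D; [exact: L2_sqr|exact: L1_Z]|exact: L2_sqr].
rewrite expecD; [|exact: L2_sqr|exact: L1_Z].
by rewrite expecZ// e1 Y0 ih Yv -natr1; ring.
Qed.

(** In complex notation |(c + i s)^N - q^N| <= N |c + i s - q|, all the numbers
    having modulus at most 1; here the real and imaginary parts are bounded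
    separately, by the recursions above. *)
Lemma expec_cos_sin_sum_le (c s q : R) N : 0 <= q <= 1 ->
  (forall k, \int[P]_w cos (Y k w) = c) ->
  (forall k, \int[P]_w sin (Y k w) = s) ->
  `|(\int[P]_w cos (S N w)) - q ^+ N| <= N%:R * (`|c - q| + `|s|) /\
  `|\int[P]_w sin (S N w)| <= N%:R * (`|c - q| + `|s|).
Proof.
move=> /andP[q0 q1] Yc Ys.
have a1 n : `|\int[P]_w cos (S n w)| <= 1.
  apply: normr_expec_le1 => [|w]; last exact: cos_max.
  by apply: measurableT_comp => //; exact: measurable_cos.
have b1 n : `|\int[P]_w sin (S n w)| <= 1.
  apply: normr_expec_le1 => [|w]; last exact: sin_max.
  by apply: measurableT_comp => //; exact: measurable_sin.
elim: N => [|N [iha ihb]].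
  under expec_eq do rewrite sum0 cos0.
  under [X in _ /\ `|X| <= _]expec_eq do rewrite sum0 sin0.
  by rewrite !expec_cst expr0 subrr normr0 mul0r.
rewrite expec_cos_sum_recr expec_sin_sum_recr Yc Ys.
have := a1 N; have := b1 N; move: iha ihb.
set a := \int[P]_w cos (S N w); set b := \int[P]_w sin (S N w) => iha ihb b1N a1N.
set e := `|c - q| + `|s| in iha ihb *.
have bnd (x y z t : R) : `|x| <= 1 -> `|y| <= 1 -> `|z| <= N%:R * e ->
    `|t| = `|s| -> `|x * (c - q) + q * z + y * t| <= N.+1%:R * e.
  move=> x1 y1 ze ts; rewrite -natr1 mulrDl mul1r.
  have h1 : `|x * (c - q)| <= `|c - q| by rewrite normrM ler_piMl.
  have h2 : `|q * z| <= N%:R * e.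
    by rewrite normrM (ger0_norm q0) (le_trans _ ze)// ler_piMl.
  have h3 : `|y * t| <= `|s| by rewrite normrM ts ler_piMl.
  have := ler_normD (x * (c - q) + q * z) (y * t).
  have := ler_normD (x * (c - q)) (q * z).
  rewrite /e in h2 *; lra.
split.
  have -> : a * c - b * s - q ^+ N.+1 = a * (c - q) + q * (a - q ^+ N) + b * - s.
    by rewrite exprS; ring.
  by apply: bnd => //; rewrite normrN.
have -> : b * c + a * s = b * (c - q) + q * b + a * s by ring.
exact: bnd.
Qed.

End sums_of_independent_variables.

Section central_limit.
Context {R : realType}.

Lemma cvg_normr_le (u e : nat -> R) (l : R) :
  (\forall n \near \oo, `|u n - l| <= e n) -> e n @[n --> \oo] --> 0 ->
  u n @[n --> \oo] --> l.
Proof.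
move=> ue e0; apply/cvgrPdist_le => eps eps0; near=> n.
rewrite distrC (@le_trans _ _ (e n))//; first by near: n.
by near: n; apply: cvgr_le e0 _ eps0.
Unshelve. all: by end_near. Qed.

Lemma cvg_invn (c : R) : c / n%:R @[n --> \oo] --> 0.
Proof.
rewrite -(mulr0 c); apply: cvgM; first exact: cvg_cst.
by apply/gtr0_cvgV0; [exact: nbhs_infty_gtr|exact: cvgr_idn].
Qed.

Lemma cvg_invsqrtn (c : R) : c / Num.sqrt n%:R @[n --> \oo] --> 0.
Proof.
rewrite -(mulr0 c); apply: cvgM; first exact: cvg_cst.
apply/cvgrPdist_le => e e0; near=> n.
rewrite sub0r normrN ger0_norm ?invr_ge0 ?sqrtr_ge0//.
have n0 : 0 < (n%:R : R) by near: n; exact: nbhs_infty_gtr.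
rewrite -(invrK e) lef_pV2 ?posrE ?invr_gt0 ?sqrtr_gt0//.
have h : Num.sqrt (e^-1 ^+ 2) = e^-1 by rewrite sqrtr_sqr ger0_norm ?invr_ge0 ?ltW.
rewrite -h ler_sqrt ?ltW//.
by near: n; exact: nbhs_infty_gtr.
Unshelve. all: by end_near. Qed.

Context d (T : measurableType d) (P : probability T R).
Local Notation L1 f := (P.-integrable setT (EFin \o f)).

Let sq N : Num.sqrt (N%:R : R) ^+ 2 = N%:R.
Proof. by rewrite sqr_sqrtr. Qed.

(** Dominated convergence: N times the Taylor error at y = Y / sqrt N is at most
    Y^4 / N, and at most Y^2 for all N. *)
Lemma cos_taylor_cvg (Y : T -> R) : L2fun P Y ->
  N%:R * (\int[P]_w (cos (Y w / Num.sqrt N%:R) - 1 + (Y w / Num.sqrt N%:R) ^+ 2 / 2))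
    @[N --> \oo] --> 0.
Proof.
move=> [mY IY].
have mf N : measurable_fun setT
    (fun w => cos (Y w / Num.sqrt N%:R) - 1 + (Y w / Num.sqrt N%:R) ^+ 2 / 2).
  have m1 : measurable_fun setT (fun w => Y w / Num.sqrt N%:R) by exact: measurable_funM.
  apply: measurable_funD; last by apply: measurable_funM => //; exact: measurable_funX.
  apply: measurable_funB => //.
  by apply: measurableT_comp => //; exact: measurable_cos.
have sqE N w : (Y w / Num.sqrt N%:R) ^+ 2 = Y w ^+ 2 / N%:R by rewrite expr_div_n sq.
have IYN N : L1 (fun w => (Y w / Num.sqrt N%:R) ^+ 2 / 2).
  by apply: eq_L1 (L1_Z (2^-1 / N%:R) IY) => w; rewrite sqE; ring.
have If N : L1 (fun w => cos (Y w / Num.sqrt N%:R) - 1 + (Y w / Num.sqrt N%:R) ^+ 2 / 2).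
  by apply: L1_le (IYN N) => // w; exact: cos_taylor2_sqr.
suff : \int[P]_w (N%:R * (cos (Y w / Num.sqrt N%:R) - 1 + (Y w / Num.sqrt N%:R) ^+ 2 / 2)) @[N --> \oo] --> \int[P]_w (0 : R).
  rewrite expec_cst; apply: cvg_trans; apply: near_eq_cvg.
  by apply: nearW => N; rewrite expecZ.
apply: (@expec_dominated_cvg _ _ _ _ _ _ (fun w => Y w ^+ 2)) => //.
- by move=> N; apply: measurable_funM.
- move=> w; apply/norm_cvg0P.
  apply: (@squeeze_cvgr _ _ _ _ (fun=> 0) (fun N => Y w ^+ 4 / N%:R)).
  + near=> N; rewrite normr_ge0/= normrM ger0_norm//.
    have N0 : 0 < (N%:R : R) by near: N; exact: nbhs_infty_gtr.
    rewrite mulrC -ler_pdivlMr//.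
    rewrite (le_trans (cos_taylor2 _))// -(mulrA (Y w ^+ 4)) -invfM -expr2.
    have e (z : R) : z ^+ 4 = (z ^+ 2) ^+ 2 by rewrite -exprM.
    by rewrite e [Y w ^+ 4]e sqE expr_div_n.
  + exact: cvg_cst.
  + exact: cvg_invn.
- move=> N w; rewrite normrM ger0_norm//.
  have [->|N0] := eqVneq N 0%N; first by rewrite mul0r sqr_ge0.
  have N0' : 0 < (N%:R : R) by rewrite ltr0n lt0n.
  rewrite mulrC -ler_pdivlMr// (le_trans (cos_taylor2_sqr _))// sqE.
  by rewrite ler_pdivrMr// ler_peMr// ?divr_ge0 ?sqr_ge0// ler1n.
Unshelve. all: by end_near. Qed.

Lemma sin_taylor_cvg (Y : T -> R) : L2fun P Y ->
  N%:R * (\int[P]_w (sin (Y w / Num.sqrt N%:R) - Y w / Num.sqrt N%:R))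
    @[N --> \oo] --> 0.
Proof.
move=> hY; have [mY IY] := hY.
have m1 N : measurable_fun setT (fun w => Y w / Num.sqrt N%:R) by exact: measurable_funM.
have mf N : measurable_fun setT (fun w => sin (Y w / Num.sqrt N%:R) - Y w / Num.sqrt N%:R).
  apply: measurable_funB => //.
  by apply: measurableT_comp => //; exact: measurable_sin.
have sqE N w : (Y w / Num.sqrt N%:R) ^+ 2 = Y w ^+ 2 / N%:R by rewrite expr_div_n sq.
have IYN N : L1 (fun w => (Y w / Num.sqrt N%:R) ^+ 2).
  by apply: eq_L1 (L1_Z (N%:R^-1) IY) => w; rewrite sqE mulrC.
have If N : L1 (fun w => sin (Y w / Num.sqrt N%:R) - Y w / Num.sqrt N%:R).
  by apply: L1_le (IYN N) => // w; exact: sin_taylor1_sqr.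
suff : \int[P]_w (N%:R * (sin (Y w / Num.sqrt N%:R) - Y w / Num.sqrt N%:R)) @[N --> \oo] --> \int[P]_w (0 : R).
  rewrite expec_cst; apply: cvg_trans; apply: near_eq_cvg.
  by apply: nearW => N; rewrite expecZ.
apply: (@expec_dominated_cvg _ _ _ _ _ _ (fun w => Y w ^+ 2)) => //.
- by move=> N; apply: measurable_funM.
- move=> w; apply/norm_cvg0P.
  apply: (@squeeze_cvgr _ _ _ _ (fun=> 0) (fun N => `|Y w| ^+ 3 / Num.sqrt N%:R)).
  + near=> N; rewrite normr_ge0/= normrM ger0_norm//.
    have N0 : 0 < (N%:R : R) by near: N; exact: nbhs_infty_gtr.
    have s0 : 0 < Num.sqrt (N%:R : R) by rewrite sqrtr_gt0.
    have h := sin_taylor1 (Y w / Num.sqrt N%:R).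
    apply: (@le_trans _ _ (N%:R * (`|Y w / Num.sqrt N%:R| ^+ 3 / 2))).
      by rewrite ler_wpM2l.
    rewrite normrM normfV (ger0_norm (ltW s0)) -{1}(sq N).
    set s := Num.sqrt _ in s0 *; set y := `|Y w|.
    have -> : s ^+ 2 * ((y / s) ^+ 3 / 2) = (y ^+ 3 / s) / 2 by field; rewrite gt_eqF.
    have y0 : 0 <= y by exact: normr_ge0.
    have : 0 <= y ^+ 3 / s by apply: divr_ge0; [exact: exprn_ge0|exact: ltW].
    lra.
  + exact: cvg_cst.
  + exact: cvg_invsqrtn.
- move=> N w; rewrite normrM ger0_norm//.
  have [->|N0] := eqVneq N 0%N; first by rewrite mul0r sqr_ge0.
  have N0' : 0 < (N%:R : R) by rewrite ltr0n lt0n.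
  by rewrite mulrC -ler_pdivlMr// (le_trans (sin_taylor1_sqr _))// sqE.
Unshelve. all: by end_near. Qed.

(** The expectations c_N and s_N of cos and sin at Y / sqrt N are
    1 - v / (2 N) + o(1 / N) and o(1 / N), so the characteristic function of the
    sum is close to the N-th power of q_N = exp(- v / (2 N)), which is
    exp(- v / 2).  The shift th gives access to sines as well as to cosines. *)
Theorem central_limit_cos (Y : nat -> T -> R) (v th : R) :
  mutually_independent P Y -> (forall k, measurable_fun setT (Y k)) ->
  (forall k (g : R -> R), measurable_fun setT g ->
     \int[P]_w g (Y k w) = \int[P]_w g (Y 0%N w)) ->
  L2fun P (Y 0%N) -> \int[P]_w Y 0%N w = 0 -> \int[P]_w (Y 0%N w ^+ 2) = v ->
  \int[P]_w cos ((\sum_(k < N) Y k w) / Num.sqrt N%:R + th) @[N --> \oo]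
    --> cos th * expR (- v / 2).
Proof.
move=> indY mY idY L2Y EY EY2.
have v0 : 0 <= v by rewrite -EY2; apply: expec_ge0 => w; exact: sqr_ge0.
pose y N k w := Y k w / Num.sqrt (N%:R : R).
have my N k : measurable_fun setT (y N k) by exact: measurable_funM.
have indy N : mutually_independent P (y N).
  by apply: (mutually_independent_comp (g := fun k x => x / Num.sqrt N%:R)) => // k; exact: measurable_funM.
pose c N := \int[P]_w cos (y N 0%N w); pose s N := \int[P]_w sin (y N 0%N w).
pose q (N : nat) : R := expR (- (v / 2 / N%:R)).
have q01 N : 0 <= q N <= 1.
  by rewrite expR_ge0 -expR0 ler_expR oppr_le0 !divr_ge0.
have sumE N w : (\sum_(k < N) Y k w) / Num.sqrt N%:R = \sum_(k < N) y N k w.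
  by rewrite mulr_suml.
have bnd N := expec_cos_sin_sum_le (my N) (indy N) N (c := c N) (s := s N) (q01 N).
have bc N k : \int[P]_w cos (y N k w) = c N.
  rewrite /c /y (idY k (fun x => cos (x / Num.sqrt N%:R)))//.
  apply: measurableT_comp; first exact: measurable_cos.
  exact: measurable_funM.
have bs N k : \int[P]_w sin (y N k w) = s N.
  rewrite /s /y (idY k (fun x => sin (x / Num.sqrt N%:R)))//.
  apply: measurableT_comp; first exact: measurable_sin.
  exact: measurable_funM.
have cs N := bnd N (bc N) (bs N).
have Ns : N%:R * s N @[N --> \oo] --> 0.
  have := sin_taylor_cvg L2Y; apply: cvg_trans; apply: near_eq_cvg.
  apply: nearW => N; congr (_ * _); rewrite expecB; last 2 first.
  - by apply: L1_sin; exact: (my N 0%N).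
  - by apply: eq_L1 (L1_Z (Num.sqrt N%:R)^-1 (L2_L1 L2Y)) => w; rewrite mulrC.
  under [X in _ - X]expec_eq do rewrite mulrC.
  by rewrite expecZ ?EY ?mulr0 ?subr0//; exact: L2_L1.
have Nc : N%:R * (c N - 1 + v / 2 / N%:R) @[N --> \oo] --> 0.
  have := cos_taylor_cvg L2Y; apply: cvg_trans; apply: near_eq_cvg.
  apply: nearW => N; congr (_ * _).
  have sqE w : (Y 0%N w / Num.sqrt N%:R) ^+ 2 / 2 = (2^-1 / N%:R) * Y 0%N w ^+ 2.
    by rewrite expr_div_n sq; ring.
  under expec_eq do rewrite sqE.
  rewrite expecD; last 2 first.
  - by apply: L1_B; [apply: L1_cos; exact: (my N 0%N)|exact: L1_cst].
  - by apply: L1_Z; exact: L2_sqr.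
  rewrite expecB; [|apply: L1_cos; exact: (my N 0%N)|exact: L1_cst].
  by rewrite expec_cst expecZ ?EY2; [rewrite /c; ring|exact: L2_sqr].
have Nq : N%:R * (q N - 1 + v / 2 / N%:R) @[N --> \oo] --> 0.
  apply/norm_cvg0P.
  apply: (@squeeze_cvgr _ _ _ _ (fun=> 0) (fun N => (v / 2) ^+ 2 / N%:R)).
  - near=> N; rewrite normr_ge0/= normrM ger0_norm//.
    have N0 : 0 < (N%:R : R) by near: N; exact: nbhs_infty_gtr.
    rewrite mulrC -ler_pdivlMr// (le_trans (expRN_taylor1 _)) ?divr_ge0//.
    by rewrite -(mulrA ((v / 2) ^+ 2)) -invfM -expr2 expr_div_n.
  - exact: cvg_cst.
  - exact: cvg_invn.
have err : N%:R * (`|c N - q N| + `|s N|) @[N --> \oo] --> 0.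
  have : `|N%:R * (c N - 1 + v / 2 / N%:R) - N%:R * (q N - 1 + v / 2 / N%:R) : R| + `|N%:R * s N : R| @[N --> \oo] --> (`|0 - 0 : R| + `|0 : R| : R).
    by apply: cvgD; apply: cvg_norm => //; exact: cvgB.
  rewrite subr0 normr0 addr0; apply: cvg_trans; apply: near_eq_cvg.
  apply: nearW => N; rewrite -mulrBr !normrM ger0_norm// -mulrDr.
  by congr (_ * (`|_| + _)); ring.
have cosq : \int[P]_w cos (\sum_(k < N) y N k w) @[N --> \oo] --> expR (- v / 2).
  apply: cvg_normr_le err; near=> N; have [h _] := cs N.
  have N0 : 0 < (N%:R : R) by near: N; exact: nbhs_infty_gtr.
  suff -> : expR (- v / 2) = q N ^+ N by [].
  by rewrite -expRM_natl; congr expR; field; rewrite gt_eqF.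
have sin0 : \int[P]_w sin (\sum_(k < N) y N k w) @[N --> \oo] --> 0.
  apply: cvg_normr_le err; near=> N; rewrite subr0; exact: (cs N).2.
have : cos th * (\int[P]_w cos (\sum_(k < N) y N k w)) - sin th * (\int[P]_w sin (\sum_(k < N) y N k w)) @[N --> \oo] --> cos th * expR (- v / 2) - sin th * 0.
  by apply: cvgB; apply: cvgM => //; exact: cvg_cst.
rewrite mulr0 subr0; apply: cvg_trans; apply: near_eq_cvg; apply: nearW => N.
rewrite -expec_cosD; first by apply: expec_eq => w; rewrite sumE.
by apply: measurable_sum => k; exact: my.
Unshelve. all: by end_near. Qed.

End central_limit.

(** * Approximation by polynomials in sines *)

Section bernstein.
Context {R : realType} {m : nat}.
Implicit Types (s : seq 'I_m) (g h : ('I_m -> nat) -> R) (y : 'I_m -> R).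

(** Each entry j of s tosses an independent coin that shows heads with
    probability y j; [bernstein s g y] is the expectation of g at the numbers of
    heads of all coordinates.  As a function of y it is a Bernstein polynomial,
    and this recursion on the list of coins gives its positivity, its variance
    and, later, its trigonometric expansion. *)
Definition incr_count (i : 'I_m) (K : 'I_m -> nat) : 'I_m -> nat :=
  fun j => ((j == i) + K j)%N.

Fixpoint bernstein s g y : R :=
  if s is i :: s' then
    y i * bernstein s' (fun K => g (incr_count i K)) y +
    (1 - y i) * bernstein s' g y
  else g (fun=> 0%N).

Lemma bernstein_le s g h y : (forall i, 0 <= y i <= 1) ->
  (forall K, g K <= h K) -> bernstein s g y <= bernstein s h y.
Proof.
move=> y01; elim: s g h => [|i s ih] g h gh //=.
have /andP[y0 y1] := y01 i.
by apply: lerD; rewrite ler_wpM2l ?subr_ge0//; apply: ih => K; exact: gh.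
Qed.

Lemma bernstein_lin s a b g h y :
  bernstein s (fun K => a * g K + b * h K) y =
  a * bernstein s g y + b * bernstein s h y.
Proof.
elim: s g h => [|i s ih] g h //=.
have := ih (fun K => g (incr_count i K)) (fun K => h (incr_count i K)).
by move=> /= h'; rewrite h' ih; ring.
Qed.

Lemma bernstein_cst s c y : bernstein s (fun=> c) y = c.
Proof. by elim: s => //= i s ->; ring. Qed.

Lemma bernstein_sum s (g : 'I_m -> ('I_m -> nat) -> R) y :
  bernstein s (fun K => \sum_(i < m) g i K) y = \sum_(i < m) bernstein s (g i) y.
Proof.
elim: s g => [|i s ih] g //=.
have := ih (fun j K => g j (incr_count i K)).
by move=> /= h'; rewrite h' ih big_split/= -!mulr_sumr.
Qed.

(** Bias-variance decomposition of a binomial variable, the parameter a being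
    free so that the induction can shift it by one head. *)
Lemma bernstein_variance s i a y :
  bernstein s (fun K => ((K i)%:R - a) ^+ 2) y =
  ((count_mem i s)%:R * y i - a) ^+ 2 + (count_mem i s)%:R * y i * (1 - y i).
Proof.
elim: s a => [|j s ih] a //=; first by ring.
have [eij|ji] := eqVneq i j.
  rewrite -{j}eij; have := ih (a - 1); have := ih a.
  have -> : (fun K : 'I_m -> nat => ((K i)%:R - (a - 1)) ^+ 2) =
            (fun K : 'I_m -> nat => ((incr_count i K i)%:R - a) ^+ 2) :> (_ -> R).
    by apply/funext => K; rewrite /incr_count eqxx add1n -natr1; ring.
  by move=> -> ->; rewrite add1n -natr1; ring.
have -> : (fun K : 'I_m -> nat => ((incr_count j K i)%:R - a) ^+ 2) =
          (fun K : 'I_m -> nat => ((K i)%:R - a) ^+ 2) :> (_ -> R).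
  by apply/funext => K; rewrite /incr_count (negbTE ji).
by rewrite ih add0n; ring.
Qed.

Lemma bernstein_normr_le s g y (M : R) : (forall i, 0 <= y i <= 1) ->
  (forall K, `|g K| <= M) -> `|bernstein s g y| <= M.
Proof.
move=> y01 gM; rewrite ler_norml; apply/andP; split.
  rewrite -(bernstein_cst s (- M) y); apply: bernstein_le => // K.
  by have := gM K; rewrite ler_norml => /andP[].
rewrite -(bernstein_cst s M y); apply: bernstein_le => // K.
by have := gM K; rewrite ler_norml => /andP[].
Qed.

Definition flips (n : nat) : seq 'I_m := iter n (cat (enum 'I_m)) [::].

Lemma count_flips n i : count_mem i (flips n) = n.
Proof.
rewrite /flips; elim: n => //= n ih.
by rewrite count_cat ih count_uniq_mem ?enum_uniq// mem_enum.
Qed.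

End bernstein.

Section box.
Context {R : realType}.

Lemma box_uniform_continuity (m : nat) (f : 'rV[R]_m -> R) (A e : R) :
  continuous f -> 0 < e ->
  exists2 delta, 0 < delta & forall x y : 'rV[R]_m, (forall i, `|x ord0 i| <= A) ->
    (forall i, `|x ord0 i - y ord0 i| <= delta) -> `|f x - f y| <= e.
Proof.
move=> cf e0.
have cbox : compact [set v : 'rV[R]_m | forall i, `[- A, A]%classic (v ord0 i)].
  by apply: (@rV_compact R m (fun=> `[- A, A]%classic)) => i; exact: segment_compact.
have /compact_near_coveringP cov := cbox.
pose Q (delta : R) (x : 'rV[R]_m) := forall y : 'rV[R]_m,
  (forall i, `|x ord0 i - y ord0 i| <= delta) -> `|f x - f y| <= e.
have key : nbhs (0 : R)^'+ [set delta | forall x : 'rV[R]_m,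
    (forall i, `[- A, A]%classic (x ord0 i)) -> Q delta x].
  apply: (cov R (0 : R)^'+ Q) => x0 _.
  have e20 : 0 < e / 2 by rewrite divr_gt0.
  have /cvgrPdist_le/(_ _ e20) := cf x0.
  move=> /nbhs_ballP[r /= r0 hr].
  have r20 : 0 < r / 2 by rewrite divr_gt0.
  exists (ball x0 (r / 2), [set t | t < r / 2]); first split.
  - exact: nbhsx_ballx.
  - exact: nbhs_right_lt.
  move=> [x delta] /= [bx dr] y hy.
  have fx : `|f x0 - f x| <= e / 2.
    by apply: hr; apply: le_ball bx; rewrite ler_pdivrMr// ler_peMr ?ltW// ltr1n.
  have fy : `|f x0 - f y| <= e / 2.
    apply: hr; rewrite (splitr r); apply: ball_triangle bx _.
    split=> // i j; rewrite (ord1 i) /ball/=.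
    by rewrite (le_lt_trans (hy j)).
  rewrite (le_trans (ler_distD (f x0) _ _))// (splitr e) distrC.
  exact: lerD.
have pos : nbhs (0 : R)^'+ [set delta : R | 0 < delta] by exact: nbhs_right_gt.
near (0 : R)^'+ => delta.
have d0 : 0 < delta by near: delta.
have hd : forall x : 'rV[R]_m, (forall i, `[- A, A]%classic (x ord0 i)) -> Q delta x by near: delta.
exists delta => // x y xA; apply: hd => i /=.
by rewrite in_itv/= -ler_norml.
Unshelve. all: by end_near. Qed.

Let pihalf1 : 1 <= (pi : R) / 2.
Proof. exact: pihalf_ge1. Qed.

(** The arcsine is not Lipschitz at -1 and 1.  On the box only the values sin x
    with |x| <= 1 have to be inverted, so its argument is projected onto
    [- sin 1, sin 1], where the derivative is at most 1 / cos 1. *)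
Let clamp (u : R) : R := Num.max (- sin 1) (Num.min (sin 1) u).

Let sin1_gt0 : 0 < sin (1 : R).
Proof. by apply: sin_gt0_pi; rewrite ltr01/=; have := pihalf1; lra. Qed.

Let clamp_in u : - sin 1 <= clamp u <= sin 1.
Proof.
have := sin1_gt0; rewrite /clamp /Num.max /Num.min => h.
by case: (ltP (sin 1) u) => h1; case: ltP => h2; apply/andP; split; lra.
Qed.

Let clamp_id u : - sin 1 <= u <= sin 1 -> clamp u = u.
Proof.
move=> /andP[]; rewrite /clamp /Num.max /Num.min => h h'.
by case: (ltP (sin 1) u) => h1; case: ltP => h2; lra.
Qed.

Let max_lip (a x y : R) : `|Num.max a x - Num.max a y| <= `|x - y|.
Proof.
wlog xy : x y / y <= x => [hw|].
  have [|/ltW] := leP y x; first exact: hw.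
  by rewrite distrC (distrC x); exact: hw.
rewrite (@ger0_norm _ (x - y)) ?subr_ge0// ler_norml /Num.max.
by case: ltP => h1; case: ltP => h2; apply/andP; split; lra.
Qed.

Let clamp_lip u v : `|clamp u - clamp v| <= `|u - v|.
Proof.
rewrite (le_trans (max_lip _ _ _))//.
rewrite -(opprK (Num.min _ u)) -(opprK (Num.min _ v)) !oppr_min.
rewrite -opprD normrN (le_trans (max_lip _ _ _))//.
by rewrite -opprD normrN.
Qed.

Definition clamped_asin (u : R) : R := asin (clamp u).

Let sin1_le1 : sin (1 : R) <= 1. Proof. exact: sin_le1. Qed.

Let sin_clamped u : sin (clamped_asin u) = clamp u.
Proof.
rewrite /clamped_asin asinK// in_itv/=; have /andP[] := clamp_in u.
by have := sin1_le1; lra.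
Qed.

Let clamped_pihalf u : clamped_asin u \in `[- (pi / 2), pi / 2].
Proof.
rewrite in_itv/= /clamped_asin; have /andP[h1 h2] := clamp_in u.
have h3 := sin1_le1.
by rewrite asin_geNpi2 ?asin_lepi2//; lra.
Qed.

Let one_in : (1 : R) \in `[- (pi / 2), pi / 2].
Proof. by rewrite in_itv/=; have := pihalf1; lra. Qed.

Let None_in : (-1 : R) \in `[- (pi / 2), pi / 2].
Proof. by rewrite in_itv/=; have := pihalf1; lra. Qed.

Lemma clamped_asin_in u : -1 <= clamped_asin u <= 1.
Proof.
have /andP[h1 h2] := clamp_in u; apply/andP; split; rewrite leNgt; apply/negP.
  by rewrite -ltr_sin// sin_clamped sinN; lra.
by rewrite -ltr_sin// sin_clamped; lra.
Qed.

Lemma clamped_asinK x : `|x| <= 1 -> clamped_asin (sin x) = x.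
Proof.
rewrite ler_norml => /andP[x1 x2].
have xin : x \in `[- (pi / 2), pi / 2].
  by rewrite in_itv/=; have := pihalf1; lra.
rewrite /clamped_asin clamp_id ?sinK//; apply/andP; split; rewrite leNgt; apply/negP.
  by rewrite -sinN ltr_sin//; lra.
by rewrite ltr_sin//; lra.
Qed.

Let cos1_le (c : R) : `|c| <= 1 -> cos 1 <= cos c.
Proof.
move=> c1; rewrite leNgt; apply/negP => h.
have hc : cos c = cos `|c|.
  have [h0|h0] := leP 0 c; first by rewrite ger0_norm.
  by rewrite ltr0_norm// cosN.
move: h; rewrite hc ltr_cos ?in_itv/=; first by rewrite ltNge c1.
  by have := pihalf1; lra.
by rewrite normr_ge0/=; have := pihalf1; lra.
Qed.

Lemma clamped_asin_lip u v :
  `|clamped_asin u - clamped_asin v| <= `|u - v| / cos 1.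
Proof.
rewrite ler_pdivlMr ?cos1_gt0// (le_trans _ (clamp_lip u v))//.
rewrite -!sin_clamped.
have := clamped_asin_in u; have := clamped_asin_in v.
move: (clamped_asin u) (clamped_asin v) => p q.
wlog pq : p q / q <= p => [hw|].
  have [|/ltW] := leP q p; first exact: hw.
  by rewrite distrC (distrC (sin p)) => ? ? ?; exact: hw.
move=> /andP[q1 q2] /andP[p1 p2].
have [c] : exists2 c, c \in `[q, p] & sin p - sin q = cos c * (p - q).
  apply: MVT_segment => //.
  by apply: continuous_subspaceT => y; exact: continuous_sin.
rewrite in_itv/= => /andP[qc cp] ->.
rewrite normrM mulrC ler_wpM2r// (le_trans _ (ler_norm _))// cos1_le//.
by rewrite ler_norml; apply/andP; split; lra.
Qed.

(** With y_i = (1 + sin (x_i / A)) / 2 one recovers x_i = A asin (2 y_i - 1) when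
    |x_i| <= A, so on the box f is a continuous function of y, which its
    Bernstein polynomials approximate uniformly.  Outside the box the sum of the
    (x_i / A)^2 exceeds 1, and the second term bounds the trivial error 2 M. *)
Lemma trigonometric_approximation (m : nat) (f : 'rV[R]_m -> R) (M A e : R) :
  continuous f -> (forall x, `|f x| <= M) -> 0 < A -> 0 < e ->
  exists (s : seq 'I_m) (g : ('I_m -> nat) -> R), (forall K, `|g K| <= M) /\
    forall x : 'I_m -> R,
      `|f (\row_i x i) - bernstein s g (fun i => (1 + sin (x i / A)) / 2)| <=
      e + 2 * M * \sum_(i < m) (x i / A) ^+ 2.
Proof.
move=> cf fM A0 e0.
have M0 : 0 <= M by rewrite (le_trans _ (fM 0)).
have e20 : 0 < e / 2 by rewrite divr_gt0.
have [delta d0 hd] := @box_uniform_continuity m f A _ cf e20.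
pose L := A * 2 / cos 1.
have L0 : 0 < L by rewrite !mulr_gt0// invr_gt0 cos1_gt0.
(* Chebyshev: an error 2 M is allowed whenever some frequency of heads is
   farther than delta / L from y i, and C measures the cost of that event in
   terms of the variances. *)
pose C := 2 * M * (L / delta) ^+ 2.
have C0 : 0 <= C by apply: mulr_ge0; [exact: mulr_ge0|exact: sqr_ge0].
have [n [n0 nC]] : exists n : nat, 0 < (n%:R : R) /\ C * m%:R / n%:R <= e / 2.
  exists (Num.truncn ((e / 2)^-1 * (C * m%:R))).+1; split; first by rewrite ltr0n.
  rewrite ler_pdivrMr ?ltr0n// -ler_pdivrMl// ltW//.
  exact: truncnS_gt.
pose g (K : 'I_m -> nat) := f (\row_i (A * clamped_asin (2 * ((K i)%:R / n%:R) - 1))).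
exists (flips n), g; split=> [K|x]; first exact: fM.
set y := fun i => (1 + sin (x i / A)) / 2.
have y01 i : 0 <= y i <= 1.
  have := sin_max (x i / A); rewrite ler_norml => /andP[h1 h2].
  by rewrite /y; apply/andP; split; lra.
have sum0 : 0 <= \sum_(i < m) (x i / A) ^+ 2 by apply: sumr_ge0 => i _; exact: sqr_ge0.
have [xA|xA] := pselect (forall i, `|x i| <= A); last first.
  have [i xiA] : exists i, A < `|x i|.
    by apply: contrapT => h; apply: xA => i; rewrite leNgt; apply/negP => hi; apply: h; exists i.
  have s1 : 1 <= \sum_(i < m) (x i / A) ^+ 2.
    rewrite (bigD1 i)//= (@le_trans _ _ ((x i / A) ^+ 2))//; last first.
      by rewrite lerDl sumr_ge0// => j _; exact: sqr_ge0.
    rewrite -real_normK ?num_real// expr_ge1// normrM normfV (gtr0_norm A0).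
    by rewrite ler_pdivlMr// mul1r ltW.
  rewrite (le_trans (ler_normB _ _))//.
  have h1 := fM (\row_i x i).
  have h2 : `|bernstein (flips n) g y| <= M by apply: bernstein_normr_le => // K; exact: fM.
  have h3 : 2 * M <= 2 * M * \sum_(i < m) (x i / A) ^+ 2 by rewrite ler_peMr// mulr_ge0.
  lra.
have gK K : `|f (\row_i x i) - g K| <= e / 2 + C / n%:R ^+ 2 * \sum_(i < m) ((K i)%:R - n%:R * y i) ^+ 2.
  have S0 : 0 <= \sum_(i < m) ((K i)%:R - n%:R * y i) ^+ 2 by apply: sumr_ge0 => i _; exact: sqr_ge0.
  have Cn0 : 0 <= C / n%:R ^+ 2 by rewrite divr_ge0// sqr_ge0.
  have lip i : `|x i - A * clamped_asin (2 * ((K i)%:R / n%:R) - 1)| <= L * `|(K i)%:R / n%:R - y i|.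
    have xi : x i = A * clamped_asin (2 * y i - 1).
      rewrite /y (_ : 2 * ((1 + sin (x i / A)) / 2) - 1 = sin (x i / A)); last by field.
      rewrite clamped_asinK; first by field; rewrite gt_eqF.
      by rewrite normrM normfV (gtr0_norm A0) ler_pdivrMr// mul1r.
    rewrite {1}xi -mulrBr normrM (gtr0_norm A0) /L -2!mulrA ler_wpM2l ?(ltW A0)//.
    rewrite (le_trans (clamped_asin_lip _ _))//.
    rewrite (_ : 2 * y i - 1 - (2 * ((K i)%:R / n%:R) - 1) = 2 * (y i - (K i)%:R / n%:R)); last by ring.
    by rewrite normrM ger0_norm// distrC -mulrA (mulrC `|_|).
  have [cl|ncl] := pselect (forall i, L * `|(K i)%:R / n%:R - y i| <= delta).
    apply: (@le_trans _ _ (e / 2)); last by rewrite lerDl mulr_ge0.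
    by apply: hd => i; rewrite !mxE// (le_trans (lip i)).
  have [i hi] : exists i, delta < L * `|(K i)%:R / n%:R - y i|.
    by apply: contrapT => h; apply: ncl => i; rewrite leNgt; apply/negP => hi; apply: h; exists i.
  rewrite (le_trans (ler_normB _ _))//.
  have h1 := fM (\row_i x i); have h2 : `|g K| <= M by exact: fM.
  have h3 : 1 <= (L / delta) ^+ 2 * ((K i)%:R / n%:R - y i) ^+ 2.
    rewrite -exprMn -real_normK ?num_real// expr_ge1// normrM.
    rewrite ger0_norm; last by rewrite divr_ge0// ltW.
    by rewrite mulrAC ler_pdivlMr// mul1r ltW.
  have h4 : ((K i)%:R - n%:R * y i) ^+ 2 <= \sum_(i < m) ((K i)%:R - n%:R * y i) ^+ 2.
    by rewrite (bigD1 i)//= lerDl sumr_ge0// => j _; exact: sqr_ge0.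
  have h5 : C / n%:R ^+ 2 * ((K i)%:R - n%:R * y i) ^+ 2 = 2 * M * ((L / delta) ^+ 2 * ((K i)%:R / n%:R - y i) ^+ 2).
    by rewrite /C; field; rewrite !gt_eqF.
  have h6 := ler_wpM2l Cn0 h4; rewrite h5 in h6.
  have h7 : 2 * M <= 2 * M * ((L / delta) ^+ 2 * ((K i)%:R / n%:R - y i) ^+ 2).
    by rewrite ler_peMr// mulr_ge0.
  lra.
(* The variance of the number of heads is at most n in each coordinate. *)
have bnd : bernstein (flips n) (fun K => e / 2 * 1 + C / n%:R ^+ 2 * \sum_(i < m) ((K i)%:R - n%:R * y i) ^+ 2) y <= e.
  rewrite bernstein_lin bernstein_cst bernstein_sum.
  under eq_bigr do rewrite bernstein_variance count_flips subrr expr0n add0r.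
  have h : \sum_(i < m) n%:R * y i * (1 - y i) <= \sum_(i < m) (n%:R : R).
    apply: ler_sum => i _; rewrite -mulrA ler_piMr ?ltW//.
    by have /andP[a1 a2] := y01 i; nra.
  rewrite sumr_const card_ord in h.
  have := ler_wpM2l (_ : 0 <= C / n%:R ^+ 2) h => /(_ _).
  have -> : C / n%:R ^+ 2 * (n%:R *+ m) = C * m%:R / n%:R.
    by rewrite -mulr_natr; field; rewrite gt_eqF.
  rewrite divr_ge0 ?sqr_ge0// => /(_ isT) h'.
  lra.
apply: (@le_trans _ _ e); last by rewrite lerDl mulr_ge0// mulr_ge0.
have up (a b : R) : (forall K, a * 1 + b * g K <=
    e / 2 * 1 + C / n%:R ^+ 2 * \sum_(i < m) ((K i)%:R - n%:R * y i) ^+ 2) ->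
    a + b * bernstein (flips n) g y <= e.
  move=> h; apply: le_trans bnd; apply: le_trans (bernstein_le _ y01 h).
  by rewrite bernstein_lin bernstein_cst mulr1.
rewrite ler_norml; apply/andP; split.
  rewrite lerNl opprB addrC; have := up (- f (\row_i x i)) 1; rewrite mul1r; apply => K.
  by have := gK K; rewrite ler_norml => /andP[]; lra.
have := up (f (\row_i x i)) (-1); rewrite mulN1r; apply => K.
by have := gK K; rewrite ler_norml => /andP[]; lra.
Qed.

End box.

(** * Characteristic functions determine limits of finite dimensional distributions *)

Section sine_polynomials.
Context d (T : measurableType d) (R : realType) (P : probability T R).
Context (m : nat) (X : 'I_m -> T -> R) (A : R).
Hypothesis mX : forall i, measurable_fun setT (X i).
Local Notation L1 f := (P.-integrable setT (EFin \o f)).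
Implicit Types (s : seq 'I_m) (g : ('I_m -> nat) -> R) (u : 'I_m -> R) (c : R).

Let coord w i := (1 + sin (X i w / A)) / 2.

Let coord01 w i : 0 <= coord w i <= 1.
Proof.
have := sin_max (X i w / A); rewrite ler_norml => /andP[h1 h2].
by rewrite /coord; apply/andP; split; lra.
Qed.

Let mcoord i : measurable_fun setT (fun w => coord w i).
Proof.
apply: measurable_funM => //; apply: measurable_funD => //.
by apply: measurableT_comp; [exact: measurable_sin|exact: measurable_funM].
Qed.

Lemma measurable_bernstein s g :
  measurable_fun setT (fun w => bernstein s g (coord w)).
Proof.
elim: s g => [|i s ih] g /=; first exact: measurable_cst.
apply: measurable_funD; apply: measurable_funM => //.
exact: measurable_funB.
Qed.

Definition phase u c w := (\sum_(i < m) u i * X i w) + c.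

Lemma measurable_phase u c : measurable_fun setT (phase u c).
Proof.
apply: measurable_funD => //; apply: measurable_sum => i.
exact: measurable_funM.
Qed.

Definition sine_moment s g u c :=
  \int[P]_w (bernstein s g (coord w) * cos (phase u c w)).

Lemma L1_sine_moment s g u c (M : R) : (forall K, `|g K| <= M) ->
  L1 (fun w => bernstein s g (coord w) * cos (phase u c w)).
Proof.
move=> gM; have M0 : 0 <= M by rewrite (le_trans _ (gM (fun=> 0%N))).
apply: (@L1_bounded _ _ _ P _ M) => [|w].
  apply: measurable_funM; first exact: measurable_bernstein.
  by apply: measurableT_comp; [exact: measurable_cos|exact: measurable_phase].
rewrite normrM -[leRHS]mulr1; apply: ler_pM => //; last exact: cos_max.
exact: bernstein_normr_le.
Qed.

Let shift (i : 'I_m) (r : R) u : 'I_m -> R := fun j => u j + (j == i)%:R * r.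

Let phase_shift i r u c w : phase (shift i r u) c w = phase u c w + r * X i w.
Proof.
rewrite /phase /shift; under eq_bigr do rewrite mulrDl.
rewrite big_split/= [X in _ + X + c](bigD1 i)//= eqxx mul1r.
have -> : \sum_(j < m | j != i) (j == i)%:R * r * X j w = 0.
  by rewrite big1// => j /negbTE ->; rewrite !mul0r.
ring.
Qed.

(** The head of the list contributes the factor (1 + sin a) / 2, a = X_i / A.
    Writing sin a cos th = (sin (th + a) - sin (th - a)) / 2 and
    sin x = cos (x - pi / 2) absorbs it into the phase. *)
Lemma sine_moment_cons i s g u c (M : R) : (forall K, `|g K| <= M) ->
  sine_moment (i :: s) g u c =
  2^-1 * (sine_moment s (fun K => g (incr_count i K)) u c + sine_moment s g u c) +
  4^-1 * ((sine_moment s (fun K => g (incr_count i K)) (shift i A^-1 u) (c - pi / 2)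
         - sine_moment s (fun K => g (incr_count i K)) (shift i (- A^-1) u) (c - pi / 2))
        - (sine_moment s g (shift i A^-1 u) (c - pi / 2)
         - sine_moment s g (shift i (- A^-1) u) (c - pi / 2))).
Proof.
move=> gM; rewrite /sine_moment.
have i1 u' c' := @L1_sine_moment s (fun K => g (incr_count i K)) u' c' M (fun K => gM _).
have i2 u' c' := @L1_sine_moment s g u' c' M gM.
have [j1 j2] := (i1 u c, i2 u c).
have [k1 k2] := (i1 (shift i A^-1 u) (c - pi / 2), i1 (shift i (- A^-1) u) (c - pi / 2)).
have [l1 l2] := (i2 (shift i A^-1 u) (c - pi / 2), i2 (shift i (- A^-1) u) (c - pi / 2)).
rewrite -expecD// -expecZ; last exact: L1_D.
rewrite -expecB// -expecB// -expecB; [|exact: L1_B|exact: L1_B].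
rewrite -expecZ; last by apply: L1_B; exact: L1_B.
rewrite -expecD; [|by apply: L1_Z; exact: L1_D|by apply: L1_Z; apply: L1_B; exact: L1_B].
apply: expec_eq => w /=; rewrite !phase_shift.
have cE u' : phase u' (c - pi / 2) w = phase u' c w - pi / 2.
  by rewrite /phase addrA.
rewrite !cE; set th := phase u c w; set a := X i w / A.
have -> : th - pi / 2 + A^-1 * X i w = (th + a) - pi / 2 by rewrite /a; ring.
have -> : th - pi / 2 + - A^-1 * X i w = (th - a) - pi / 2 by rewrite /a; ring.
rewrite !cosBpihalf sinD sinB.
set b1 := bernstein _ _ _; set b2 := bernstein _ _ _.
have -> : coord w i = (1 + sin a) / 2 by [].
by field.
Qed.

Lemma sine_moment_nil g u c :
  sine_moment [::] g u c = g (fun=> 0%N) * (\int[P]_w cos (phase u c w)).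
Proof.
by rewrite /sine_moment/= expecZ//; apply: L1_cos; exact: measurable_phase.
Qed.

End sine_polynomials.

Section weak_limits.
Context {R : realType}.

(** By [sine_moment_cons] a sine moment is a fixed linear combination of values
    E cos(sum_i u_i X_i + c), and each of them converges. *)
Lemma sine_moment_cvg (m : nat) (A : R)
    (d_ : nat -> measure_display) (T_ : forall n, measurableType (d_ n))
    (P_ : forall n, probability (T_ n) R) (X_ : forall n, 'I_m -> T_ n -> R)
    d (T : measurableType d) (P : probability T R) (X : 'I_m -> T -> R)
    (s : seq 'I_m) (g : ('I_m -> nat) -> R) (M : R) (u : 'I_m -> R) (c : R) :
  (forall n i, measurable_fun setT (X_ n i)) ->
  (forall i, measurable_fun setT (X i)) ->
  (forall u c, \int[P_ n]_w cos (phase (X_ n) u c w) @[n --> \oo] -->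
     \int[P]_w cos (phase X u c w)) ->
  (forall K, `|g K| <= M) ->
  sine_moment (P_ n) (X_ n) A s g u c @[n --> \oo] --> sine_moment P X A s g u c.
Proof.
move=> mX_ mX cX.
elim: s g u c => [|i s ih] g u c gM.
  rewrite sine_moment_nil//; under eq_fun do rewrite sine_moment_nil//.
  by apply: cvgM; [exact: cvg_cst|exact: cX].
rewrite (sine_moment_cons P A mX i s u c gM).
under eq_fun do rewrite (sine_moment_cons _ A (mX_ _) i s u c gM).
have gM' K : `|g (incr_count i K)| <= M by exact: gM.
apply: cvgD; apply: cvgM; (try exact: cvg_cst).
  by apply: cvgD; apply: ih.
by apply: cvgB; apply: cvgB; apply: ih.
Qed.

Section one_space.
Context d (T : measurableType d) (P : probability T R).
Context (m : nat) (X : 'I_m -> T -> R) (f : 'rV[R]_m -> R) (M : R).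
Hypotheses (cf : continuous f) (fM : forall x, `|f x| <= M).
Local Notation L1 f := (P.-integrable setT (EFin \o f)).

(** A continuous function of several variables is a pointwise limit of
    polynomials in the sines of its coordinates, which are measurable. *)
Lemma measurable_continuous_row : (forall i, measurable_fun setT (X i)) ->
  measurable_fun setT (fun w => f (\row_i X i w)).
Proof.
move=> mX.
have h (n : nat) : exists sg : seq 'I_m * (('I_m -> nat) -> R), forall x : 'I_m -> R,
      `|f (\row_i x i) - bernstein sg.1 sg.2 (fun i => (1 + sin (x i / n.+1%:R)) / 2)| <=
      n.+1%:R^-1 + 2 * M * \sum_(i < m) (x i / n.+1%:R) ^+ 2.
  have [s [g [_ sg]]] := @trigonometric_approximation R m f M n.+1%:R n.+1%:R^-1 cf fM (ltr0Sn _ _) (ltac:(by rewrite invr_gt0 ltr0Sn)).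
  by exists (s, g).
have [sg hsg] := choice h.
apply: (@measurable_fun_cvg _ _ _ _ (fun n w => bernstein (sg n).1 (sg n).2 (fun i => (1 + sin (X i w / n.+1%:R)) / 2))).
  by move=> n; exact: measurable_bernstein.
move=> w _; pose S := 1 + 2 * M * \sum_(i < m) X i w ^+ 2.
have M0 : 0 <= M by rewrite (le_trans _ (fM 0)).
apply: (@cvg_normr_le _ _ (fun n => S * harmonic n)); last first.
  by rewrite -(mulr0 S); apply: cvgM; [exact: cvg_cst|exact: cvg_harmonic].
apply: nearW => n; rewrite distrC (le_trans (hsg n _))//.
have -> : S * harmonic n = n.+1%:R^-1 + 2 * M * ((\sum_(i < m) X i w ^+ 2) / n.+1%:R).
  by rewrite /S /harmonic/=; ring.
rewrite lerD2l ler_wpM2l ?mulr_ge0// mulr_suml; apply: ler_sum => i _.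
rewrite expr_div_n ler_wpM2l ?sqr_ge0// lef_pV2 ?posrE ?exprn_gt0 ?ltr0Sn//.
by rewrite expr2 ler_peMr// ler1n.
Qed.

Lemma L1_continuous_row : (forall i, measurable_fun setT (X i)) ->
  L1 (fun w => f (\row_i X i w)).
Proof. by move=> mX; apply: (L1_bounded P (measurable_continuous_row mX)) => w; exact: fM. Qed.

Lemma expec_approximation (A e : R) s g : 0 < A -> (forall i, L2fun P (X i)) ->
  (forall K, `|g K| <= M) ->
  (forall x : 'I_m -> R,
      `|f (\row_i x i) - bernstein s g (fun i => (1 + sin (x i / A)) / 2)| <=
      e + 2 * M * \sum_(i < m) (x i / A) ^+ 2) ->
  `|(\int[P]_w f (\row_i X i w)) - sine_moment P X A s g (fun=> 0) 0| <=
  e + 2 * M * ((\sum_(i < m) \int[P]_w (X i w ^+ 2)) / A ^+ 2).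
Proof.
move=> A0 L2X gM fg.
have mX i : measurable_fun setT (X i) by exact: L2_measurable (L2X i).
have If := L1_continuous_row mX.
have Ib := @L1_sine_moment _ _ _ P _ X A mX s g (fun=> 0) 0 M gM.
rewrite /sine_moment -expecB//.
have Ir : L1 (fun w => e + 2 * M / A ^+ 2 * \sum_(i < m) X i w ^+ 2).
  by apply: L1_D; [exact: L1_cst|apply: L1_Z; apply: L1_sum => i; exact: L2_sqr].
have -> : e + 2 * M * ((\sum_(i < m) \int[P]_w (X i w ^+ 2)) / A ^+ 2) =
    \int[P]_w (e + 2 * M / A ^+ 2 * \sum_(i < m) X i w ^+ 2).
  have I2 i : L1 (fun w => X i w ^+ 2) by exact: L2_sqr.
  rewrite expecD; [|exact: L1_cst|by apply: L1_Z; exact: L1_sum].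
  by rewrite expec_cst expecZ; [rewrite expec_sum//; ring|exact: L1_sum].
apply: normr_expec_le => //; first exact: L1_B.
move=> w; rewrite /phase; under eq_bigr do rewrite mul0r.
rewrite big1// addr0 cos0 mulr1 (le_trans (fg _))// lerD2l.
have -> : \sum_(i < m) (X i w / A) ^+ 2 = (A ^+ 2)^-1 * \sum_(i < m) X i w ^+ 2.
  by rewrite mulr_sumr; apply: eq_bigr => i _; rewrite expr_div_n mulrC.
by rewrite mulrA.
Qed.

End one_space.

(** Approximate f by a sine polynomial with a box size A so large that the
    bounded second moments make the error small for all n and for the limit at
    the same time; the sine polynomials converge by [sine_moment_cvg]. *)
Theorem Df_lim_criterion (Y : nat -> process R) (Z : process R) :
  (forall t, 0 <= t -> exists K, [/\
     forall n, L2fun (proc_prob (Y n)) (Y n t),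
     forall n, \int[proc_prob (Y n)]_w (Y n t w ^+ 2) <= K,
     L2fun (proc_prob Z) (Z t) &
     \int[proc_prob Z]_w (Z t w ^+ 2) <= K]) ->
  (forall m (t : 'I_m -> R) (u : 'I_m -> R) (c : R), (forall i, 0 <= t i) ->
     \int[proc_prob (Y n)]_w cos ((\sum_(i < m) u i * Y n (t i) w) + c) @[n --> \oo]
     --> \int[proc_prob Z]_w cos ((\sum_(i < m) u i * Z (t i) w) + c)) ->
  Df_lim Y Z.
Proof.
move=> tight charf m t t0 f cf [M fM].
have [K hK] := choice (fun i => tight (t i) (t0 i)).
have M0 : 0 <= M by rewrite (le_trans _ (fM 0)).
pose X_ n i := Y n (t i); pose X i := Z (t i).
have L2X_ n i : L2fun (proc_prob (Y n)) (X_ n i) by have [h _ _ _] := hK i.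
have L2X i : L2fun (proc_prob Z) (X i) by have [_ _ h _] := hK i.
have mX_ n i := L2_measurable (L2X_ n i).
have mX i := L2_measurable (L2X i).
have If_ n := L1_continuous_row (proc_prob (Y n)) cf fM (mX_ n).
have If := L1_continuous_row (proc_prob Z) cf fM mX.
rewrite (expectationE If).
under eq_fun do rewrite (expectationE (If_ _)).
apply: cvg_EFin; first exact: nearW.
apply/cvgrPdist_le => e e0.
pose KK := \sum_(i < m) `|K i|.
have KK0 : 0 <= KK by apply: sumr_ge0.
have e4 : 0 < e / 4 by rewrite divr_gt0.
pose A2 := 2 * M * KK / (e / 8) + 1; pose A := Num.sqrt A2.
have A20 : 0 < A2 by rewrite ltr_wpDl// !mulr_ge0// ?invr_ge0; lra.
have A0 : 0 < A by rewrite sqrtr_gt0.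
have AE : A ^+ 2 = A2 by rewrite sqr_sqrtr// ltW.
have hA S : S <= KK -> 2 * M * (S / A ^+ 2) <= e / 8.
  move=> SK; rewrite AE mulrA ler_pdivrMr//.
  rewrite (@le_trans _ _ (2 * M * KK))//; first by rewrite ler_wpM2l// mulr_ge0.
  have -> : e / 8 * A2 = 2 * M * KK + e / 8 by rewrite /A2; field; rewrite gt_eqF.
  by rewrite lerDl; lra.
have e8 : 0 < e / 8 by rewrite divr_gt0.
have [s [g [gM sg]]] := @trigonometric_approximation R m f M A (e / 8) cf fM A0 e8.
have bnd_ n : `|(\int[proc_prob (Y n)]_w f (\row_i X_ n i w)) - sine_moment (proc_prob (Y n)) (X_ n) A s g (fun=> 0) 0| <= e / 4.
  apply: le_trans (expec_approximation cf fM A0 (L2X_ n) gM sg) _.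
  have : 2 * M * ((\sum_(i < m) \int[proc_prob (Y n)]_w (X_ n i w ^+ 2)) / A ^+ 2) <= e / 8.
    apply: hA; apply: ler_sum => i _; have [_ h _ _] := hK i.
    by rewrite (le_trans (h n))// ler_norm.
  by lra.
have bnd : `|(\int[proc_prob Z]_w f (\row_i X i w)) - sine_moment (proc_prob Z) X A s g (fun=> 0) 0| <= e / 4.
  apply: le_trans (expec_approximation cf fM A0 L2X gM sg) _.
  have : 2 * M * ((\sum_(i < m) \int[proc_prob Z]_w (X i w ^+ 2)) / A ^+ 2) <= e / 8.
    apply: hA; apply: ler_sum => i _; have [_ _ _ h] := hK i.
    by rewrite (le_trans h)// ler_norm.
  by lra.
have := @sine_moment_cvg m A _ _ (fun n => proc_prob (Y n)) X_ _ _ (proc_prob Z) X s g M (fun=> 0) 0 mX_ mX _ gM.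
move=> /(_ (fun u c => charf m t u c t0)) /cvgrPdist_le /(_ _ e4) cvs.
near=> n.
have h : `|sine_moment (proc_prob Z) X A s g (fun=> 0) 0 - sine_moment (proc_prob (Y n)) (X_ n) A s g (fun=> 0) 0| <= e / 4.
  by near: n; exact: cvs.
move: h (bnd_ n) bnd.
set a := \int[_]_w _; set b := \int[_]_w _; set a' := sine_moment _ _ _ _ _ _ _; set b' := sine_moment _ _ _ _ _ _ _.
rewrite !ler_norml => /andP[? ?] /andP[? ?] /andP[? ?].
change (- e <= b - a <= e).
by apply/andP; split; lra.
Unshelve. all: by end_near. Qed.

End weak_limits.

(** * The characteristic function of the normal law *)

Section normal_characteristic_function.
Context {R : realType}.
Notation mu := (@lebesgue_measure R).

Lemma Rintegral_derivative0 (F f : R -> R) :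
  (forall x : R, is_derive x 1 F (f x)) -> continuous f ->
  mu.-integrable setT (EFin \o f) ->
  F n%:R @[n --> \oo] --> 0 -> F (- n%:R) @[n --> \oo] --> 0 ->
  \int[mu]_x f x = 0.
Proof.
move=> dF cf If F0 F0'.
have cF : continuous F by move=> x; apply/differentiable_continuous/derivable1_diffP; have := dF x; case.
have I_ (n : nat) : \int[mu]_(x in `[- n.+1%:R, n.+1%:R]) f x = F n.+1%:R - F (- n.+1%:R).
  rewrite /Rintegral (@continuous_FTC2 _ f F)//.
  - by rewrite -subr_gt0 opprK ltr_wpDl.
  - exact: continuous_subspaceT.
  - split.
    + by move=> x _; have := dF x; case.
    + by apply: cvg_at_right_filter; exact: cF.
    + by apply: cvg_at_left_filter; exact: cF.
  - by move=> x _; rewrite derive1E; have := dF x => dFx; rewrite derive_val.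
have c1 : \int[mu]_(x in `[- n.+1%:R, n.+1%:R]) f x @[n --> \oo] --> 0.
  have : F n.+1%:R - F (- n.+1%:R) @[n --> \oo] --> (0 - 0 : R).
    apply: cvgB.
      by have := F0; rewrite -(cvg_shiftS (fun n => F n%:R)).
    by have := F0'; rewrite -(cvg_shiftS (fun n => F (- n%:R))).
  by rewrite subr0; under eq_fun do rewrite -I_.
have c2 : \int[mu]_(x in `[- n.+1%:R, n.+1%:R]) f x @[n --> \oo] --> \int[mu]_x f x.
  under eq_fun do rewrite Rintegral_mkcond.
  apply: fine_cvg; rewrite /Rintegral fineK; last exact: (integrable_fin_num measurableT If).
  apply: (@dominated_cvg _ _ _ mu _ measurableT
    (fun n x => ((f \_ `[- n.+1%:R, n.+1%:R]) x)%:E) _ (EFin \o (fun x => `|f x|))) => //.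
  - move=> n; apply/measurable_EFinP/measurable_restrict => //.
    by apply: measurable_funTS; exact: continuous_measurable_fun.
  - move=> x _; apply: cvg_EFin; first exact: nearW.
    apply: (@cvg_normr_le _ _ (fun=> 0)); last exact: cvg_cst.
    near=> n.
    rewrite /= patchE mem_set; first by rewrite subrr normr0.
    rewrite /= in_itv/= -ler_norml ltW//.
    rewrite (@lt_trans _ _ n%:R)// ?ltr_nat//.
    by near: n; exact: nbhs_infty_gtr.
  - exact: integrable_norm.
  - by move=> n x _; rewrite /= lee_fin patchE; case: ifPn => // _; rewrite normr0.
exact: (cvg_unique _ c2 c1).
Unshelve. all: by end_near. Qed.

Variable sigma : R.
Hypothesis sigma0 : 0 < sigma.
Let p := normal_pdf 0 sigma.

Let pE x : p x = normal_peak sigma * expR (- (x ^+ 2 / (sigma ^+ 2 *+ 2))).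
Proof. by rewrite /p normal_pdfE ?gt_eqF// /normal_fun subr0 mulNr. Qed.

Let s2 : 0 < sigma ^+ 2 *+ 2.
Proof. by rewrite mulrn_wgt0// exprn_gt0. Qed.

Let peak0 : 0 < normal_peak sigma.
Proof. by rewrite normal_peak_gt0// gt_eqF. Qed.

Let peak20 : 0 < normal_peak (2 * sigma).
Proof. by rewrite normal_peak_gt0// gt_eqF// mulr_gt0. Qed.

Let p0 x : 0 <= p x. Proof. exact: normal_pdf_ge0. Qed.

Let cp : continuous p. Proof. by apply: continuous_normal_pdf; rewrite gt_eqF. Qed.

Let mp : measurable_fun setT p. Proof. exact: measurable_normal_pdf. Qed.

Let dp (x : R) : is_derive x 1 p (- (x / sigma ^+ 2) * p x).
Proof.
have -> : p = (fun x => normal_peak sigma * expR (- (x ^+ 2 / (sigma ^+ 2 *+ 2)))).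
  by apply/funext => y; rewrite pE.
apply: is_derive_eq; rewrite /GRing.scale/=.
by field; rewrite gt_eqF.
Qed.

Let Ip : mu.-integrable setT (EFin \o p).
Proof. exact: integrable_normal_pdf. Qed.

(** Three quarters of the exponent of the density absorb the factor |x|: since
    |x| <= 1 + x^2 <= c exp(3 x^2 / (8 sigma^2)), what remains is a multiple of
    the density with standard deviation 2 sigma. *)
Let C : R := (1 + 8 * sigma ^+ 2) * normal_peak sigma / normal_peak (2 * sigma).

Let C0 : 0 <= C.
Proof.
apply: divr_ge0; last exact: ltW.
by rewrite mulr_ge0 ?(ltW peak0)// addr_ge0// mulr_ge0// sqr_ge0.
Qed.

Let xp_le x : `|x| * p x <= C * normal_pdf 0 (2 * sigma) x.
Proof.
rewrite pE normal_pdfE ?gt_eqF ?mulr_gt0// /normal_fun subr0 mulNr.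
set E := expR (- (x ^+ 2 / ((2 * sigma) ^+ 2 *+ 2))).
have -> : C * (normal_peak (2 * sigma) * E) = normal_peak sigma * ((1 + 8 * sigma ^+ 2) * E).
  by rewrite /C; field; rewrite gt_eqF.
rewrite /E mulrCA ler_wpM2l ?(ltW peak0)//.
set a := x ^+ 2 / (sigma ^+ 2 *+ 2).
have a0 : 0 <= a by rewrite divr_ge0 ?sqr_ge0 ?ltW.
have -> : x ^+ 2 / ((2 * sigma) ^+ 2 *+ 2) = a / 4.
  by rewrite /a; field; rewrite gt_eqF.
have -> : - a = - (a / 4) + - (3 / 4 * a) by field.
rewrite expRD mulrCA mulrC ler_wpM2r ?expR_ge0//.
rewrite expRN -ler_pdivlMr ?invr_gt0 ?expR_gt0// invrK.
have h := expR_ge1Dx (3 / 4 * a).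
have x1 : `|x| <= 1 + x ^+ 2.
  by rewrite -(real_normK (num_real x)); have := normr_ge0 x; nra.
have x2 : x ^+ 2 = 2 * sigma ^+ 2 * a by rewrite /a; field; rewrite gt_eqF.
have sg : 0 <= sigma ^+ 2 by exact: sqr_ge0.
have h2 : (1 + 8 * sigma ^+ 2) * (1 + 3 / 4 * a) <= (1 + 8 * sigma ^+ 2) * expR (3 / 4 * a).
  by rewrite ler_wpM2l//; lra.
have : 0 <= sigma ^+ 2 * a by rewrite mulr_ge0.
nra.
Qed.

Let Ixp : mu.-integrable setT (EFin \o (fun x => `|x| * p x)).
Proof.
apply: (@le_integrable _ _ _ mu _ measurableT _ (EFin \o (fun x => C * normal_pdf 0 (2 * sigma) x))).
- apply/measurable_EFinP/measurable_funM => //; exact: measurable_normr.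
- move=> x _; rewrite /= lee_fin ger0_norm; last by rewrite mulr_ge0.
  by rewrite (le_trans (xp_le x))// ler_norm.
- have := @integrableZl _ _ _ mu _ measurableT C _ (integrable_normal_pdf 0 (2 * sigma)).
  by apply: eq_integrable.
Qed.

Let Ibp (b : R -> R) : measurable_fun setT b -> (forall x, `|b x| <= 1) ->
  mu.-integrable setT (EFin \o (fun x => b x * p x)).
Proof.
move=> mb b1; apply: le_integrable Ip => //.
  by apply/measurable_EFinP/measurable_funM.
by move=> x _; rewrite /= lee_fin normrM ler_piMl.
Qed.

Let Ixbp (b : R -> R) : measurable_fun setT b -> (forall x, `|b x| <= 1) ->
  mu.-integrable setT (EFin \o (fun x => x * b x * p x)).
Proof.
move=> mb b1; apply: le_integrable Ixp => //.
  by apply/measurable_EFinP/measurable_funM => //; exact: measurable_funM.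
move=> x _; rewrite /= lee_fin !normrM normr_id mulrAC.
by rewrite ler_piMr// mulr_ge0.
Qed.

Let mlin (u th : R) : measurable_fun setT (fun x : R => u * x + th).
Proof. by apply: measurable_funD => //; exact: measurable_funM. Qed.

Let mcosl (u th : R) : measurable_fun setT (fun x : R => cos (u * x + th)).
Proof. by apply: measurableT_comp; [exact: measurable_cos|exact: mlin]. Qed.

Let msinl (u th : R) : measurable_fun setT (fun x : R => sin (u * x + th)).
Proof. by apply: measurableT_comp; [exact: measurable_sin|exact: mlin]. Qed.

Let charf (th u : R) := \int[mu]_x (cos (u * x + th) * p x).

Let p_cvg0 (b : nat -> R) : (forall n, `|b n| <= 1) ->
  b n * p n%:R @[n --> \oo] --> 0.
Proof.
move=> b1; apply: (@cvg_normr_le _ _ (fun n => (C * normal_peak (2 * sigma)) / n%:R)).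
  near=> n; rewrite subr0 normrM (@le_trans _ _ (p n%:R))//.
    by rewrite (ger0_norm (p0 _)) ler_piMl.
  have n0 : 0 < (n%:R : R) by near: n; exact: nbhs_infty_gtr.
  rewrite ler_pdivlMr// mulrC; have := xp_le n%:R; rewrite ger0_norm// => h.
  rewrite (le_trans h)// ler_wpM2l//.
  by rewrite normal_pdf_ub// gt_eqF// mulr_gt0.
exact: cvg_invn.
Unshelve. all: by end_near. Qed.

Let pN x : p (- x) = p x. Proof. by rewrite !pE sqrrN. Qed.

(** Stein's identity for x |-> sin (u x + th): integrate the derivative of its
    product with the density. *)
Let stein u th : \int[mu]_x (x * sin (u * x + th) * p x) =
  sigma ^+ 2 * u * charf th u.
Proof.
pose F x := sin (u * x + th) * p x.
pose f x := u * (cos (u * x + th) * p x) - (sigma ^+ 2)^-1 * (x * sin (u * x + th) * p x).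
have I1 : mu.-integrable setT (EFin \o (fun x => cos (u * x + th) * p x)).
  by apply: Ibp => // x; exact: cos_max.
have I2 : mu.-integrable setT (EFin \o (fun x => x * sin (u * x + th) * p x)).
  by apply: Ixbp => // x; exact: sin_max.
have I1' : mu.-integrable setT (EFin \o (fun x => u * (cos (u * x + th) * p x))).
  by have := @integrableZl _ _ _ mu _ measurableT u _ I1; apply: eq_integrable.
have I2' : mu.-integrable setT (EFin \o (fun x => (sigma ^+ 2)^-1 * (x * sin (u * x + th) * p x))).
  by have := @integrableZl _ _ _ mu _ measurableT (sigma ^+ 2)^-1 _ I2; apply: eq_integrable.
have If : mu.-integrable setT (EFin \o f).
  by have := integrableB measurableT I1' I2'; apply: eq_integrable.
have clin : continuous (fun x : R => u * x + th).
  by move=> x; apply: cvgD; [apply: cvgM; [exact: cvg_cst|exact: cvg_id]|exact: cvg_cst].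
have ccos : continuous (fun x : R => cos (u * x + th)).
  by move=> x; apply: continuous_comp; [exact: clin|exact: continuous_cos].
have csin : continuous (fun x : R => sin (u * x + th)).
  by move=> x; apply: continuous_comp; [exact: clin|exact: continuous_sin].
have cf : continuous f.
  move=> x; apply: cvgB; apply: cvgM; try exact: cvg_cst.
    by apply: cvgM; [exact: ccos|exact: cp].
  by apply: cvgM; [apply: cvgM; [exact: cvg_id|exact: csin]|exact: cp].
have dF (x : R) : is_derive x 1 F (f x).
  have dpx := dp x.
  by apply: is_derive_eq; rewrite /GRing.scale/= /f; ring.
have := Rintegral_derivative0 dF cf If.
rewrite RintegralB// RintegralZl// RintegralZl//.
have s0 : sigma ^+ 2 != 0 by rewrite gt_eqF// exprn_gt0.
move=> h; have {}h : u * charf th u - (sigma ^+ 2)^-1 * (\int[mu]_x (x * sin (u * x + th) * p x)) = 0.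
  apply: h; first by apply: p_cvg0 => n; exact: sin_max.
  under eq_fun do rewrite /F pN.
  by apply: p_cvg0 => n; exact: sin_max.
have /eqP := h; rewrite subr_eq0 => /eqP h'.
by rewrite -mulrA h' mulrA divff// mul1r.
Qed.

(** Differentiation under the integral, with the majorant |x| p(x), followed by
    Stein's identity. *)
Let charf_derive th (u : R) : is_derive u 1 (charf th) (- (sigma ^+ 2 * u) * charf th u).
Proof.
pose f (v x : R) := cos (v * x + th) * p x.
have u_in : [set` `]u - 1, u + 1[] u by rewrite /= in_itv/=; apply/andP; split; lra.
have d1f (v x : R) : is_derive v 1 (f ^~ x) (- (x * sin (v * x + th) * p x)).
  by apply: is_derive_eq; rewrite /GRing.scale/=; ring.
have Hd1 v x : derivable (f ^~ x) v 1 by have := d1f v x; case.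
have d1E v x : partial1of2 f v x = - (x * sin (v * x + th) * p x).
  by rewrite partial1of2E; have := d1f v x => h; rewrite derive_val.
have HI v : mu.-integrable setT (EFin \o f v).
  by apply: Ibp => // x; exact: cos_max.
have G0 y : 0 <= `|y| * p y by rewrite mulr_ge0.
have Gub v y : `|partial1of2 f v y| <= `|y| * p y.
  rewrite d1E normrN !normrM (ger0_norm (p0 _)) ler_wpM2r// ler_piMr//.
  exact: sin_max.
have D : derivable (charf th) u 1.
  exact: (@derivable_under_integral _ _ _ mu f setT measurableT u (u - 1) (u + 1) u_in
    (fun v _ => HI v) (fun v y _ _ => Hd1 v y) _ G0 Ixp (fun v y _ _ => Gub v y)).
apply: DeriveDef => //.
rewrite -derive1E.
have -> : (charf th)^`()%classic u = \int[mu]_y partial1of2 f u y.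
  exact: (@differentiation_under_integral _ _ _ mu f setT measurableT u (u - 1) (u + 1) u_in
    (fun v _ => HI v) (fun v y _ _ => Hd1 v y) _ G0 Ixp (fun v y _ _ => Gub v y)).
under eq_Rintegral do rewrite d1E.
have I2 : mu.-integrable setT (EFin \o (fun x => x * sin (u * x + th) * p x)).
  by apply: Ixbp => // x; exact: sin_max.
rewrite mulNr -stein -mulN1r -RintegralZl//; apply: eq_Rintegral => x _.
by rewrite mulN1r.
Qed.

(** The characteristic function solves y' = - sigma^2 u y, so its product with
    exp(sigma^2 u^2 / 2) is constant. *)
Lemma normal_pdf_charf th u :
  \int[mu]_x (cos (u * x + th) * normal_pdf 0 sigma x) =
  cos th * expR (- (sigma ^+ 2 * u ^+ 2) / 2).
Proof.
pose h v := charf th v * expR (sigma ^+ 2 * v ^+ 2 / 2).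
have dh (v : R) : is_derive v 1 h 0.
  have dc := charf_derive th v.
  by apply: is_derive_eq; rewrite /GRing.scale/=; field.
have hc : h u = h 0 by exact: (is_derive_0_is_cst u 0 dh).
have h0 : h 0 = cos th.
  rewrite /h expr0n/= mulr0 mul0r expR0 mulr1 /charf.
  under eq_Rintegral do rewrite mul0r add0r.
  rewrite RintegralZl// /Rintegral integral_normal_pdf/=.
  by rewrite mulr1.
rewrite -[LHS]/(charf th u).
have -> : charf th u = h u * expR (- (sigma ^+ 2 * u ^+ 2) / 2).
  by rewrite /h -mulrA -expRD mulNr addrN expR0 mulr1.
by rewrite hc h0.
Qed.

End normal_characteristic_function.

Lemma eq_law_integral d1 (T1 : measurableType d1) d2 (T2 : measurableType d2)
    (R : realType) (P1 : probability T1 R) (P2 : probability T2 R)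
    (X1 : T1 -> R) (X2 : T2 -> R) (g : R -> R) :
  measurable_fun setT X1 -> measurable_fun setT X2 ->
  (forall A, measurable A -> P1 (X1 @^-1` A) = P2 (X2 @^-1` A)) ->
  measurable_fun setT g ->
  (\int[P1]_w (g (X1 w))%:E = \int[P2]_w (g (X2 w))%:E)%E.
Proof.
move=> m1 m2 P12 mg.
have ge0 (f : R -> \bar R) : measurable_fun setT f -> (forall x, (0 <= f x)%E) ->
    (\int[P1]_w f (X1 w) = \int[P2]_w f (X2 w))%E.
  move=> mf f0.
  have e1 := @ge0_integral_pushforward _ _ T1 R R X1 m1 P1 setT f measurableT mf (fun y _ => f0 y).
  have e2 := @ge0_integral_pushforward _ _ T2 R R X2 m2 P2 setT f measurableT mf (fun y _ => f0 y).
  rewrite -[LHS]e1 -[RHS]e2; apply: eq_measure_integral => A mA _.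
  exact: P12.
have mE : measurable_fun setT (EFin \o g) by exact/measurable_EFinP.
have e1 := ge0 _ (measurable_funepos mE) (funepos_ge0 _).
have e2 := ge0 _ (measurable_funeneg mE) (funeneg_ge0 _).
rewrite integralE [RHS]integralE; congr (_ - _)%E.
  rewrite -[LHS](_ : \int[P1]_w (EFin \o g)^\+ (X1 w) = _)%E; last first.
    by apply: eq_integral => w _; rewrite !funeposE.
  by rewrite e1; apply: eq_integral => w _; rewrite !funeposE.
rewrite -[LHS](_ : \int[P1]_w (EFin \o g)^\- (X1 w) = _)%E; last first.
  by apply: eq_integral => w _; rewrite !funenegE.
by rewrite e2; apply: eq_integral => w _; rewrite !funenegE.
Qed.

Section gaussian_variables.
Context d (T : measurableType d) (R : realType) (P : probability T R).
Variables (X : T -> R) (v : R).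
Hypotheses (mX : measurable_fun setT X) (v0 : 0 <= v).
Local Notation L1 f := (P.-integrable setT (EFin \o f)).

(** The law of X is known on events, hence on nonnegative functions: the cosine
    is raised by 1 to become one. *)
Lemma normal_expec_cos (u th : R) : normally_distributed P X 0 v ->
  \int[P]_w cos (u * X w + th) = cos th * expR (- (v * u ^+ 2) / 2).
Proof.
move=> nX; pose g x := 1 + cos (u * x + th).
have mc : measurable_fun setT (fun x : R => cos (u * x + th)).
  apply: measurableT_comp; first exact: measurable_cos.
  by apply: measurable_funD => //; exact: measurable_funM.
have mg : measurable_fun setT g by exact: measurable_funD.
have g0 x : 0 <= g x.
  by have := cos_max (u * x + th); rewrite ler_norml => /andP[h _]; rewrite /g; lra.
have gE : (\int[P]_w (g (X w))%:E = (1 + cos th * expR (- (v * u ^+ 2) / 2))%:E)%E.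
  have [vp|vn] := ltP 0 v.
    pose s := Num.sqrt v; have s0 : 0 < s by rewrite sqrtr_gt0.
    have sE : s ^+ 2 = v by rewrite sqr_sqrtr.
    pose N : probability (measurableTypeR R) R := normal_prob 0 s.
    have mid : measurable_fun setT (idfun : measurableTypeR R -> R) by exact: measurable_id.
    have law A : measurable A -> P (X @^-1` A) = N (idfun @^-1` A).
      by move=> mA; rewrite (nX A mA) vp.
    have e := @eq_law_integral _ T _ (measurableTypeR R) R P N X idfun g mX mid law mg.
    rewrite e /= => {e}.
    have mp : measurable_fun setT (EFin \o normal_pdf 0 s).
      by apply/measurable_EFinP; exact: measurable_normal_pdf.
    have p0 x : (0 <= (EFin \o normal_pdf 0 s) x)%E by rewrite lee_fin normal_pdf_ge0.
    transitivity (\int[density_measure lebesgue_measure mp p0]_x (g x)%:E)%E.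
      by apply: eq_measure_integral.
    rewrite ge0_integral_density//; last by apply/measurable_EFinP.
    have Ip := integrable_normal_pdf 0 s.
    have Ic : lebesgue_measure.-integrable setT (EFin \o (fun x => cos (u * x + th) * normal_pdf 0 s x)).
      apply: le_integrable Ip => //.
        apply/measurable_EFinP/measurable_funM => //; exact: measurable_normal_pdf.
      move=> x _; rewrite /= lee_fin normrM ler_piMl//; exact: cos_max.
    under eq_integral do rewrite -EFinM /g mulrDl mul1r EFinD.
    rewrite integralD_EFin// integral_normal_pdf EFinD; congr (_ + _)%E.
    rewrite -sE -(normal_pdf_charf s0 th u) /Rintegral fineK//.
    exact: (integrable_fin_num measurableT Ic).
  have {}vn : v = 0 by apply/eqP; rewrite eq_le vn.
  rewrite (@eq_law_integral _ T _ T R P P X (cst 0) g) => //; last first.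
    move=> A mA; rewrite (nX A mA) vn ltxx.
    rewrite diracE; have [h|h] := boolP (0 \in A).
      by rewrite (_ : _ @^-1` _ = setT) ?probability_setT//; apply/seteqP; split=> // w _; exact/set_mem.
    rewrite (_ : _ @^-1` _ = set0) ?measure0//; apply/seteqP; split=> // w /= Aw.
    by case/negP: h; exact/mem_set.
  have e := EFin_expec (L1_cst P (g 0)).
  by rewrite -e expec_cst /g vn mulr0 mul0r oppr0 mul0r expR0 mulr1 add0r.
have Ic : L1 (fun w => cos (u * X w + th)).
  by apply: L1_cos; apply: measurable_funD => //; exact: measurable_funM.
have Ig : L1 (fun w => g (X w)) by apply: L1_D => //; exact: L1_cst.
move: gE; rewrite -EFin_expec// /g expecD//; last exact: L1_cst.
by rewrite expec_cst => -[] /addrI.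
Qed.

(** Fatou's lemma for 2 n^2 (1 - cos (X / n)), which tends to X^2 and whose
    expectation is 2 n^2 (1 - exp(- v / (2 n^2))) <= v. *)
Lemma second_moment_charf :
  (forall u, \int[P]_w cos (u * X w) = expR (- (v * u ^+ 2) / 2)) ->
  L2fun P X /\ \int[P]_w (X w ^+ 2) <= v.
Proof.
move=> cX.
pose f (n : nat) w : \bar R := (2 * n.+1%:R ^+ 2 * (1 - cos (n.+1%:R^-1 * X w)))%:E.
have f0 n w : (0 <= f n w)%E.
  by rewrite lee_fin mulr_ge0 ?onem_cos_ge0// mulr_ge0// sqr_ge0.
have mcn n : measurable_fun setT (fun w => cos (n.+1%:R^-1 * X w)).
  by apply: measurableT_comp; [exact: measurable_cos|exact: measurable_funM].
have mf n : measurable_fun setT (f n).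
  by apply/measurable_EFinP/measurable_funM => //; exact: measurable_funB.
have ff w : f n w @[n --> \oo] --> (X w ^+ 2)%:E.
  apply: cvg_EFin; first exact: nearW.
  apply: (@cvg_normr_le _ _ (fun n => (2 * X w ^+ 4) * harmonic n)); last first.
    by rewrite -(mulr0 (2 * X w ^+ 4)); apply: cvgM; [exact: cvg_cst|exact: cvg_harmonic].
  apply: nearW => n; rewrite /= /harmonic/=; set N : R := n.+1%:R.
  have N1 : 1 <= N by rewrite ler1n.
  have N0 : 0 < N by rewrite ltr0Sn.
  have -> : 2 * N ^+ 2 * (1 - cos (N^-1 * X w)) - X w ^+ 2 =
      - (2 * N ^+ 2 * (cos (N^-1 * X w) - 1 + (N^-1 * X w) ^+ 2 / 2)).
    by field; rewrite gt_eqF.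
  rewrite normrN normrM ger0_norm; last by rewrite mulr_ge0// sqr_ge0.
  have h := cos_taylor2 (N^-1 * X w).
  have N20 : 0 <= 2 * N ^+ 2 by rewrite mulr_ge0// sqr_ge0.
  rewrite (le_trans (ler_wpM2l N20 h))//.
  have -> : 2 * N ^+ 2 * (N^-1 * X w) ^+ 4 = 2 * X w ^+ 4 * (N^-1 * N^-1).
    by field; rewrite gt_eqF.
  rewrite ler_wpM2l//; first by rewrite mulr_ge0// exprn_even_ge0.
  by rewrite ler_piMr ?invr_ge0 ?(ltW N0)// invf_le1.
have If n : (\int[P]_w f n w <= v%:E)%E.
  have I1 : L1 (fun w => 1 - cos (n.+1%:R^-1 * X w)).
    by apply: L1_B; [exact: L1_cst|apply: L1_cos; exact: measurable_funM].
  rewrite /f -EFin_expec; last exact: L1_Z.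
  rewrite lee_fin expecZ// expecB; [|exact: L1_cst|by apply: L1_cos; exact: measurable_funM].
  rewrite expec_cst cX; set N : R := n.+1%:R.
  have N0 : 0 < N by rewrite ltr0Sn.
  have N20 : 0 <= 2 * N ^+ 2 by rewrite mulr_ge0// sqr_ge0.
  have h2 : 1 - expR (- (v * N^-1 ^+ 2) / 2) <= v * N^-1 ^+ 2 / 2.
    by rewrite mulNr lerBlDl -lerBlDr expR_ge1Dx.
  rewrite (le_trans (ler_wpM2l N20 h2))// le_eqVlt; apply/orP; left; apply/eqP.
  by field; rewrite gt_eqF.
have X2v : (\int[P]_w (X w ^+ 2)%:E <= v%:E)%E.
  have := fatou P measurableT mf (fun n w _ => f0 n w).
  have -> : (\int[P]_w limn_einf (f ^~ w) = \int[P]_w (X w ^+ 2)%:E)%E.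
    by apply: eq_integral => w _; exact: (cvg_limn_einf_sup (ff w)).1.
  move=> /le_trans; apply; rewrite limn_einf_lim.
  apply: lime_le; first exact: is_cvg_einfs.
  apply: nearW => n; apply: le_trans (If n).
  by apply: ereal_inf_lbound; exists n => /=.
have IX : L1 (fun w => X w ^+ 2).
  apply: ge0_L1; [exact: measurable_funX|by move=> w; exact: sqr_ge0|].
  by rewrite (le_lt_trans X2v)// ltry.
split; first by split.
by move: X2v; rewrite -EFin_expec// lee_fin.
Qed.

End gaussian_variables.

(** * The quantile transform *)

Lemma near_right_ex (R : realType) (s : R) (Q : R -> Prop) :
  (\forall x \near s^'+, Q x) -> exists2 x, s < x & Q x.
Proof.
move=> h; have h2 := @nbhs_right_gt _ s.
have [x [? ?]] := @filter_ex _ _ (at_right_proper_filter s) _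
  (@filterI _ _ (at_right_proper_filter s) _ _ h h2).
by exists x.
Qed.

Lemma cvge_near_lt {T : Type} {F : set_system T} {FF : Filter F} (R : realType)
    (f : T -> \bar R) (l c : \bar R) :
  f x @[x --> F] --> l -> (l < c)%E -> \forall x \near F, (f x < c)%E.
Proof. by move=> fl /open_ereal_lt' lc; exact: (fl _ lc). Qed.

Lemma cvge_near_gt {T : Type} {F : set_system T} {FF : Filter F} (R : realType)
    (f : T -> \bar R) (l c : \bar R) :
  f x @[x --> F] --> l -> (c < l)%E -> \forall x \near F, (c < f x)%E.
Proof. by move=> fl /open_ereal_gt' lc; exact: (fl _ lc). Qed.

Section quantile_transform.
Context d (T : measurableType d) (R : realType) (P : probability T R).

Lemma eq_law_rays (X : T -> R) (N : probability (measurableTypeR R) R) :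
  measurable_fun setT X ->
  (forall y, P (X @^-1` `]-oo, y]) = N `]-oo, y]%classic) ->
  forall A, measurable A -> P (X @^-1` A) = N A.
Proof.
move=> mX ray A mA.
have mX' : measurable_fun setT (X : T -> measurableTypeR R) by exact: mX.
pose X' : {mfun T >-> measurableTypeR R} :=
  HB.pack (X : T -> measurableTypeR R) (@isMeasurableFun.Build _ _ T (measurableTypeR R) X mX').
pose m1 : {measure set (measurableTypeR R) -> \bar R} := distribution P X'.
rewrite -[LHS]/(m1 A).
have mG : RGenOInfty.G (R := R) `<=` @measurable _ (measurableTypeR R).
  by move=> _ [x ->]; exact: measurable_itv.
apply: (@g_sigma_algebra_measure_unique _ R (measurableTypeR R) (@RGenOInfty.G R) mG
  (fun n => `]- n%:R, +oo[%classic) _ _ m1 N).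
- by move=> n; exists (- n%:R).
- apply/seteqP; split=> // x _; exists (Num.truncn `|x|).+1 => //=.
  rewrite in_itv/= andbT ltrNl (le_lt_trans _ (truncnS_gt _))//.
  by rewrite -normrN ler_norm.
- move=> _ _ [x ->] [y ->]; exists (Num.max x y).
  by apply/seteqP; split=> z /=; rewrite !in_itv/= !andbT gt_max;
    [case=> -> ->|case/andP].
- move=> _ [x ->].
  have -> : `]x, +oo[%classic = ~` `]-oo, x]%classic :> set (measurableTypeR R).
    by rewrite setCitvl.
  have mray : measurable (`]-oo, x]%classic : set (measurableTypeR R)) by exact: measurable_itv.
  transitivity (1 - N `]-oo, x]%classic)%E; last by symmetry; exact: probability_setC.
  by rewrite -ray; exact: (@probability_setC _ _ _ (distribution P X') _ mray).
- move=> n; rewrite (le_lt_trans (@probability_le1 _ _ _ (distribution P X') _ _))// ?ltry//.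
- have : ((@ocitv R).-sigma.-measurable)%classic A by exact: mA.
  by rewrite RGenOInfty.measurableE.
Qed.

Variable X : {RV P >-> R}.
Hypothesis noatom : forall x, P (X @^-1` [set x]) = 0%E.
Let F : R -> \bar R := cdf X.

Let FE x : F x = P (X @^-1` `]-oo, x]). Proof. by []. Qed.

Let Fnd x y : x <= y -> (F x <= F y)%E.
Proof. by move=> xy; exact: cdf_nondecreasing. Qed.

Let mX (B : set R) : measurable B -> measurable (X @^-1` B).
Proof. by move=> mB; rewrite -[X in measurable X]setTI; exact: measurable_funPT. Qed.

Let mFX (c : \bar R) : measurable [set w | (F (X w) <= c)%E].
Proof.
have m : measurable_fun setT (F \o X).
  by apply: measurableT_comp; [exact: cdf_measurable|exact: measurable_funPT].
have := m measurableT `]-oo, c]%classic (emeasurable_itv _).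
by rewrite setTI; congr measurable; apply/seteqP; split=> w /=; rewrite in_itv.
Qed.

(** Let s be the supremum of the x with F x <= u.  Right continuity gives
    F s >= u and the absence of an atom at s gives F s <= u, so the event is
    {X <= s} and has probability F s = u. *)
Lemma law_of_cdf (u : R) : 0 < u < 1 -> P [set w | (F (X w) <= u%:E)%E] = u%:E.
Proof.
move=> /andP[u0 u1].
pose S := [set x | (F x <= u%:E)%E].
have S0 : S !=set0.
  have : \forall x \near -oo, (F x < u%:E)%E.
    by apply: (cvge_near_lt (cvg_cdfNy0 X)); rewrite lte_fin.
  by move=> /filter_ex[x /ltW hx]; exists x.
have [x1 hx1] : exists x1, (u%:E < F x1)%E.
  have : \forall x \near +oo, (u%:E < F x)%E.
    by apply: (cvge_near_gt (cvg_cdfy1 X)); rewrite lte_fin.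
  by move=> /filter_ex[x hx]; exists x.
have Sub : has_ubound S.
  exists x1 => x Sx; rewrite leNgt; apply/negP => /ltW /Fnd h.
  by have := lt_le_trans hx1 h; rewrite ltNge Sx.
have supS : has_sup S by [].
pose s := sup S.
have lts x : x < s -> (F x <= u%:E)%E.
  move=> xs; have : 0 < s - x by rewrite subr_gt0.
  move=> /(@sup_adherent _ _) /(_ supS)[y Sy]; rewrite opprB addrC subrK => /ltW xy.
  exact: le_trans (Fnd xy) Sy.
have gts x : s < x -> (u%:E < F x)%E.
  move=> sx; rewrite ltNge; apply/negP => Sx.
  by have := ub_le_sup Sub Sx; rewrite leNgt sx.
have Fs_le : (F s <= u%:E)%E.
  have -> : F s = P (X @^-1` `]-oo, s[).
    rewrite FE (_ : X @^-1` `]-oo, s] = X @^-1` `]-oo, s[ `|` X @^-1` [set s]); last first.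
      apply/seteqP; split=> w /=; rewrite !in_itv/=.
        by rewrite le_eqVlt => /orP[/eqP ->|]; [right|left].
      by case=> [/ltW//|->].
    rewrite measureU//; [|exact: mX..|].
      by rewrite [X in (_ + X)%E](noatom s) adde0.
    by apply/seteqP; split=> // w /= [] /[swap] ->; rewrite in_itv/= ltxx.
  have -> : X @^-1` `]-oo, s[ = \bigcup_n X @^-1` `]-oo, s - n.+1%:R^-1].
    apply/seteqP; split=> w /=.
      rewrite in_itv/= => /ltr_add_invr[n nw]; exists n => //=.
      by rewrite in_itv/= lerBrDr ltW.
    by move=> [n _] /=; rewrite !in_itv/= => /le_lt_trans; apply; rewrite gtrBl invr_gt0.
  have cv : (P \o (fun n => X @^-1` `]-oo, s - n.+1%:R^-1])) n @[n --> \oo] -->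
      P (\bigcup_n X @^-1` `]-oo, s - n.+1%:R^-1]).
    apply: nondecreasing_cvg_mu => [n| |n m nm].
    - exact: mX.
    - by apply: bigcup_measurable => n _; exact: mX.
    - apply/subsetPset => w /=; rewrite !in_itv/= => /le_trans; apply.
      by rewrite lerD2l lerN2 lef_pV2 ?posrE// ler_nat.
  apply: (cvge_to_le cv); apply: nearW => n /=.
  by apply: lts; rewrite gtrBl invr_gt0.
have Fs_ge : (u%:E <= F s)%E.
  rewrite leNgt; apply/negP => h.
  have [] : exists x, s < x /\ (F x < u%:E)%E.
    have h1 : \forall x \near s^'+, (F x < u%:E)%E.
      by apply: (cvge_near_lt (@cdf_right_continuous _ _ _ _ X s)).
    by have [x sx ?] := near_right_ex h1; exists x.
  by move=> x [/gts /lt_trans h1 /h1]; rewrite ltxx.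
have Fs : F s = u%:E by apply/eqP; rewrite eq_le Fs_le.
rewrite -Fs FE; congr (P _); apply/seteqP; split=> w /=; rewrite in_itv/=.
  by rewrite -FE Fs => h; exact: ub_le_sup.
by move=> h; rewrite -FE; exact: Fnd.
Qed.

Let E0 := [set w | (F (X w) <= 0)%E].
Let E1 := [set w | (1 <= F (X w))%E].

Let PE0 : P E0 = 0%E.
Proof.
apply/eqP; rewrite eq_le measure_ge0 andbT; apply/lee_addgt0Pr => e e0; rewrite add0e.
pose u := Num.min e 2^-1.
have u01 : 0 < u < 1 by rewrite lt_min e0 invr_gt0 ltr0n gt_min invf_lt1// ltr1n orbT.
have /andP[u0 u1] := u01.
apply: (@le_trans _ _ u%:E); last by rewrite lee_fin ge_min lexx.
rewrite -(law_of_cdf u01); apply: le_measure; rewrite ?inE//; try exact: mFX.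
by move=> w /= h; rewrite (le_trans h)// lee_fin ltW.
Qed.

Let mE1 : measurable E1.
Proof.
have -> : E1 = ~` [set w | (F (X w) < 1)%E].
  by apply/seteqP; split=> w /=; rewrite /E1/= leNgt => /negP.
apply: measurableC.
have m : measurable_fun setT (F \o X).
  by apply: measurableT_comp; [exact: cdf_measurable|exact: measurable_funPT].
have := m measurableT `]-oo, 1%E[%classic (emeasurable_itv _).
by rewrite setTI; congr measurable; apply/seteqP; split=> w /=; rewrite in_itv.
Qed.

Let PE1 : P E1 = 0%E.
Proof.
apply/eqP; rewrite eq_le measure_ge0 andbT; apply/lee_addgt0Pr => e e0; rewrite add0e.
pose u := 1 - Num.min e 2^-1.
have v01 : 0 < Num.min e 2^-1 < 1 by rewrite lt_min e0 invr_gt0 ltr0n gt_min invf_lt1// ltr1n orbT.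
have u01 : 0 < u < 1 by move: v01 => /andP[? ?]; rewrite /u; apply/andP; split; lra.
apply: (@le_trans _ _ (1 - u%:E)%E); last first.
  by rewrite -EFinB lee_fin /u opprB addrC subrK ge_min lexx.
rewrite -(law_of_cdf u01) -probability_setC; last exact: mFX.
apply: le_measure; rewrite ?inE//.
- by apply: measurableC; exact: mFX.
- move=> w; rewrite /E1/= => h; apply/negP; rewrite -ltNge (lt_le_trans _ h)//.
  by rewrite lte_fin; case/andP: u01.
Qed.

(** g is the generalized inverse of the normal distribution function, composed
    with F: for 0 < F x < 1, g x <= y if and only if F x <= Phi y, and the latter
    event has probability Phi y because F (X) is uniform.  The values of X with
    F x = 0 or F x = 1 form a null event, on which g is set to 0. *)
Theorem gaussian_transform : exists2 g : R -> R, measurable_fun setT g &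
  forall A, measurable A -> P ((g \o X) @^-1` A) = normal_prob 0 1 A.
Proof.
pose N : probability (measurableTypeR R) R := normal_prob 0 1.
have mid : measurable_fun setT (idfun : measurableTypeR R -> R) by exact: measurable_id.
pose I : {RV N >-> R} := HB.pack (idfun : measurableTypeR R -> R)
  (@isMeasurableFun.Build _ _ (measurableTypeR R) R (idfun : measurableTypeR R -> R) mid).
pose Phi : R -> \bar R := cdf I.
have Phi_nd x y : x <= y -> (Phi x <= Phi y)%E by move=> xy; exact: cdf_nondecreasing.
have PhiE y : Phi y = N `]-oo, y]%classic by [].
pose S x := [set y | (F x <= Phi y)%E].
pose inner x := ((0 < F x) && (F x < 1))%E.
have S0 x : inner x -> S x !=set0.
  move=> /andP[_ F1]; have : \forall y \near +oo, (F x < Phi y)%E.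
    by apply: (cvge_near_gt (cvg_cdfy1 I)).
  by move=> /filter_ex[y /ltW hy]; exists y.
have Slb x : inner x -> has_lbound (S x).
  move=> /andP[F0 _]; have : \forall y \near -oo, (Phi y < F x)%E.
    by apply: (cvge_near_lt (cvg_cdfNy0 I)).
  move=> /filter_ex[y hy]; exists y => z Sz; rewrite leNgt; apply/negP => /ltW /Phi_nd zy.
  by have := lt_le_trans hy (le_trans Sz zy); rewrite ltxx.
pose g x := if inner x then inf (S x) else 0.
have gle x (y : R) : inner x -> (g x <= y) = (F x <= Phi y)%E.
  move=> ix; rewrite /g ix; apply/idP/idP; last first.
    by move=> h; apply: ge_inf => //; exact: Slb.
  move=> h; rewrite leNgt; apply/negP => FP.
  have h1 : \forall z \near y^'+, (Phi z < F x)%E.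
    by apply: (cvge_near_lt (@cdf_right_continuous _ _ _ _ I y)).
  have [z yz Fz] := near_right_ex h1.
  have : 0 < z - inf (S x) by rewrite subr_gt0 (le_lt_trans h).
  move=> /(@inf_adherent _ _) /(_ (conj (S0 _ ix) (Slb _ ix)))[v Sv].
  rewrite addrC subrK => /ltW /Phi_nd vz.
  by have := le_lt_trans (le_trans Sv vz) Fz; rewrite ltxx.
have gnle x y : ~~ inner x -> (g x <= y) = (0 <= y) by rewrite /g => /negbTE ->.
have mF : measurable_fun setT F by exact: cdf_measurable.
have minner : measurable [set x | inner x].
  have := mF measurableT `]0%E, 1%E[%classic (emeasurable_itv _).
  by rewrite setTI; congr measurable; apply/seteqP; split=> x /=; rewrite in_itv.
have mFP y : measurable [set x | (F x <= Phi y)%E].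
  have := mF measurableT `]-oo, Phi y]%classic (emeasurable_itv _).
  by rewrite setTI; congr measurable; apply/seteqP; split=> x /=; rewrite in_itv.
have mg : measurable_fun setT g.
  move=> _; apply: (measurability _ (RGenOInfty.measurableE R)) => //.
  move=> _ [_ [y ->] <-]; rewrite setTI.
  have -> : g @^-1` `]y, +oo[ = ~` (([set x | inner x] `&` [set x | (F x <= Phi y)%E]) `|`
      (~` [set x | inner x] `&` [set x | 0 <= y])).
    apply/seteqP; split=> x /=; rewrite in_itv/= andbT ltNge.
      move=> /negP h [[ix]|[/negP ix]]; rewrite -?gle// -?(gnle x)//.
    move=> h; apply/negP => h'; apply: h.
    have [ix|ix] := boolP (inner x); first by left; rewrite -gle.
    by right; split; [exact/negP|rewrite -(gnle x)].
  apply: measurableC; apply: measurableU; first exact: measurableI.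
  apply: measurableI; first exact: measurableC.
  have [y0|y0] := boolP (0 <= y).
    by rewrite (_ : [set _ | _] = setT)//; apply/seteqP.
  by rewrite (_ : [set _ | _] = set0)//; apply/seteqP; split=> // z /= h; case/negP: y0.
exists g => //; apply: (eq_law_rays (N := N)).
  by apply: measurableT_comp => //; exact: measurable_funPT.
move=> y; rewrite -PhiE.
have nullN : P (E0 `|` E1) = 0%E.
  apply/eqP; rewrite eq_le measure_ge0 andbT (le_trans (measureU2 _ _ _))//; [exact: mFX|].
  by rewrite [X in (X + _)%E]PE0 [X in (_ + X)%E]PE1 adde0.
have mE01 : measurable (E0 `|` E1) by apply: measurableU => //; exact: mFX.
have sub (A B : set T) : measurable A -> measurable B -> A `<=` B `|` (E0 `|` E1) -> (P A <= P B)%E.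
  move=> mA mB AB; rewrite -[leRHS]adde0 -nullN (le_trans _ (measureU2 _ _ _))//.
  by apply: le_measure; rewrite ?inE//; exact: measurableU.
have outer w : ~~ inner (X w) -> (E0 `|` E1) w.
  rewrite /inner negb_and -!leNgt => /orP[h|h]; [by left|by right].
have -> : P ((g \o X) @^-1` `]-oo, y]) = P [set w | (F (X w) <= Phi y)%E].
  have m1 : measurable ((g \o X) @^-1` `]-oo, y]).
    rewrite -[X in measurable X]setTI; apply: measurableT_comp => //; exact: measurable_funPT.
  apply/eqP; rewrite eq_le; apply/andP; split; apply: sub => //; try exact: mFX.
    move=> w /=; rewrite in_itv/=; have [ix|ix] := boolP (inner (X w)).
      by rewrite gle//; left.
    by right; exact: outer.
  move=> w /=; have [ix|ix] := boolP (inner (X w)); last by right; exact: outer.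
  by left; rewrite in_itv/= gle.
have Phi_fin : Phi y \is a fin_num by rewrite PhiE fin_num_measure//; exact: measurable_itv.
rewrite -(fineK Phi_fin).
have u0 : 0 <= fine (Phi y) by rewrite fine_ge0.
have u1 : fine (Phi y) <= 1 by rewrite -lee_fin fineK//; exact: cdf_le1.
move: u0 u1; rewrite le_eqVlt => /predU1P[<- _|u0]; first exact: PE0.
rewrite le_eqVlt => /predU1P[->|u1]; last by apply: law_of_cdf; rewrite u0.
rewrite (_ : [set _ | _] = setT) ?probability_setT//; apply/seteqP; split=> // w _ /=.
exact: cdf_le1.
Qed.

End quantile_transform.

(** * Gaussian sequences with prescribed covariances *)

Section gram_factorization.
Context {R : realType}.
Implicit Types (G : nat -> nat -> R) (c : nat -> R).

Definition quadratic_form G (K : nat) c : R :=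
  \sum_(j < K) \sum_(k < K) c j * c k * G j k.

Definition positive_kernel G : Prop :=
  (forall j k, G j k = G k j) /\ forall K c, 0 <= quadratic_form G K c.

Definition schur_complement G (j k : nat) : R :=
  G j.+1 k.+1 - G j.+1 0%N * G k.+1 0%N / G 0%N 0%N.

(** [cholesky i G k] is the coefficient of the i-th normal variable in the k-th
    term of the sequence: the transpose of the usual lower triangular factor,
    read off by eliminating one index at a time. *)
Fixpoint cholesky (i : nat) G (k : nat) : R :=
  match i, k with
  | 0, _ => G k 0%N / Num.sqrt (G 0%N 0%N)
  | i.+1, 0 => 0
  | i.+1, k.+1 => cholesky i (schur_complement G) k
  end.

Lemma cholesky_triangular i G k : (k < i)%N -> cholesky i G k = 0.
Proof. by elim: i G k => // i ih G [|k]//= ki; exact: ih. Qed.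

Lemma quadratic_form_recl G K c : (forall j k, G j k = G k j) ->
  quadratic_form G K.+1 c = c 0%N ^+ 2 * G 0%N 0%N
    + 2 * c 0%N * (\sum_(k < K) c k.+1 * G k.+1 0%N)
    + quadratic_form (fun j k => G j.+1 k.+1) K (fun k => c k.+1).
Proof.
move=> sG; rewrite /quadratic_form big_ord_recl big_ord_recl/=.
under [X in _ + _ + X = _]eq_bigr do rewrite big_ord_recl/=.
rewrite big_split/=.
under [X in _ + X + _ = _]eq_bigr do rewrite /bump/= add1n (sG 0%N) -mulrA.
rewrite -mulr_sumr.
under [X in _ + _ + (X + _) = _]eq_bigr do
  rewrite /bump/= add1n (mulrC (c _.+1)) -mulrA.
rewrite -mulr_sumr.
under [X in _ + _ + (_ + X) = _]eq_bigr do under eq_bigr do rewrite /bump/= !add1n.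
by ring.
Qed.

Lemma quadratic_form_schur G K c : (forall j k, G j k = G k j) ->
  quadratic_form (schur_complement G) K c =
  quadratic_form (fun j k => G j.+1 k.+1) K c
    - (\sum_(k < K) c k * G k.+1 0%N) ^+ 2 / G 0%N 0%N.
Proof.
move=> sG; rewrite /quadratic_form /schur_complement expr2 mulr_suml mulr_suml.
rewrite -sumrB; apply: eq_bigr => j _.
rewrite mulr_sumr mulr_suml -sumrB; apply: eq_bigr => k _.
by ring.
Qed.

(** Otherwise the quadratic form would be affine and nonconstant in the
    coordinate of index 0, hence negative somewhere.  This makes the division by
    G 0 0 = 0 in the Schur complement harmless. *)
Lemma positive_kernel_col0 G k : positive_kernel G -> G 0%N 0%N = 0 -> G k 0%N = 0.
Proof.
move=> [sG pG] G00; case: k => // k.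
pose c x i : R := if i is i'.+1 then (i' == k)%:R else x.
have b : \sum_(i < k.+1) (i == k :> nat)%:R * G i.+1 0%N = G k.+1 0%N.
  rewrite big_ord_recr/= eqxx mul1r big1 ?add0r// => i _.
  by rewrite ltn_eqF ?mul0r.
pose q := quadratic_form (fun i j => G i.+1 j.+1) k.+1 (fun i => (i == k)%:R).
have h x : 0 <= 2 * x * G k.+1 0%N + q.
  have := pG k.+2 (c x); rewrite quadratic_form_recl//= G00 mulr0 add0r.
  by rewrite b.
apply/eqP/negP => /negP g0.
have := h (- (q + 1) / (2 * G k.+1 0%N)).
rewrite (_ : 2 * _ * _ = - (q + 1)); last by field.
by apply/negP; rewrite -ltNge; lra.
Qed.

Lemma positive_kernel_ge0 G : positive_kernel G -> 0 <= G 0%N 0%N.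
Proof.
move=> [_ pG]; have := pG 1%N (fun=> 1).
by rewrite /quadratic_form !big_ord_recl !big_ord0 !addr0 !mul1r.
Qed.

(** The Schur complement is the minimum of the quadratic form over the
    coordinate of index 0, attained at - b / G 0 0 when G 0 0 is positive. *)
Lemma schur_complement_positive G : positive_kernel G -> positive_kernel (schur_complement G).
Proof.
move=> pG; have [sG qG] := pG.
split=> [j k|K c]; first by rewrite /schur_complement sG (mulrC (G j.+1 0%N)).
rewrite quadratic_form_schur//; set b := \sum_(_ < _) _.
pose c' i := if i is i'.+1 then c i' else - b / G 0%N 0%N.
have := qG K.+1 c'; rewrite quadratic_form_recl//= -/b.
have [G0|G0] := eqVneq (G 0%N 0%N) 0.
  by rewrite G0 invr0 !mulr0 !mul0r !add0r subr0.
set q := quadratic_form _ _ _.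
by rewrite (_ : _ + q = q - b ^+ 2 / G 0%N 0%N)//; field.
Qed.

(** Completing the square in the coordinate of index 0 leaves the Schur
    complement, to which the induction hypothesis applies. *)
Lemma cholesky_factorization G K c : positive_kernel G ->
  quadratic_form G K c = \sum_(i < K) (\sum_(k < K) c k * cholesky i G k) ^+ 2.
Proof.
elim: K G c => [|K ih] G c pG; first by rewrite /quadratic_form !big_ord0.
have [sG _] := pG.
rewrite quadratic_form_recl// big_ord_recl/=.
under [X in _ = _ + X]eq_bigr do rewrite big_ord_recl/= mulr0 add0r.
rewrite -(ih (schur_complement G) (fun k => c k.+1)); last exact: schur_complement_positive.
rewrite quadratic_form_schur// big_ord_recl/=.
under [X in _ = (_ + X) ^+ 2 + _]eq_bigr do rewrite /bump/= add1n mulrA.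
rewrite -mulr_suml; set b := \sum_(_ < _) _; set q := quadratic_form _ _ _.
have [G0|G0] := eqVneq (G 0%N 0%N) 0.
  have -> : b = 0.
    by rewrite /b big1// => i _; rewrite (positive_kernel_col0 _ pG)// mulr0.
  by rewrite G0 sqrtr0 !invr0; ring.
have s2 : Num.sqrt (G 0%N 0%N) ^+ 2 = G 0%N 0%N by rewrite sqr_sqrtr// positive_kernel_ge0.
have : Num.sqrt (G 0%N 0%N) != 0 by apply: contra_neq G0 => s0; rewrite -s2 s0 expr0n.
move: s2; move: (Num.sqrt _) => s <- s0; field; exact: s0.
Qed.

End gram_factorization.

Section gaussian_sequence.
Context d (T : measurableType d) (R : realType) (P : probability T R).
Local Notation L1 := (fun f : T -> R => P.-integrable setT (EFin \o f)).

Lemma second_moment_positive_kernel (Y : nat -> T -> R) : (forall k, L2fun P (Y k)) ->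
  (forall K c, quadratic_form (fun j k => \int[P]_w (Y j w * Y k w)) K c =
    \int[P]_w ((\sum_(k < K) c k * Y k w) ^+ 2)) /\
  positive_kernel (fun j k => \int[P]_w (Y j w * Y k w)).
Proof.
move=> Y2.
have H K c : quadratic_form (fun j k => \int[P]_w (Y j w * Y k w)) K c =
    \int[P]_w ((\sum_(k < K) c k * Y k w) ^+ 2).
  have -> : \int[P]_w ((\sum_(k < K) c k * Y k w) ^+ 2) =
      \int[P]_w (\sum_(j < K) \sum_(k < K) c j * c k * (Y j w * Y k w)).
    apply: expec_eq => w; rewrite expr2 mulr_suml; apply: eq_bigr => j _.
    by rewrite mulr_sumr; apply: eq_bigr => k _; ring.
  rewrite expec_sum; last first.
    by move=> j; apply: L1_sum => k; apply: L1_Z; exact: L2_M.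
  apply: eq_bigr => j _; rewrite expec_sum; last first.
    by move=> k; apply: L1_Z; exact: L2_M.
  by apply: eq_bigr => k _; rewrite expecZ//; exact: L2_M.
split=> //; split=> [j k|K c]; first by apply: expec_eq => w; rewrite mulrC.
by rewrite H; apply: expec_ge0 => w; exact: sqr_ge0.
Qed.

Context d' (T' : measurableType d') (P' : probability T' R).

(** A linear combination of independent normals is normal with the sum of the
    squares of its coefficients as variance, which [cholesky_factorization]
    identifies with the quadratic form of G. *)
Theorem gaussian_sequence_exists (Z : nat -> T' -> R) (G : nat -> nat -> R) :
  (forall k, measurable_fun setT (Z k)) -> mutually_independent P' Z ->
  (forall k A, measurable A -> P' (Z k @^-1` A) = normal_prob 0 1 A) ->
  positive_kernel G ->
  exists2 g : nat -> T' -> R, forall k, measurable_fun setT (g k) &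
    forall K (c : nat -> R) th, \int[P']_w cos ((\sum_(k < K) c k * g k w) + th) =
      cos th * expR (- quadratic_form G K c / 2).
Proof.
move=> mZ iZ nZ pG.
pose g k w := \sum_(i < k.+1) cholesky i G k * Z i w.
exists g.
  move=> k; apply: measurable_sum => i; exact: measurable_funM.
move=> K c th.
pose a i := \sum_(k < K) c k * cholesky i G k.
have gE w : \sum_(k < K) c k * g k w = \sum_(i < K) a i * Z i w.
  have -> : \sum_(k < K) c k * g k w = \sum_(k < K) \sum_(i < K) c k * cholesky i G k * Z i w.
    apply: eq_bigr => k _; rewrite /g mulr_sumr.
    rewrite (big_ord_widen K (fun i => c k * (cholesky i G k * Z i w)))//.
    rewrite big_mkcond/=; apply: eq_bigr => i _; case: ifPn => [_|]; first by rewrite mulrA.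
    by rewrite -leqNgt => /cholesky_triangular ->; rewrite mulr0 mul0r.
  rewrite exchange_big/=; apply: eq_bigr => i _; rewrite /a mulr_suml.
  by [].
under expec_eq do rewrite gE.
rewrite cholesky_factorization//.
have ind : mutually_independent P' (fun k w => a k * Z k w).
  by apply: (mutually_independent_comp (g := fun k x => a k * x)) => // k; exact: measurable_funM.
have nZ' k : normally_distributed P' (Z k) 0 1.
  by move=> A mA; rewrite ltr01 sqrtr1; exact: nZ.
have cZ k th' : \int[P']_w cos (a k * Z k w + th') = cos th' * expR (- (a k ^+ 2) / 2).
  by rewrite (normal_expec_cos (mZ k) ler01 _ _ (nZ' k)) mul1r.
have mY k : measurable_fun setT (fun w => a k * Z k w) by exact: measurable_funM.
have cY k : \int[P']_w cos (a k * Z k w) = expR (- (a k ^+ 2) / 2).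
  by have := cZ k 0; rewrite cos0 mul1r => <-; apply: expec_eq => w; rewrite addr0.
have sY k : \int[P']_w sin (a k * Z k w) = 0.
  have -> : \int[P']_w sin (a k * Z k w) = \int[P']_w cos (a k * Z k w + - (pi / 2)).
    by apply: expec_eq => w; rewrite cosBpihalf.
  by rewrite cZ cosN cos_pihalf mul0r.
have [cS sS] : \int[P']_w cos (\sum_(i < K) a i * Z i w) = expR (- (\sum_(i < K) a i ^+ 2) / 2)
    /\ \int[P']_w sin (\sum_(i < K) a i * Z i w) = 0.
  move: a {gE} ind {cZ} mY cY sY => a ind mY cY sY; elim: K => [|K [cS sS]].
    split; under expec_eq do rewrite big_ord0.
      by rewrite big_ord0 oppr0 mul0r expR0 cos0 expec_cst.
    by rewrite sin0 expec_cst.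
  rewrite (expec_cos_sum_recr mY ind) (expec_sin_sum_recr mY ind).
  rewrite cS sS cY sY !mulr0 !mul0r subr0 addr0; split=> //.
  by rewrite -expRD big_ord_recr/= opprD mulrDl.
rewrite expec_cosD; last by apply: measurable_sum => i; exact: mY.
by rewrite cS sS mulr0 subr0.
Qed.

End gaussian_sequence.

(** * Conditioning on alpha and on all but one of the inputs *)

Section law_on_event.
Context d (T : measurableType d) d' (U : measurableType d') (R : realType).
Variables (P : probability T R) (X : {mfun T >-> U}) (E : set T).
Hypothesis mE : measurable E.

(** The measurability of E is an argument so that the finite measure structure
    below can be inferred from the term. *)
Definition law_on_event & measurable E : set U -> \bar R :=
  fun A => P (X @^-1` A `&` E).

Let nu := law_on_event mE.

Let mpre A : measurable A -> measurable (X @^-1` A).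
Proof. by move=> mA; rewrite -[X in measurable X]setTI; exact: measurable_funPT. Qed.

Let law0 : nu set0 = 0%E.
Proof. by rewrite /nu /law_on_event preimage_set0 set0I measure0. Qed.

Let law_ge0 A : (0 <= nu A)%E.
Proof. exact: measure_ge0. Qed.

Let law_sigma_additive : semi_sigma_additive nu.
Proof.
move=> F mF tF mUF; rewrite /nu /law_on_event preimage_bigcup setI_bigcupl.
apply: measure_semi_sigma_additive.
- by move=> n; apply: measurableI => //; exact: mpre.
- apply/trivIsetP => /= i j _ _ ij; rewrite setIACA -preimage_setI.
  by move/trivIsetP : tF => /(_ _ _ _ _ ij) ->//; rewrite preimage_set0 set0I.
- by rewrite -setI_bigcupl -preimage_bigcup; apply: measurableI => //; exact: mpre.
Qed.

HB.instance Definition _ := isMeasure.Build _ _ _ (law_on_event mE)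
  law0 law_ge0 law_sigma_additive.

Let law_finite : fin_num_fun nu.
Proof.
by move=> A mA; apply: fin_num_measure; apply: measurableI => //; exact: mpre.
Qed.

HB.instance Definition _ := Measure_isFinite.Build _ _ _ (law_on_event mE) law_finite.

End law_on_event.

Section conditional_versions.
Context d (T : measurableType d) (R : realType) (P : probability T R).
Variable alpha : {mfun T >-> R}.
Let malpha : measurable_fun setT alpha. Proof. exact: measurable_funPT. Qed.

(** The law of alpha on E is dominated by the law of alpha; its Radon-Nikodym
    derivative is a version of P(E | alpha). *)
Lemma cond_prob_exists (E : set T) : measurable E ->
  exists2 g : R -> R, forall a, 0 <= g a & is_cond_prob P alpha E g.
Proof.
move=> mE.
have mpre A : measurable A -> measurable (alpha @^-1` A).
  by move=> mA; rewrite -[X in measurable X]setTI; exact: malpha.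
pose nu : {finite_measure set R -> \bar R} := law_on_event P alpha mE.
pose mu : {finite_measure set R -> \bar R} := law_on_event P alpha measurableT.
have nuE A : nu A = P (alpha @^-1` A `&` E) by [].
have muE A : mu A = P (alpha @^-1` A) by rewrite -[in RHS](setIT (alpha @^-1` A)).
have numu : nu `<< mu.
  apply/null_content_dominatesP => A mA A0; have A0' : P (alpha @^-1` A) = 0%E by rewrite -muE.
  apply/eqP; rewrite eq_le measure_ge0 andbT -A0' nuE; apply: le_measure; rewrite ?inE.
  - by apply: measurableI => //; exact: mpre.
  - exact: mpre.
  - exact: subIsetl.
have [f [f0 If fE]] := radon_nikodym_finite numu.
have mf := measurable_int _ If.
exists (fun a => fine (f a)); first by move=> a; exact: fine_ge0.
split; first exact: measurableT_comp.
move=> A mA; rewrite -nuE fE//.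
have -> : (\int[mu]_(x in A) f x = \int[mu]_(x in A) (fine (f x))%:E)%E.
  apply: ae_eq_integral => //.
  - exact: measurable_funTS.
  - by apply/measurable_funTS/measurable_EFinP; exact: measurableT_comp.
  have := integrable_ae measurableT If; apply: filterS => x /(_ I) fx _.
  by rewrite fineK.
have -> : (\int[mu]_(x in A) (fine (f x))%:E = \int[pushforward P alpha]_(x in A) (fine (f x))%:E)%E.
  by apply: eq_measure_integral => B mB _ /=; rewrite /law_on_event/= setIT.
rewrite ge0_integral_pushforward//.
- by apply/measurable_funTS/measurable_EFinP; exact: measurableT_comp.
- by move=> a _; rewrite lee_fin fine_ge0.
Qed.

End conditional_versions.

Section conditional_independence.
Context d (T : measurableType d) (R : realType) (P : probability T R).
Variables (alpha : {mfun T >-> R}) (I : eqType) (Y : I -> T -> nat).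
Let malpha : measurable_fun setT alpha. Proof. exact: measurable_funPT. Qed.
Hypothesis mY : forall i, measurable_fun setT (Y i).
Hypothesis indY : cond_independent P alpha Y.

(** The events that depend on alpha and on finitely many of the Y i with
    i != i0: a pi-system that generates the information carried by alpha and by
    all the inputs except the one of index i0. *)
Definition other_events (i0 : I) : set (set T) :=
  [set E | exists (A : set R) (s : seq I) (B : I -> set nat),
    [/\ measurable A, i0 \notin s &
        E = alpha @^-1` A `&` [set w | forall i, i \in s -> B i (Y i w)]]].

Definition other_space (i0 : I) : Type := g_sigma_algebraType (other_events i0).

Lemma measurable_nat_preimage i (B : set nat) : measurable (Y i @^-1` B).
Proof. by rewrite -[X in measurable X]setTI; exact: mY. Qed.

Lemma measurable_alpha_preimage (A : set R) : measurable A -> measurable (alpha @^-1` A).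
Proof. by move=> mA; rewrite -[X in measurable X]setTI; exact: malpha. Qed.

Lemma measurable_finite_event (s : seq I) (B : I -> set nat) :
  measurable [set w | forall i, i \in s -> B i (Y i w)].
Proof.
elim: s => [|i s ih].
  by rewrite (_ : [set _ | _] = setT)//; apply/seteqP; split.
rewrite (_ : [set _ | _] = Y i @^-1` B i `&` [set w | forall i, i \in s -> B i (Y i w)]).
  by apply: measurableI => //; exact: measurable_nat_preimage.
apply/seteqP; split=> w /=.
  by move=> h; split=> [|j js]; apply: h; rewrite inE ?eqxx ?js ?orbT.
by move=> [h1 h2] j; rewrite inE => /predU1P[->//|]; exact: h2.
Qed.

Lemma other_events_measurable i0 : other_events i0 `<=` measurable.
Proof.
move=> _ [A [s [B [mA _ ->]]]]; apply: measurableI; last exact: measurable_finite_event.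
exact: measurable_alpha_preimage.
Qed.

Lemma other_events_setI i0 : setI_closed (other_events i0).
Proof.
move=> _ _ [A [s [B [mA is0 ->]]]] [A' [s' [B' [mA' is0' ->]]]].
exists (A `&` A'), (s ++ s'), (fun i => [set k | (i \in s -> B i k) /\ (i \in s' -> B' i k)]).
split; [exact: measurableI|by rewrite mem_cat negb_or is0|].
apply/seteqP; split=> w /=.
  move=> [[Aw h] [A'w h']]; split=> // i _; split=> [/h//|/h'//].
move=> [[Aw A'w] h]; split; split=> // i is1.
  by have [+ _] := h i (ltac:(by rewrite mem_cat is1)); exact.
by have [_ +] := h i (ltac:(by rewrite mem_cat is1 orbT)); exact.
Qed.

Lemma other_events_setT i0 : other_events i0 setT.
Proof.
exists setT, [::], (fun=> setT); split=> //.
by apply/seteqP; split.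
Qed.

Lemma measurable_other_alpha i0 : measurable_fun (setT : set (other_space i0)) (alpha : other_space i0 -> R).
Proof.
move=> _ A mA; rewrite setTI; apply: sub_sigma_algebra.
exists A, [::], (fun=> setT); split=> //.
by apply/seteqP; split=> w //= -[].
Qed.

Lemma measurable_other_input i0 i : i != i0 ->
  measurable_fun (setT : set (other_space i0)) (Y i : other_space i0 -> nat).
Proof.
move=> ii0 _ B mB; rewrite setTI; apply: sub_sigma_algebra.
exists setT, [:: i], (fun=> B); split=> //; first by rewrite inE eq_sym.
by apply/seteqP; split=> w //=; [move=> Bw; split=> // j; rewrite inE => /eqP ->|move=> [_]; apply; rewrite inE].
Qed.

Lemma cond_prob_finite_event (s : seq I) (B : I -> set nat) (g : I -> R -> R) :
  uniq s -> (forall i, is_cond_prob P alpha (Y i @^-1` B i) (g i)) ->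
  is_cond_prob P alpha [set w | forall i, i \in s -> B i (Y i w)]
    (fun a => \prod_(i <- s) g i a).
Proof.
move=> /(@tuple_uniqP _ _ (in_tuple s)) us hg.
have [mg hP] := indY us (fun k => hg (tnth (in_tuple s) k)).
split; first by apply: eq_measurable_fun mg => a _; rewrite [RHS]big_tnth.
move=> A mA; under eq_integral do rewrite big_tnth.
rewrite -hP//; congr (P (_ `&` _)); apply/seteqP; split=> w /= h.
  by move=> k; apply: h; exact: mem_tnth.
by move=> i /(@tnthP _ _ (in_tuple s))[k ->]; exact: h.
Qed.

Lemma integral_mul_indic (D : set T) (f : T -> \bar R) :
  (\int[P]_(w in D) f w = \int[P]_w (f w * (\1_D w)%:E))%E.
Proof.
rewrite integral_mkcond; apply: eq_integral => w _.
by rewrite /patch indicE; case: ifPn => _; rewrite ?mule1 ?mule0.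
Qed.

(** The defining property of a conditional probability, extended from the events
    {alpha \in A} to the nonnegative functions of alpha. *)
Lemma is_cond_prob_integral (E : set T) (g : R -> R) (h : R -> \bar R) :
  measurable E -> is_cond_prob P alpha E g -> (forall w, 0 <= g (alpha w)) ->
  measurable_fun setT h -> (forall w, (0 <= h (alpha w))%E) ->
  (\int[P]_w (h (alpha w) * (\1_E w)%:E) = \int[P]_w (h (alpha w) * (g (alpha w))%:E))%E.
Proof.
move=> mE [mg hg] g0 mh h0.
pose G := [set D | exists2 A : set R, measurable A & D = alpha @^-1` A].
apply: (@eq_integral_weight _ _ _ P G _ _ _ _ _ (fun w => h (alpha w))) => //.
- by move=> _ [A mA ->]; exact: measurable_alpha_preimage.
- by exists setT.
- by move=> _ _ [A mA ->] [B mB ->]; exists (A `&` B) => //; exact: measurableI.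
- exact: measurableT_comp.
- rewrite integral_indic// setIT (le_lt_trans (probability_le1 P mE))// ltry//.
- move=> _ [A mA ->]; rewrite -hg// integral_indic//; last exact: measurable_alpha_preimage.
  by rewrite setIC.
- move=> _ B mB; rewrite setTI; apply: sub_sigma_algebra.
  exists (h @^-1` B) => //; rewrite -[X in measurable X]setTI; exact: mh.
Qed.

(** By conditional independence P(Y i0 \in B | alpha, (Y i)_(i != i0)) is
    P(Y i0 \in B | alpha).  On the pi-system of the other events this is the
    product formula, in which versions for the other factors are supplied by
    [cond_prob_exists]; then [eq_integral_weight] extends it. *)
Lemma cond_prob_other i0 (B : set nat) (g : R -> R) (H : T -> \bar R) :
  is_cond_prob P alpha (Y i0 @^-1` B) g -> (forall w, 0 <= g (alpha w)) ->
  measurable_fun (setT : set (other_space i0)) (H : other_space i0 -> \bar R) ->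
  (forall w, (0 <= H w)%E) ->
  (\int[P]_w (H w * (\1_(Y i0 @^-1` B) w)%:E) = \int[P]_w (H w * (g (alpha w))%:E))%E.
Proof.
move=> hg g0 mH H0; have [mg gP] := hg.
apply: (@eq_integral_weight _ _ _ P (other_events i0)) => //.
- exact: other_events_measurable.
- exact: other_events_setT.
- exact: other_events_setI.
- by apply: measurable_indic; exact: measurable_nat_preimage.
- exact: measurableT_comp.
- rewrite integral_indic// ?setIT; last exact: measurable_nat_preimage.
  by rewrite (le_lt_trans (probability_le1 P _)) ?ltry//; exact: measurable_nat_preimage.
move=> E [A [s0 [B0 [mA is0 ->]]]].
pose s := undup s0.
have us : uniq s by exact: undup_uniq.
have is1 : i0 \notin s by rewrite mem_undup.
pose F := [set w | forall i, i \in s -> B0 i (Y i w)].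
have -> : [set w | forall i, i \in s0 -> B0 i (Y i w)] = F.
  by apply/seteqP; split=> w /= h i; move: (h i); rewrite mem_undup.
have mF : measurable F by exact: measurable_finite_event.
have ver i : exists v : R -> R, (forall a, 0 <= v a) /\ is_cond_prob P alpha (Y i @^-1` B0 i) v.
  by have [v v0 hv] := cond_prob_exists P alpha (measurable_nat_preimage i (B0 i)); exists v.
have [v hv] := choice ver.
pose p a := \prod_(i <- s) v i a.
have p0 a : 0 <= p a by apply: prodr_ge0 => i _; exact: (hv i).1.
have hF : is_cond_prob P alpha F p by apply: cond_prob_finite_event => // i; exact: (hv i).2.
pose B1 i := if i == i0 then B else B0 i.
pose v1 i := if i == i0 then g else v i.
pose F1 := [set w | forall i, i \in i0 :: s -> B1 i (Y i w)].
have hF1 : is_cond_prob P alpha F1 (fun a => \prod_(i <- i0 :: s) v1 i a).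
  apply: cond_prob_finite_event; first by rewrite /= is1.
  by move=> i; rewrite /B1 /v1; case: eqP => [->//|_]; exact: (hv i).2.
have F1E : F1 = F `&` Y i0 @^-1` B.
  apply/seteqP; split=> w /=.
    move=> h; split=> [i si|]; last first.
      by have := h i0; rewrite /B1 eqxx; apply; rewrite inE eqxx.
    have := h i; rewrite /B1 inE si orbT; case: eqP => [ii0|_]; last exact.
    by move: si; rewrite ii0 (negbTE is1).
  move=> [h1 h2] i; rewrite inE /B1; case: eqP => [->//|_]/=; exact: h1.
have pE a : \prod_(i <- i0 :: s) v1 i a = g a * p a.
  rewrite big_cons /v1 eqxx; congr (_ * _); apply: eq_big_seq => i si.
  by case: eqP => // ii0; move: si; rewrite ii0 (negbTE is1).
have mE : measurable (alpha @^-1` A `&` F).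
  by apply: measurableI => //; exact: measurable_alpha_preimage.
rewrite integral_indic//; last exact: measurable_nat_preimage.
transitivity (P (alpha @^-1` A `&` F1)); first by rewrite F1E setIC setIA.
rewrite hF1.2//.
under [LHS]eq_integral do rewrite pE.
rewrite [LHS]integral_mul_indic [RHS]integral_mul_indic.
transitivity (\int[P]_w (((fun a => (g a)%:E * (\1_A a)%:E) (alpha w)) * (p (alpha w))%:E))%E.
  apply: eq_integral => w _ /=; rewrite EFinM muleAC; congr (_ * _ * _)%E.
rewrite -(@is_cond_prob_integral _ _ (fun a => (g a)%:E * (\1_A a)%:E)%E mF hF)//.
- apply: eq_integral => w _ /=; rewrite indicI /= EFinM muleA; congr (_ * _ * _)%E.
- by apply: emeasurable_funM; apply/measurable_EFinP => //; exact: measurable_indic.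
- by move=> w; rewrite mule_ge0// lee_fin.
Qed.

End conditional_independence.

(** * Poisson moments and random sums *)

Section nonnegative_series.
Context {R : realType}.
Implicit Types f : nat -> \bar R.
Local Open Scope ereal_scope.

Lemma nneseries_finite f N : (forall i, 0 <= f i) -> (forall i, (N <= i)%N -> f i = 0) ->
  \sum_(i <oo) f i = \sum_(i < N) f i.
Proof.
move=> f0 fN; rewrite (nneseries_split 0%N N)// add0n (@eseries0 _ _ N) ?adde0 ?big_mkord//.
by move=> i Ni _; exact: fN.
Qed.

Lemma nneseries_single f (N : nat) : (forall i, 0 <= f i) -> (forall i, i != N -> f i = 0) ->
  \sum_(i <oo) f i = f N.
Proof.
move=> f0 fN; rewrite (@nneseriesD1 _ f N xpredT)// eseries0 ?adde0// => i _ /=; exact: fN.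
Qed.

Lemma nneseries_shift f : (forall i, 0 <= f i) -> f 0%N = 0 ->
  \sum_(i <oo) f i = \sum_(i <oo) f i.+1.
Proof.
move=> f0 f00; rewrite nneseries_recl// f00 add0e -nneseries_addn//.
by apply: eq_eseriesr => i _; rewrite addn1.
Qed.

End nonnegative_series.

Section poisson_moments.
Context {R : realType} (r : R).
Hypothesis r0 : 0 < r.
Local Notation p := (poisson_pmf r).

Let p0 m : 0 <= p m. Proof. exact: poisson_pmf_ge0. Qed.

Lemma poisson_pmf_sum : (\sum_(m <oo) (p m)%:E = 1)%E.
Proof.
have := probability_setT (poisson_prob r 0).
by rewrite /= /poisson_prob r0 -nneseries_esumT// => m _; rewrite lee_fin.
Qed.

(** This identity shifts the index of the series of the first two moments. *)
Lemma poisson_pmfS m : m.+1%:R * p m.+1 = r * p m.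
Proof.
rewrite /poisson_pmf r0 factS natrM exprS invfM.
have : m.+1%:R != 0 :> R by rewrite pnatr_eq0.
have : m`!%:R != 0 :> R by rewrite pnatr_eq0 -lt0n fact_gt0.
move: (m.+1%:R : R) => x h1 h2; field; exact/andP.
Qed.

Lemma poisson_mean : (\sum_(m <oo) (m%:R * p m)%:E = r%:E)%E.
Proof.
rewrite nneseries_shift; [|by move=> i; rewrite lee_fin mulr_ge0|by rewrite mul0r].
under eq_eseriesr do rewrite poisson_pmfS EFinM.
by rewrite nneseriesZl ?poisson_pmf_sum ?mule1// => i _; rewrite lee_fin.
Qed.

Lemma poisson_second_moment : (\sum_(m <oo) (m%:R ^+ 2 * p m)%:E = (r ^+ 2 + r)%:E)%E.
Proof.
rewrite nneseries_shift; [|by move=> i; rewrite lee_fin mulr_ge0// sqr_ge0|by rewrite expr0n mul0r].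
under eq_eseriesr.
  move=> m _; rewrite (_ : _ * _ = r * (m%:R * p m + p m)); last first.
    by rewrite expr2 -mulrA poisson_pmfS mulrCA -natr1 mulrDl mul1r.
  rewrite EFinM EFinD; over.
rewrite /= nneseriesZl; last by move=> i _; rewrite -EFinD lee_fin addr_ge0// mulr_ge0.
rewrite nneseriesD; [|by move=> i _; rewrite lee_fin ?mulr_ge0..].
by rewrite poisson_mean poisson_pmf_sum -EFinD -EFinM mulrDr mulr1.
Qed.

End poisson_moments.

Section conditional_expectation.
Context d (T : measurableType d) (R : realType) (P : probability T R).
Variables (alpha : {mfun T >-> R}) (I : eqType) (Y : I -> T -> nat).
Hypothesis mY : forall i, measurable_fun setT (Y i).
Hypothesis indY : cond_independent P alpha Y.

Lemma measurable_of_other i0 d' (U : measurableType d') (H : T -> U) :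
  measurable_fun (setT : set (other_space alpha Y i0)) (H : other_space alpha Y i0 -> U) ->
  measurable_fun setT H.
Proof. by apply: sub_measurable_fun; exact: other_events_measurable. Qed.

(** Decompose f (Y i0) according to the value m of Y i0 and apply
    [cond_prob_other] to each term; H is fixed by the conditioning. *)
Lemma cond_expec_other i0 (f : nat -> R) (p : nat -> R -> R) (s H : T -> R) :
  (forall m, is_cond_prob P alpha [set w | Y i0 w = m] (p m)) ->
  (forall m w, 0 <= p m (alpha w)) -> (forall m, 0 <= f m) ->
  (forall w, (\sum_(m <oo) (f m * p m (alpha w))%:E = (s w)%:E)%E) ->
  measurable_fun (setT : set (other_space alpha Y i0)) (H : other_space alpha Y i0 -> R) ->
  (forall w, 0 <= H w) ->
  (\int[P]_w (H w * f (Y i0 w))%:E = \int[P]_w (H w * s w)%:E)%E.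
Proof.
move=> hp p0 f0 hs mH H0; have mH' := measurable_of_other mH.
have mYm m : measurable (Y i0 @^-1` [set m]) by exact: measurable_nat_preimage.
transitivity (\int[P]_w (\sum_(m <oo) ((H w * f m)%:E * (\1_(Y i0 @^-1` [set m]) w)%:E)))%E.
  apply: eq_integral => w _; rewrite (nneseries_single (N := Y i0 w)).
  - by rewrite indicE mem_set// mule1.
  - by move=> i; rewrite mule_ge0// lee_fin ?mulr_ge0.
  - move=> i iY; rewrite indicE memNset ?mule0//= => h.
    by move: iY; rewrite h eqxx.
rewrite integral_nneseries//; last 2 first.
- move=> m; apply/measurable_EFinP; apply: measurable_funM; first exact: measurable_funM.
  exact: measurable_indic.
- by move=> m w _; rewrite mule_ge0// lee_fin ?mulr_ge0.
transitivity (\sum_(m <oo) \int[P]_w ((H w * f m)%:E * (p m (alpha w))%:E))%E.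
  apply: eq_eseriesr => m _.
  apply: (cond_prob_other mY indY) => //; first exact: hp.
    by apply/measurable_EFinP; exact: measurable_funM.
  by move=> w; rewrite lee_fin mulr_ge0.
rewrite -integral_nneseries//; last 2 first.
- move=> m; apply/measurable_EFinP; apply: measurable_funM; first exact: measurable_funM.
  have [mp _] := hp m; exact: measurableT_comp.
- by move=> m w _; rewrite mule_ge0// lee_fin ?mulr_ge0.
apply: eq_integral => w _.
rewrite (_ : (fun n => _) = (fun n => \sum_(0 <= i < n) ((H w)%:E * (f i * p i (alpha w))%:E))%E); last first.
  by apply/funext => n; apply: eq_bigr => m _; rewrite -!EFinM mulrA.
by rewrite nneseriesZl ?hs -?EFinM// => m _; rewrite lee_fin mulr_ge0.
Qed.

(** A sum over l < N is a series over all l of terms that carry the indicator of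
    l < N, so it is integrated term by term. *)
Lemma eq_integral_random_sum (N : T -> nat) (F G : nat -> T -> R) :
  measurable_fun setT N ->
  (forall l, measurable_fun setT (F l)) -> (forall l w, 0 <= F l w) ->
  (forall l, measurable_fun setT (G l)) -> (forall l w, 0 <= G l w) ->
  (forall l, (\int[P]_w ((l < N w)%:R * F l w)%:E = \int[P]_w ((l < N w)%:R * G l w)%:E)%E) ->
  (\int[P]_w (\sum_(l < N w) F l w)%:E = \int[P]_w (\sum_(l < N w) G l w)%:E)%E.
Proof.
move=> mN mF F0 mG G0 FG.
have ml l : measurable_fun setT (fun w => (l < N w)%:R : R).
  have : measurable_fun setT (\1_(N @^-1` [set k | (l < k)%N]) : T -> R).
    by apply: measurable_indic; rewrite -[X in measurable X]setTI; exact: mN.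
  apply: eq_measurable_fun => w _; rewrite indicE; congr (nat_of_bool _)%:R.
  by apply/idP/idP => [/set_mem//|h]; exact/mem_set.
have series (K : nat -> T -> R) : (forall l, measurable_fun setT (K l)) -> (forall l w, 0 <= K l w) ->
    (\int[P]_w (\sum_(l < N w) K l w)%:E = \sum_(l <oo) \int[P]_w ((l < N w)%:R * K l w)%:E)%E.
  move=> mK K0; rewrite -integral_nneseries//; last 2 first.
  - by move=> l; apply/measurable_EFinP; exact: measurable_funM.
  - by move=> l w _; rewrite lee_fin mulr_ge0.
  apply: eq_integral => w _; rewrite (nneseries_finite (N := N w)).
  - rewrite -sumEFin; apply: eq_bigr => l _; by rewrite ltn_ord mul1r.
  - by move=> l; rewrite lee_fin mulr_ge0.
  - by move=> l; rewrite leqNgt => /negbTE ->; rewrite mul0r.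
by rewrite !series//; apply: eq_eseriesr => l _; exact: FG.
Qed.

End conditional_expectation.

Lemma measurable_random_sum d (T : measurableType d) (R : realType) (N : T -> nat) (F : nat -> T -> R) :
  measurable_fun setT N -> (forall l, measurable_fun setT (F l)) ->
  measurable_fun setT (fun w => \sum_(l < N w) F l w).
Proof.
move=> mN mF _ B mB; rewrite setTI.
rewrite (_ : _ @^-1` B = \bigcup_n (N @^-1` [set n] `&` (fun w => \sum_(l < n) F l w) @^-1` B)).
  apply: bigcup_measurable => n _; apply: measurableI.
    by rewrite -[X in measurable X]setTI; exact: mN.
  by rewrite -[X in measurable X]setTI; apply: measurable_sum.
apply/seteqP; split=> w /=; first by exists (N w).
by move=> [n _ [/= -> ]].
Qed.

Lemma measurable_random_sum_nat d (T : measurableType d) (N : T -> nat) (F : nat -> T -> nat) :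
  measurable_fun setT N -> (forall l, measurable_fun setT (F l)) ->
  measurable_fun setT (fun w => \sum_(l < N w) F l w)%N.
Proof.
move=> mN mF _ B mB; rewrite setTI.
have mS n : measurable_fun setT (fun w => \sum_(l < n) F l w)%N.
  elim: n => [|n ih].
    by rewrite (_ : (fun _ => _) = fun=> 0%N)//; apply/funext => w; rewrite big_ord0.
  rewrite (_ : (fun _ => _) = fun w => (\sum_(l < n) F l w + F n w)%N).
    exact: measurable_fun_addn.
  by apply/funext => w; rewrite big_ord_recr.
rewrite (_ : _ @^-1` B = \bigcup_n (N @^-1` [set n] `&` (fun w => \sum_(l < n) F l w)%N @^-1` B)).
  apply: bigcup_measurable => n _; apply: measurableI.
    by rewrite -[X in measurable X]setTI; exact: mN.
  by rewrite -[X in measurable X]setTI; exact: mS.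
apply/seteqP; split=> w /=; first by exists (N w).
by move=> [n _ [/= -> ]].
Qed.

(** * Conditional moments of the INAR(1) process *)

HB.instance Definition _ := gen_eqMixin inar_index.

Lemma measurable_invr (R : realType) : measurable_fun setT (@GRing.inv R).
Proof.
rewrite -(setUv [set (0 : R)]); apply/measurable_funU => //; first exact: measurableC.
split; first exact: measurable_fun_set1.
apply: open_continuous_measurable_fun; first exact/closed_openC/closed_eq.
by move=> x /set_mem/eqP x0; exact: inv_continuous.
Qed.

Section inar_measurability.
Context d (T : measurableType d).

(** [Thinning k' l] and [Innovation k'] enter the recursion at time k' + 1, so
    X_k is a function of the inputs that are not [input_after k]. *)
Definition input_after (k : nat) (i : inar_index) : Prop :=
  match i with
  | Initial => False
  | Thinning k' _ => (k <= k')%N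
  | Innovation k' => (k <= k')%N
  end.

Lemma measurable_inar (X0 : T -> nat) (xi : nat -> nat -> T -> nat) (eps : nat -> T -> nat) k :
  (forall i, ~ input_after k i -> measurable_fun setT (inar_input X0 xi eps i)) ->
  measurable_fun setT (inar X0 xi eps k).
Proof.
elim: k => [|k ih] mi /=; first by apply: (mi Initial).
apply: measurable_fun_addn.
  apply: measurable_random_sum_nat.
    apply: ih => i ik; apply: mi; move: i ik => [|k' l|k']//=.
    - by move=> kk' /ltnW.
    - by move=> kk' /ltnW.
  by move=> l; apply: (mi (Thinning k l)); rewrite /= ltnn.
by apply: (mi (Innovation k)); rewrite /= ltnn.
Qed.

End inar_measurability.

Section inar_moments.
Context d (T : measurableType d) (R : realType) (P : probability T R).
Variables (lambda : R) (alpha : {RV P >-> R}) (X0 : {RV P >-> nat})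
  (xi : nat -> nat -> {RV P >-> nat}) (eps : nat -> {RV P >-> nat}).
Hypothesis lambda0 : 0 < lambda.
Hypothesis inarP : randomized_inar P lambda alpha X0 xi eps.

Local Notation Y := (inar_input X0 xi eps).
Local Notation X := (inar X0 xi eps).

Let a01 w : 0 < alpha w < 1. Proof. exact: (inar_alpha01 inarP). Qed.
Let a0 w : 0 < alpha w. Proof. by have /andP[] := a01 w. Qed.
Let a1 w : 0 < 1 - alpha w. Proof. by have /andP[_] := a01 w; rewrite subr_gt0. Qed.

Lemma measurable_inar_input i : measurable_fun setT (Y i).
Proof. by case: i => [|k l|k] /=; exact: measurable_funPT. Qed.

Let mY := measurable_inar_input.
Let indY : cond_independent P alpha Y. Proof. exact: (inar_cond_indep inarP). Qed.

(** H depends on alpha and on the inputs up to time k only, expressed as: H is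
    fixed by the conditioning on all the inputs except any single later one. *)
Definition adapted d' (U : measurableType d') (k : nat) (H : T -> U) : Prop :=
  forall i0, input_after k i0 ->
    measurable_fun (setT : set (other_space alpha Y i0)) (H : other_space alpha Y i0 -> U).

Lemma adapted_measurable d' (U : measurableType d') k (H : T -> U) : adapted k H -> measurable_fun setT H.
Proof. by move=> /(_ (Innovation k) (leqnn _)); exact: measurable_of_other. Qed.

Lemma adapted_leq d' (U : measurableType d') j k (H : T -> U) : (j <= k)%N -> adapted j H -> adapted k H.
Proof. by move=> jk aH [|k' l|k'] //= h; apply: aH => /=; exact: leq_trans h. Qed.

Lemma adapted_alpha k (h : R -> R) : measurable_fun setT h -> adapted k (fun w => h (alpha w)).
Proof. by move=> mh i0 _; apply: measurableT_comp => //; exact: measurable_other_alpha. Qed.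

Lemma adapted_cst k (c : R) : adapted k (fun=> c).
Proof. by move=> i0 _. Qed.

Lemma adapted_M k (H G : T -> R) : adapted k H -> adapted k G -> adapted k (fun w => H w * G w).
Proof. by move=> aH aG i0 ik; apply: measurable_funM; [exact: aH|exact: aG]. Qed.

Lemma adapted_nat k (h : nat -> R) (H : T -> nat) : adapted k H -> adapted k (fun w => h (H w)).
Proof. by move=> aH i0 ik; apply: measurableT_comp => //; exact: aH. Qed.

Lemma adapted_inar k : adapted k (X k).
Proof.
move=> i0 ik; apply: measurable_inar => i ik'; apply: measurable_other_input.
by apply/eqP => ii0; apply: ik'; rewrite ii0.
Qed.

Definition bernoulli_version (m : nat) (a : R) : R :=
  match m with 0 => 1 - a | 1 => a | _ => 0 end.

(** The values 0 and 1 have total conditional probability 1, which leaves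
    nothing for the others. *)
Lemma thinning_version k l m :
  is_cond_prob P alpha [set w | xi k l w = m] (bernoulli_version m).
Proof.
case: m => [|[|m]]; [exact: (inar_thinning0 inarP)|exact: (inar_thinning1 inarP)|split=> [|A mA]; first exact: measurable_cst].
rewrite integral0_eq//.
have mxi n : measurable [set w | xi k l w = n].
  exact: (measurable_nat_preimage mY (Thinning k l) [set n]).
have [m0 h0] := inar_thinning0 inarP k l; have [m1 h1] := inar_thinning1 inarP k l.
have P01 : (P ([set w | xi k l w = 0%N] `|` [set w | xi k l w = 1%N]) = 1)%E.
  rewrite measureU//; last by apply/seteqP; split=> // w /= [->].
  have h0' := h0 setT measurableT; have h1' := h1 setT measurableT.
  rewrite preimage_setT setTI in h0'; rewrite preimage_setT setTI in h1'.
  transitivity (\int[P]_w (1 - alpha w)%:E + \int[P]_w (alpha w)%:E)%E.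
    by congr (_ + _)%E.
  rewrite -ge0_integralD//.
  - under eq_integral do rewrite -EFinD subrK.
    by rewrite integral_cst// mul1e; exact: probability_setT.
  - by move=> w _; rewrite lee_fin ltW.
  - by apply/measurable_EFinP; apply: measurable_funB => //; exact: measurable_funPT.
  - by move=> w _; rewrite lee_fin ltW.
  - by apply/measurable_EFinP; exact: measurable_funPT.
have mU : measurable ([set w | xi k l w = 0%N] `|` [set w | xi k l w = 1%N]).
  exact: measurableU.
have PC : P (~` ([set w | xi k l w = 0%N] `|` [set w | xi k l w = 1%N])) = 0%E.
  by rewrite probability_setC// P01 subee.
apply/eqP; rewrite eq_le measure_ge0 andbT -PC; apply: le_measure; rewrite ?inE.
- by apply: measurableI => //; rewrite -[X in measurable X]setTI; exact: measurable_funPT.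
- exact: measurableC.
- by move=> w /= [_ ->] [].
Qed.

Lemma bernoulli_version_ge0 m w : 0 <= bernoulli_version m (alpha w).
Proof. by case: m => [|[|m]] //=; rewrite ltW. Qed.

(** With f m = m and f m = m^2 this gives the first two moments of a Bernoulli
    variable. *)
Lemma bernoulli_version_sum (f : nat -> R) w : (forall m, 0 <= f m) -> f 0%N = 0 -> f 1%N = 1 ->
  (\sum_(m <oo) (f m * bernoulli_version m (alpha w))%:E = (alpha w)%:E)%E.
Proof.
move=> f0 f00 f1; rewrite (nneseries_finite (N := 2)).
- by rewrite !big_ord_recl big_ord0/= f00 f1 mul0r mul1r add0e adde0.
- by move=> m; rewrite lee_fin mulr_ge0// bernoulli_version_ge0.
- by move=> [|[|m]]//= _; rewrite mulr0.
Qed.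

Lemma ge0_expecD (f g : T -> R) : measurable_fun setT f -> measurable_fun setT g ->
  (forall w, 0 <= f w) -> (forall w, 0 <= g w) ->
  (\int[P]_w (f w + g w)%:E = \int[P]_w (f w)%:E + \int[P]_w (g w)%:E)%E.
Proof.
move=> mf mg f0 g0; under eq_integral do rewrite EFinD.
rewrite ge0_integralD//; try exact/measurable_EFinP.
- by move=> w _; rewrite lee_fin.
- by move=> w _; rewrite lee_fin.
Qed.

Lemma expec_thinning k l (f : nat -> R) (H : T -> R) :
  (forall m, 0 <= f m) -> f 0%N = 0 -> f 1%N = 1 ->
  measurable_fun (setT : set (other_space alpha Y (Thinning k l))) (H : other_space alpha Y (Thinning k l) -> R) ->
  (forall w, 0 <= H w) ->
  (\int[P]_w (H w * f (xi k l w))%:E = \int[P]_w (H w * alpha w)%:E)%E.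
Proof.
move=> f0 f00 f1 mH H0.
apply: (@cond_expec_other _ _ _ P alpha _ Y mY indY (Thinning k l) f bernoulli_version (fun w => alpha w) H) => //.
- exact: thinning_version.
- by move=> m w; exact: bernoulli_version_ge0.
- by move=> w; exact: bernoulli_version_sum.
Qed.

Lemma expec_innovation k (f : nat -> R) (c : R) (H : T -> R) :
  (forall m, 0 <= f m) -> (\sum_(m <oo) (f m * poisson_pmf lambda m)%:E = c%:E)%E ->
  measurable_fun (setT : set (other_space alpha Y (Innovation k))) (H : other_space alpha Y (Innovation k) -> R) ->
  (forall w, 0 <= H w) ->
  (\int[P]_w (H w * f (eps k w))%:E = \int[P]_w (H w * c)%:E)%E.
Proof.
move=> f0 fc mH H0.
apply: (@cond_expec_other _ _ _ P alpha _ Y mY indY (Innovation k) f (fun m _ => poisson_pmf lambda m) (fun=> c) H) => //.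
- by move=> m; exact: (inar_innovation inarP).
- by move=> m w; exact: poisson_pmf_ge0.
Qed.

Definition survivors k w : R := \sum_(l < X k w) (xi k l w)%:R.

Lemma survivors_ge0 k w : 0 <= survivors k w.
Proof. by apply: sumr_ge0. Qed.

Lemma inarS k w : (X k.+1 w)%:R = survivors k w + (eps k w)%:R :> R.
Proof. by rewrite /= natrD natr_sum. Qed.

Lemma measurable_natr d' (S : measurableType d') (N : S -> nat) : measurable_fun setT N ->
  measurable_fun setT (fun w => (N w)%:R : R).
Proof. by move=> mN; apply: (@measurableT_comp _ _ _ _ _ _ (fun m : nat => m%:R : R)). Qed.

Lemma measurable_survivors k : measurable_fun setT (survivors k).
Proof.
apply: (measurable_random_sum (F := fun l w => (xi k l w)%:R)).
  exact: (adapted_measurable (@adapted_inar k)).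
by move=> l; apply: measurable_natr; exact: measurable_funPT.
Qed.

Lemma other_survivors k :
  measurable_fun (setT : set (other_space alpha Y (Innovation k)))
    (survivors k : other_space alpha Y (Innovation k) -> R).
Proof.
apply: (measurable_random_sum (T := other_space alpha Y (Innovation k)) (F := fun l w => (xi k l w)%:R)).
  by apply: (@adapted_inar k (Innovation k)); rewrite /=.
move=> l; apply: measurable_natr.
by apply: (measurable_other_input (i := Thinning k l)); exact/eqP.
Qed.

Lemma expec_survivors k (H : T -> R) : adapted k H -> (forall w, 0 <= H w) ->
  (\int[P]_w (H w * survivors k w)%:E = \int[P]_w (H w * alpha w * (X k w)%:R)%:E)%E.
Proof.
move=> aH H0; have mH := adapted_measurable aH.
have mX := adapted_measurable (@adapted_inar k).
under eq_integral do rewrite /survivors mulr_sumr.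
rewrite (@eq_integral_random_sum _ _ _ _ (X k) (fun l w => H w * (xi k l w)%:R) (fun _ w => H w * alpha w))//.
- by apply: eq_integral => w _; rewrite sumr_const card_ord mulr_natr.
- by move=> l; apply: measurable_funM => //; apply: measurable_natr; exact: measurable_funPT.
- by move=> l w; rewrite mulr_ge0.
- by move=> l; apply: measurable_funM => //; exact: measurable_funPT.
- by move=> l w; rewrite mulr_ge0// ltW.
- move=> l; under eq_integral do rewrite mulrA.
  under [RHS]eq_integral do rewrite mulrA.
  apply: (@expec_thinning k l (fun m => m%:R)) => //.
    by apply: (@adapted_M k (fun w => (l < X k w)%:R) H) => //=; exact: (adapted_nat (fun n => (l < n)%:R) (@adapted_inar k)).
  by move=> w; rewrite mulr_ge0.
Qed.

Lemma expec_inarS k (H : T -> R) : adapted k H -> (forall w, 0 <= H w) ->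
  (\int[P]_w (H w * (X k.+1 w)%:R)%:E =
   \int[P]_w (H w * (alpha w * (X k w)%:R + lambda))%:E)%E.
Proof.
move=> aH H0; have mH := adapted_measurable aH.
have mX := measurable_natr (adapted_measurable (@adapted_inar k)).
have ms := measurable_survivors k.
have ma : measurable_fun setT alpha by exact: measurable_funPT.
have me : measurable_fun setT (fun w => (eps k w)%:R : R) by apply: measurable_natr; exact: measurable_funPT.
under eq_integral do rewrite inarS mulrDr.
under [RHS]eq_integral do rewrite mulrDr mulrA.
rewrite ge0_expecD; last 4 first.
- exact: measurable_funM.
- exact: measurable_funM.
- by move=> w; rewrite mulr_ge0// survivors_ge0.
- by move=> w; rewrite mulr_ge0.
rewrite ge0_expecD; last 4 first.
- by apply: measurable_funM => //; exact: measurable_funM.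
- exact: measurable_funM.
- by move=> w; rewrite !mulr_ge0// ltW.
- by move=> w; rewrite mulr_ge0// ltW.
congr (_ + _)%E; first exact: expec_survivors.
apply: (@expec_innovation k (fun m => m%:R)) => //; first exact: poisson_mean.
by apply: aH => /=.
Qed.

(** The number of survivors at time k + 1 when the l-th individual is left out;
    it does not involve [xi k l]. *)
Definition other_individuals k l w : R := \sum_(j < X k w | j != l :> nat) (xi k j w)%:R.

(** The survivors have a binomial law given alpha and X_k.  Write the square as
    the sum over l of xi_l (xi_l + the other survivors), replace xi_l and
    xi_l^2 by alpha in each term, and note that the other survivors add up to
    (X_k - 1) times the number of survivors. *)
Lemma expec_survivors_sqr k (H : T -> R) : adapted k H -> (forall w, 0 <= H w) ->
  (\int[P]_w (H w * survivors k w ^+ 2)%:E =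
   \int[P]_w (H w * (alpha w ^+ 2 * (X k w)%:R ^+ 2 + alpha w * (1 - alpha w) * (X k w)%:R))%:E)%E.
Proof.
move=> aH H0; have mH := adapted_measurable aH.
have mXn := adapted_measurable (@adapted_inar k).
have mX := measurable_natr mXn.
have mX1 : measurable_fun setT (fun w => (X k w).-1%:R : R).
  exact: (adapted_measurable (adapted_nat (fun n => n.-1%:R) (@adapted_inar k))).
have ms := measurable_survivors k.
have ma : measurable_fun setT alpha by exact: measurable_funPT.
have mxi l : measurable_fun setT (fun w => (xi k l w)%:R : R) by apply: measurable_natr; exact: measurable_funPT.
have so l w : (l < X k w)%N -> survivors k w = (xi k l w)%:R + other_individuals k l w.
  by move=> lX; rewrite /survivors (bigD1 (Ordinal lX)).
have oE l w : other_individuals k l w = \sum_(j < X k w) ((j != l :> nat)%:R * (xi k j w)%:R).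
  rewrite /other_individuals big_mkcond; apply: eq_bigr => j _.
  by case: ifPn; rewrite ?mul1r ?mul0r.
have o0 l w : 0 <= other_individuals k l w by apply: sumr_ge0.
have mo l : measurable_fun setT (other_individuals k l).
  rewrite (funext (oE l)).
  apply: (measurable_random_sum (F := fun j w => (j != l)%:R * (xi k j w)%:R)) => // j.
  exact: measurable_funM.
have oo l : measurable_fun (setT : set (other_space alpha Y (Thinning k l)))
    (other_individuals k l : other_space alpha Y (Thinning k l) -> R).
  rewrite (funext (oE l)).
  apply: (measurable_random_sum (T := other_space alpha Y (Thinning k l))
    (F := fun j w => (j != l)%:R * (xi k j w)%:R)).
    by apply: (@adapted_inar k (Thinning k l)); rewrite /=.
  move=> j; have [->|jl] := eqVneq j l.
    by rewrite (_ : (fun _ => _) = cst 0)//; apply/funext => w; rewrite /= mul0r.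
  apply: measurable_funM => //; apply: measurable_natr.
  by apply: (measurable_other_input (i := Thinning k j)); apply/eqP => -[] /eqP; rewrite (negbTE jl).
pose F l w := H w * ((xi k l w)%:R * other_individuals k l w + (xi k l w)%:R ^+ 2).
pose G l w := H w * (alpha w * other_individuals k l w + alpha w).
transitivity (\int[P]_w (\sum_(l < X k w) F l w)%:E)%E.
  apply: eq_integral => w _; rewrite expr2 {1}/survivors mulr_suml mulr_sumr; congr EFin.
  by apply: eq_bigr => l _; rewrite /F (so l)// mulrDr addrC expr2.
rewrite (@eq_integral_random_sum _ _ _ _ (X k) F G)//.
- transitivity (\int[P]_w (H w * alpha w * ((X k w).-1)%:R * survivors k w + H w * alpha w * (X k w)%:R)%:E)%E.
    apply: eq_integral => w _; congr EFin; rewrite /G -mulr_sumr big_split/= -mulr_sumr.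
    rewrite sumr_const card_ord -mulr_natr.
    rewrite (_ : \sum_(l < X k w) other_individuals k l w = (X k w).-1%:R * survivors k w); first by ring.
    rewrite (eq_bigr (fun l : 'I_(X k w) => survivors k w - (xi k l w)%:R)); last first.
      by move=> l _; rewrite (so l)// addrC addKr.
    rewrite sumrB sumr_const card_ord -/(survivors k w) mulr_natl.
    have [Xw|Xp] := posnP (X k w); first by rewrite /survivors Xw big_ord0 !mul0rn subrr.
    by case: (X k w) Xp => // n _; rewrite mulrS addrAC subrr add0r.
  rewrite ge0_expecD; last 4 first.
  - by do !apply: measurable_funM => //; exact: mX1.
  - by do !apply: measurable_funM => //.
  - by move=> w; rewrite !mulr_ge0// ?survivors_ge0// ltW.
  - by move=> w; rewrite !mulr_ge0// ltW.
  rewrite expec_survivors; last 2 first.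
  - apply: (@adapted_M k (fun w => H w * alpha w) (fun w => (X k w).-1%:R)).
      apply: (adapted_M aH); exact: (@adapted_alpha k idfun (@measurable_id _ _ _)).
    exact: (adapted_nat (fun n => n.-1%:R) (@adapted_inar k)).
  - by move=> w; rewrite !mulr_ge0// ltW.
  rewrite -ge0_expecD; last 4 first.
  - by do !apply: measurable_funM => //; exact: mX1.
  - by do !apply: measurable_funM => //.
  - by move=> w; rewrite !mulr_ge0// ltW.
  - by move=> w; rewrite !mulr_ge0// ltW.
  apply: eq_integral => w _; congr EFin.
  by case: (X k w) => [|n] /=; rewrite -?natr1; ring.
- by move=> l; apply: measurable_funM => //; apply: measurable_funD; [exact: measurable_funM|exact: measurable_funX].
- by move=> l w; rewrite mulr_ge0// addr_ge0// ?mulr_ge0// sqr_ge0.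
- by move=> l; apply: measurable_funM => //; apply: measurable_funD => //; exact: measurable_funM.
- by move=> l w; rewrite mulr_ge0// addr_ge0// ?mulr_ge0// ltW.
move=> l.
have mb : adapted k (fun w => (l < X k w)%:R : R) by exact: (adapted_nat (fun n => (l < n)%:R) (@adapted_inar k)).
have mb' := adapted_measurable mb.
have e1 : (\int[P]_w ((l < X k w)%:R * H w * other_individuals k l w * (xi k l w)%:R)%:E =
    \int[P]_w ((l < X k w)%:R * H w * other_individuals k l w * alpha w)%:E)%E.
  apply: (@expec_thinning k l (fun m => m%:R)) => //.
    by apply: measurable_funM => //; apply: (adapted_M mb aH); rewrite /=.
  by move=> w; rewrite !mulr_ge0.
have e2 : (\int[P]_w ((l < X k w)%:R * H w * (xi k l w)%:R ^+ 2)%:E =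
    \int[P]_w ((l < X k w)%:R * H w * alpha w)%:E)%E.
  apply: (@expec_thinning k l (fun m => m%:R ^+ 2)) => //.
  - by rewrite expr0n.
  - by rewrite expr1n.
  - by apply: (adapted_M mb aH); rewrite /=.
  - by move=> w; rewrite !mulr_ge0.
transitivity (\int[P]_w ((l < X k w)%:R * H w * other_individuals k l w * (xi k l w)%:R
    + (l < X k w)%:R * H w * (xi k l w)%:R ^+ 2)%:E)%E.
  by apply: eq_integral => w _; congr EFin; rewrite /F; ring.
transitivity (\int[P]_w ((l < X k w)%:R * H w * other_individuals k l w * alpha w
    + (l < X k w)%:R * H w * alpha w)%:E)%E; last first.
  by apply: eq_integral => w _; congr EFin; rewrite /G; ring.
rewrite ge0_expecD; last 4 first.
- by do !apply: measurable_funM => //.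
- by do !apply: measurable_funM => //; exact: measurable_funX.
- by move=> w; rewrite !mulr_ge0.
- by move=> w; rewrite !mulr_ge0// sqr_ge0.
rewrite ge0_expecD; last 4 first.
- by do !apply: measurable_funM => //.
- by do !apply: measurable_funM => //.
- by move=> w; rewrite !mulr_ge0// ltW.
- by move=> w; rewrite !mulr_ge0// ltW.
by rewrite e1 e2.
Qed.

(** Expand the square of survivors plus innovation; the innovation of time k + 1
    is independent of H and of the survivors given alpha. *)
Lemma expec_inarS_sqr k (H : T -> R) : adapted k H -> (forall w, 0 <= H w) ->
  (\int[P]_w (H w * (X k.+1 w)%:R ^+ 2)%:E =
   \int[P]_w (H w * (alpha w ^+ 2 * (X k w)%:R ^+ 2 + alpha w * (1 - alpha w) * (X k w)%:R
      + 2 * lambda * (alpha w * (X k w)%:R) + (lambda ^+ 2 + lambda)))%:E)%E.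
Proof.
move=> aH H0; have mH := adapted_measurable aH.
have mX := measurable_natr (adapted_measurable (@adapted_inar k)).
have ms := measurable_survivors k.
have ma : measurable_fun setT alpha by exact: measurable_funPT.
have me : measurable_fun setT (fun w => (eps k w)%:R : R) by apply: measurable_natr; exact: measurable_funPT.
have s0 := survivors_ge0 k.
have a0' w : 0 <= alpha w by rewrite ltW.
have l0 : 0 <= lambda by rewrite ltW.
have a1' w : 0 <= 1 - alpha w by rewrite ltW.
transitivity (\int[P]_w ((H w * survivors k w ^+ 2 + 2 * H w * survivors k w * (eps k w)%:R)
    + H w * (eps k w)%:R ^+ 2)%:E)%E.
  by apply: eq_integral => w _; rewrite inarS; congr EFin; ring.
have mH2 : measurable_fun setT (fun w => 2 * H w) by exact: measurable_funM.
have mHs2 : measurable_fun setT (fun w => H w * survivors k w ^+ 2).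
  by apply: measurable_funM => //; exact: measurable_funX.
have mHse : measurable_fun setT (fun w => 2 * H w * survivors k w * (eps k w)%:R).
  by do !apply: measurable_funM => //.
have mHe2 : measurable_fun setT (fun w => H w * (eps k w)%:R ^+ 2).
  by apply: measurable_funM => //; exact: measurable_funX.
rewrite ge0_expecD; last 4 first.
- exact: measurable_funD.
- by [].
- by move=> w; rewrite addr_ge0// !mulr_ge0// exprn_ge0.
- by move=> w; rewrite !mulr_ge0// exprn_ge0.
rewrite ge0_expecD//; last 2 first.
- by move=> w; rewrite !mulr_ge0// exprn_ge0.
- by move=> w; rewrite !mulr_ge0// exprn_ge0.
rewrite expec_survivors_sqr//.
have -> : (\int[P]_w (2 * H w * survivors k w * (eps k w)%:R)%:E =
    \int[P]_w (H w * (2 * lambda * (alpha w * (X k w)%:R)))%:E)%E.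
  transitivity (\int[P]_w (2 * H w * survivors k w * lambda)%:E)%E.
    apply: (@expec_innovation k (fun m => m%:R)) => //; first exact: poisson_mean.
    - apply: measurable_funM; last exact: other_survivors.
      by apply: measurable_funM => //; apply: aH => /=.
    - by move=> w; rewrite !mulr_ge0.
  transitivity (\int[P]_w (2 * lambda * H w * survivors k w)%:E)%E.
    by apply: eq_integral => w _; congr EFin; ring.
  rewrite expec_survivors; last 2 first.
  - by apply: (@adapted_M k (fun=> 2 * lambda)) => //; exact: adapted_cst.
  - by move=> w; rewrite !mulr_ge0.
  by apply: eq_integral => w _; congr EFin; ring.
have -> : (\int[P]_w (H w * (eps k w)%:R ^+ 2)%:E = \int[P]_w (H w * (lambda ^+ 2 + lambda))%:E)%E.
  apply: (@expec_innovation k (fun m => m%:R ^+ 2)) => //.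
  - exact: poisson_second_moment.
  - by apply: aH => /=.
have m1 : measurable_fun setT (fun w => H w * (alpha w ^+ 2 * (X k w)%:R ^+ 2 + alpha w * (1 - alpha w) * (X k w)%:R)).
  apply: measurable_funM => //; apply: measurable_funD; apply: measurable_funM => //.
  - exact: measurable_funX.
  - exact: measurable_funX.
  - by apply: measurable_funM => //; exact: measurable_funB.
have m2 : measurable_fun setT (fun w => H w * (2 * lambda * (alpha w * (X k w)%:R))).
  by do !apply: measurable_funM => //.
have m3 : measurable_fun setT (fun w => H w * (lambda ^+ 2 + lambda)) by exact: measurable_funM.
rewrite -ge0_expecD//; last 2 first.
- by move=> w; rewrite mulr_ge0// addr_ge0// !mulr_ge0// exprn_ge0.
- by move=> w; rewrite !mulr_ge0.
rewrite -ge0_expecD//; last 3 first.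
- exact: measurable_funD.
- by move=> w; rewrite addr_ge0// !mulr_ge0// addr_ge0// !mulr_ge0// exprn_ge0.
- by move=> w; rewrite mulr_ge0// addr_ge0// exprn_ge0.
by apply: eq_integral => w _; congr EFin; ring.
Qed.

Definition inar_mean (a : R) : R := lambda / (1 - a).
Local Notation M := (fun w => inar_mean (alpha w)).

Lemma measurable_inar_mean : measurable_fun setT inar_mean.
Proof.
apply: measurable_funM => //; apply: (@measurableT_comp _ _ _ _ _ _ (@GRing.inv R)).
  exact: measurable_invr.
exact: measurable_funB.
Qed.

Lemma inar_mean_gt0 w : 0 < M w.
Proof. by rewrite /inar_mean divr_gt0. Qed.

Lemma inar_meanE w : lambda = (1 - alpha w) * M w.
Proof. by rewrite /inar_mean mulrCA divff ?mulr1// gt_eqF. Qed.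

Lemma expec_initial (f : nat -> R) (s h : R -> R) :
  (forall m, 0 <= f m) ->
  (forall r, 0 < r -> (\sum_(m <oo) (f m * poisson_pmf r m)%:E = (s r)%:E)%E) ->
  measurable_fun setT h -> (forall w, 0 <= h (alpha w)) ->
  (\int[P]_w (h (alpha w) * f (X0 w))%:E = \int[P]_w (h (alpha w) * s (M w))%:E)%E.
Proof.
move=> f0 fs mh h0.
apply: (@cond_expec_other _ _ _ P alpha _ Y mY indY Initial f (fun m a => poisson_pmf (lambda / (1 - a)) m)) => //.
- by move=> m; exact: (inar_initial inarP).
- by move=> m w; exact: poisson_pmf_ge0.
- by move=> w; apply: fs; exact: inar_mean_gt0.
- by apply: measurableT_comp => //; exact: measurable_other_alpha.
Qed.

(** M is a fixed point of the recursion m |-> alpha m + lambda.  The weight h has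
    to be arbitrary, since each step multiplies it by alpha. *)
Lemma expec_inar k (h : R -> R) : measurable_fun setT h -> (forall w, 0 <= h (alpha w)) ->
  (\int[P]_w (h (alpha w) * (X k w)%:R)%:E = \int[P]_w (h (alpha w) * M w)%:E)%E.
Proof.
elim: k h => [|k ih] h mh h0.
  by apply: (@expec_initial (fun m => m%:R) id) => // r; exact: poisson_mean.
have ma : measurable_fun setT alpha by exact: measurable_funPT.
have mM : measurable_fun setT M by apply: measurableT_comp => //; exact: measurable_inar_mean.
have mX := measurable_natr (adapted_measurable (@adapted_inar k)).
have mha : measurable_fun setT (fun w => h (alpha w)) by exact: measurableT_comp.
have M0 w : 0 <= M w by rewrite ltW// inar_mean_gt0.
have hl w : 0 <= h (alpha w) * lambda by rewrite mulr_ge0// ltW.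
rewrite expec_inarS//; last exact: adapted_alpha.
under eq_integral do rewrite mulrDr mulrA.
rewrite ge0_expecD//; last 3 first.
- by do !apply: measurable_funM => //.
- exact: measurable_funM.
- by move=> w; rewrite !mulr_ge0// ltW.
rewrite (ih (fun a => h a * a)); last 2 first.
- exact: measurable_funM.
- by move=> w; rewrite mulr_ge0// ltW.
rewrite -ge0_expecD//; last 3 first.
- by do !apply: measurable_funM => //.
- exact: measurable_funM.
- by move=> w; rewrite mulr_ge0 ?M0// mulr_ge0// ltW.
by apply: eq_integral => w _; rewrite (inar_meanE w); congr EFin; ring.
Qed.

(** M^2 + M, the second moment of a Poisson variable of mean M, is a fixed point
    of the recursion for the second moments. *)
Lemma expec_inar_sqr k (h : R -> R) : measurable_fun setT h -> (forall w, 0 <= h (alpha w)) ->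
  (\int[P]_w (h (alpha w) * (X k w)%:R ^+ 2)%:E = \int[P]_w (h (alpha w) * (M w ^+ 2 + M w))%:E)%E.
Proof.
elim: k h => [|k ih] h mh h0.
  apply: (@expec_initial (fun m => m%:R ^+ 2) (fun r => r ^+ 2 + r)) => //.
  by move=> r; exact: poisson_second_moment.
have ma : measurable_fun setT alpha by exact: measurable_funPT.
have mM : measurable_fun setT M by apply: measurableT_comp => //; exact: measurable_inar_mean.
have mX := measurable_natr (adapted_measurable (@adapted_inar k)).
have mha : measurable_fun setT (fun w => h (alpha w)) by exact: measurableT_comp.
have M0 w : 0 <= M w by rewrite ltW// inar_mean_gt0.
rewrite expec_inarS_sqr//; last exact: adapted_alpha.
have l0 : 0 <= lambda by rewrite ltW.
have a0' w : 0 <= alpha w by rewrite ltW.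
have a1' w : 0 <= 1 - alpha w by rewrite ltW.
pose h1 a := h a * a ^+ 2.
pose h2 a := h a * (a * (1 - a) + 2 * lambda * a).
have mh1 : measurable_fun setT h1 by apply: measurable_funM => //; exact: measurable_funX.
have mh2 : measurable_fun setT h2.
  apply: measurable_funM => //; apply: measurable_funD; last exact: measurable_funM.
  by apply: measurable_funM => //; exact: measurable_funB.
have h10 w : 0 <= h1 (alpha w) by rewrite mulr_ge0// sqr_ge0.
have h20 w : 0 <= h2 (alpha w) by rewrite mulr_ge0// addr_ge0// !mulr_ge0.
have mh1a : measurable_fun setT (fun w => h1 (alpha w)) by exact: measurableT_comp.
have mh2a : measurable_fun setT (fun w => h2 (alpha w)) by exact: measurableT_comp.
have m1 : measurable_fun setT (fun w => h1 (alpha w) * (X k w)%:R ^+ 2).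
  by apply: measurable_funM => //; exact: measurable_funX.
have m2 : measurable_fun setT (fun w => h2 (alpha w) * (X k w)%:R) by exact: measurable_funM.
have m3 : measurable_fun setT (fun w => h (alpha w) * (lambda ^+ 2 + lambda)) by exact: measurable_funM.
have m1' : measurable_fun setT (fun w => h1 (alpha w) * (M w ^+ 2 + M w)).
  by apply: measurable_funM => //; apply: measurable_funD => //; exact: measurable_funX.
have m2' : measurable_fun setT (fun w => h2 (alpha w) * M w) by exact: measurable_funM.
have h30 w : 0 <= h (alpha w) * (lambda ^+ 2 + lambda) by rewrite mulr_ge0// addr_ge0// sqr_ge0.
transitivity (\int[P]_w (h1 (alpha w) * (X k w)%:R ^+ 2 + h2 (alpha w) * (X k w)%:R
    + h (alpha w) * (lambda ^+ 2 + lambda))%:E)%E.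
  by apply: eq_integral => w _; congr EFin; rewrite /h1 /h2; ring.
rewrite ge0_expecD//; [|exact: measurable_funD|]; last first.
  by move=> w; rewrite addr_ge0// mulr_ge0// sqr_ge0.
rewrite ge0_expecD//; [|by move=> w; rewrite mulr_ge0// sqr_ge0|by move=> w; rewrite mulr_ge0].
rewrite ih// expec_inar//.
rewrite -ge0_expecD//; [|by move=> w; rewrite mulr_ge0// addr_ge0// sqr_ge0|by move=> w; rewrite mulr_ge0].
rewrite -ge0_expecD//; [|exact: measurable_funD|]; last first.
  by move=> w; rewrite addr_ge0// mulr_ge0// addr_ge0// sqr_ge0.
apply: eq_integral => w _; congr EFin; rewrite /h1 /h2.
by have := inar_meanE w; move: (M w) => m lE; rewrite lE; ring.
Qed.

(** Given the past, X_(k+m+1) has mean alpha X_(k+m) + lambda, so that the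
    product moment of lag m + 1 follows from that of lag m and from
    lambda = (1 - alpha) M. *)
Lemma expec_inarM k m (h : R -> R) : measurable_fun setT h -> (forall w, 0 <= h (alpha w)) ->
  (\int[P]_w (h (alpha w) * ((X k w)%:R * (X (k + m)%N w)%:R))%:E =
   \int[P]_w (h (alpha w) * (M w ^+ 2 + alpha w ^+ m * M w))%:E)%E.
Proof.
elim: m h => [|m ih] h mh h0.
  under eq_integral do rewrite addn0 -expr2.
  rewrite expec_inar_sqr//; by apply: eq_integral => w _; rewrite expr0 mul1r.
have ma : measurable_fun setT alpha by exact: measurable_funPT.
have mM : measurable_fun setT M by apply: measurableT_comp => //; exact: measurable_inar_mean.
have mX j := measurable_natr (adapted_measurable (@adapted_inar j)).
have mha : measurable_fun setT (fun w => h (alpha w)) by exact: measurableT_comp.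
have M0 w : 0 <= M w by rewrite ltW// inar_mean_gt0.
under eq_integral do rewrite addnS mulrA.
rewrite expec_inarS; last 2 first.
- apply: adapted_M; first exact: adapted_alpha.
  apply: (adapted_nat (fun n => n%:R)); apply: (@adapted_leq _ _ k); first exact: leq_addr.
  exact: adapted_inar.
- by move=> w; rewrite mulr_ge0.
transitivity (\int[P]_w (h (alpha w) * alpha w * ((X k w)%:R * (X (k + m)%N w)%:R)
    + h (alpha w) * lambda * (X k w)%:R)%:E)%E.
  by apply: eq_integral => w _; congr EFin; ring.
rewrite ge0_expecD; last 4 first.
- by do !apply: measurable_funM => //.
- by do !apply: measurable_funM => //.
- by move=> w; rewrite !mulr_ge0// ltW.
- by move=> w; rewrite !mulr_ge0// ltW.
rewrite (ih (fun a => h a * a)); last 2 first.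
- exact: measurable_funM.
- by move=> w; rewrite mulr_ge0// ltW.
rewrite (@expec_inar k (fun a => h a * lambda)); last 2 first.
- exact: measurable_funM.
- by move=> w; rewrite mulr_ge0// ltW.
rewrite -ge0_expecD; last 4 first.
- apply: measurable_funM; first exact: measurable_funM.
  apply: measurable_funD; first exact: measurable_funX.
  by apply: measurable_funM => //; exact: measurable_funX.
- by do !apply: measurable_funM => //.
- by move=> w; rewrite mulr_ge0 ?addr_ge0 ?sqr_ge0// mulr_ge0 ?M0 ?exprn_ge0// ltW.
- by move=> w; rewrite mulr_ge0 ?M0// mulr_ge0// ltW.
apply: eq_integral => w _; rewrite (exprS (alpha w) m); congr EFin.
by have := inar_meanE w; move: (inar_mean (alpha w)) => z lE; rewrite lE; ring.
Qed.

End inar_moments.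

(** * The second moment of the inverse of 1 - alpha *)

Lemma inv_sqr_le (R : realType) (x y : R) : 0 < x -> x <= y -> (y^-1) ^+ 2 <= x ^- 2.
Proof.
move=> x0 xy; have y0 := lt_le_trans x0 xy.
by rewrite exprVn lef_pV2 ?posrE ?exprn_gt0// lerXn2r// nnegrE ltW.
Qed.

Section density_tail.
Context d (T : measurableType d) (R : realType) (P : probability T R).
Variables (X : {RV P >-> R}) (beta psi1 : R) (psi : R -> R).
Hypothesis dX : has_density P X `]0, 1[ (fun x => psi x * (1 - x) `^ beta).

Lemma density_noatom x : P (X @^-1` [set x]) = 0%E.
Proof.
by have [_ _ ->//] := dX; rewrite (integral_Sset1 x)//; exact: subIsetl.
Qed.

Hypothesis X01 : forall w, 0 < X w < 1.
Hypothesis psi_cvg : psi x @[x --> 1^'-] --> psi1.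
Hypotheses (psi1_gt0 : 0 < psi1) (beta1 : 1 < beta).

Let C := psi1 + 1.

Let C0 : 0 <= C. Proof. by rewrite addr_ge0// ltW. Qed.

(** Near 1 the density is at most (psi1 + 1) r^beta on an interval of length
    r. *)
Lemma density_tail_le : exists2 e, 0 < e & forall r, 0 < r -> r < e ->
  (P [set w | (1 - X w <= r)%R] <= (C * r `^ beta * r)%:E)%E.
Proof.
have [mf f0 PX] := dX.
have : \forall x \near 1^'-, psi x < C.
  by apply: (cvgr_lt psi1 psi_cvg); rewrite ltrDl.
rewrite near_withinE => /nbhs_ballP[e /= e0 he].
exists (Num.min e 1); first by rewrite lt_min e0 ltr01.
move=> r r0; rewrite lt_min => /andP[re r1].
rewrite (_ : [set w | _] = X @^-1` `[1 - r, 1[); last first.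
  apply/seteqP; split=> w /=; rewrite in_itv/= => h; have /andP[_ w1] := X01 w.
    by rewrite w1 andbT; lra.
  by case/andP: h => *; lra.
rewrite PX; last exact: measurable_itv.
have mC : measurable (`[1 - r, 1[ `&` `]0, 1[ : set R) by apply: measurableI; exact: measurable_itv.
have sub : `[1 - r, 1[ `&` `]0, 1[ `<=` (`]0, 1[ : set R) by exact: subIsetr.
apply: (@le_trans _ _ (\int[lebesgue_measure]_(x in `[(1 - r)%R, 1%R[ `&` `]0%R, 1%R[) (C * r `^ beta)%:E)%E).
  apply: ge0_le_integral => //.
  - by move=> x [_ x01]; rewrite lee_fin f0.
  - by apply/measurable_EFinP; exact: measurable_funS mf.
  move=> x []; rewrite /= !in_itv/= => /andP[xr x1] /andP[x0 _].
  have xe : ball (1 : R) e x.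
    rewrite /ball/= ger0_norm ?subr_ge0 ?ltW//; lra.
  rewrite lee_fin; have psix := he _ xe x1.
  apply: (@le_trans _ _ (C * (1 - x) `^ beta)).
    by rewrite ler_wpM2r ?powR_ge0// ltW.
  rewrite ler_wpM2l//.
  have beta0 : 0 <= beta by rewrite ltW// (lt_trans ltr01).
  apply: (ge0_ler_powR beta0); rewrite ?nnegrE.
  - by rewrite subr_ge0 ltW.
  - by rewrite ltW.
  - by rewrite lerBlDl -lerBlDr.
rewrite integral_cst// [leRHS]EFinM lee_wpmul2l//.
  by rewrite lee_fin mulr_ge0 ?powR_ge0.
apply: (@le_trans _ _ (lebesgue_measure (`[1 - r, 1[%classic : set R))).
  by apply: le_measure; rewrite ?inE//; exact: subIsetl.
rewrite lebesgue_measure_itv/= lte_fin ifT; last by lra.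
by rewrite -EFinB lee_fin; lra.
Qed.

(** Dyadic decomposition: with r_j = (e / 2) 2^-j, the integrand is at most
    (2 / e)^2 plus the sum of r_(j+1)^-2 over the j with 1 - X <= r_j, an event of
    probability at most C r_j^(beta + 1).  The resulting series is geometric of
    ratio q = 2^-(beta - 1) < 1. *)
Theorem integrable_inv_sqr : (\int[P]_w (((1 - X w)^-1) ^+ 2)%:E < +oo)%E.
Proof.
have [e e0 he] := density_tail_le.
pose r j : R := e / 2 * 2^-1 ^+ j.
have r0 j : 0 < r j by rewrite mulr_gt0 ?divr_gt0// exprn_gt0.
have re j : r j < e.
  rewrite /r (@le_lt_trans _ _ (e / 2))//; last by lra.
  have h1 : 2^-1 ^+ j <= 1 :> R by apply: exprn_ile1; lra.
  by rewrite ler_piMr// divr_ge0// ltW.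
have rS j : r j.+1 = r j / 2 by rewrite /r exprSr; lra.
pose q : R := 2^-1 `^ (beta - 1).
have q0 : 0 < q by rewrite powR_gt0.
have q1 : `|q| < 1.
  have e1 : 1 `^ (beta - 1) = 1 :> R by rewrite powR1.
  rewrite ger0_norm ?powR_ge0// /q -[ltRHS]e1.
  by apply: gt0_ltr_powR; rewrite ?nnegrE ?subr_gt0//; lra.
pose K := 4 * C * (e / 2) `^ (beta - 1).
have K0 : 0 <= K by rewrite /K !mulr_ge0 ?powR_ge0.
have mX : measurable_fun setT X by exact: measurable_funPT.
have mE j : measurable [set w | 1 - X w <= r j].
  rewrite (_ : [set w | _] = X @^-1` `[1 - r j, +oo[); last first.
    by apply/seteqP; split=> w /=; rewrite in_itv/= andbT => h; lra.
  by rewrite -[X in measurable X]setTI; exact: mX.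
have ptw w : ((((1 - X w)^-1) ^+ 2)%:E <= ((e / 2) ^- 2)%:E +
    \sum_(j <oo) ((r j.+1) ^- 2)%:E * (\1_[set w | (1 - X w <= r j)%R] w)%:E)%E.
  have /andP[Xw0 Xw1] := X01 w.
  have s0 j : (0 <= ((r j.+1) ^- 2)%:E * (\1_[set w | (1 - X w <= r j)%R] w)%:E :> \bar R)%E.
    by rewrite mule_ge0// lee_fin invr_ge0 exprn_ge0// ltW.
  have [|Xe] := leP (e / 2) (1 - X w).
    move=> h; rewrite (@le_trans _ _ ((e / 2) ^- 2)%:E)//; last first.
      by rewrite leeDl// nneseries_ge0.
    by rewrite lee_fin inv_sqr_le// divr_gt0.
  have ex : exists j, r j.+1 < 1 - X w.
    have : \forall j \near \oo, r j < 1 - X w.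
      have := @cvg_geometric R (e / 2) 2^-1 _; rewrite ger0_norm//.
      move=> /(_ ltac:(lra)) h; apply: (cvgr_lt _ h); lra.
    move=> [n _ hn]; exists n; exact: hn (leqnSn n).
  (* The term of this index alone exceeds the integrand: r_(j+1) < 1 - X <= r_j. *)
  case: (ex_minnP ex) => j jX jmin.
  have Xj : 1 - X w <= r j.
    case: j jmin {jX} => [|j] jmin; first by rewrite /r expr0 mulr1 ltW.
    by rewrite leNgt; apply/negP => /jmin; rewrite ltnn.
  apply: (@le_trans _ _ ((r j.+1) ^- 2)%:E).
    by rewrite lee_fin inv_sqr_le// ltW.
  pose u i : \bar R := (((r i.+1) ^- 2)%:E * (\1_[set w | (1 - X w <= r i)%R] w)%:E)%E.
  have uj : u j = ((r j.+1) ^- 2)%:E by rewrite /u indicE mem_set// mule1.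
  rewrite -[X in (_ <= _ + X)%E]/(\sum_(i <oo) u i)%E.
  apply: (@le_trans _ _ (\sum_(i <oo) u i)%E).
    have u0 i : xpredT i -> (0 <= u i)%E by move=> _; exact: s0.
    have h := @nneseriesD1 _ u j xpredT u0 isT.
    by rewrite -uj h; apply: leeDl; apply: nneseries_ge0 => i _ _; exact: s0.
  by rewrite leeDr// lee_fin invr_ge0 sqr_ge0.
have ms j : measurable_fun setT (fun w => ((r j.+1) ^- 2)%:E * (\1_[set w | (1 - X w <= r j)%R] w)%:E)%E.
  apply: emeasurable_funM; first exact: measurable_cst.
  by apply/measurable_EFinP; exact: measurable_indic.
have s0 j w : (0 <= ((r j.+1) ^- 2)%:E * (\1_[set w | (1 - X w <= r j)%R] w)%:E :> \bar R)%E.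
  by rewrite mule_ge0// lee_fin invr_ge0 exprn_ge0// ltW.
have m2 : measurable_fun setT (fun w => ((1 - X w)^-1) ^+ 2).
  apply: measurable_funX; apply: (@measurableT_comp _ _ _ _ _ _ (@GRing.inv R)).
    exact: measurable_invr.
  exact: measurable_funB.
have mser : measurable_fun setT (fun w => \sum_(j <oo) ((r j.+1) ^- 2)%:E * (\1_[set w | (1 - X w <= r j)%R] w)%:E)%E.
  exact: ge0_emeasurable_sum.
apply: (@le_lt_trans _ _ (\int[P]_w (((e / 2) ^- 2)%:E +
    \sum_(j <oo) ((r j.+1) ^- 2)%:E * (\1_[set w | (1 - X w <= r j)%R] w)%:E))%E).
  apply: ge0_le_integral => //.
  - by move=> w _; rewrite lee_fin sqr_ge0.
  - exact/measurable_EFinP.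
  - by apply: emeasurable_funD => //; exact: measurable_cst.
rewrite ge0_integralD//; last 2 first.
- by move=> w _; rewrite lee_fin invr_ge0 sqr_ge0.
- by move=> w _; exact: nneseries_ge0.
rewrite integral_cst// [X in (_ * X)%E]probability_setT mule1.
rewrite integral_nneseries//.
apply: (@le_lt_trans _ _ (((e / 2) ^- 2)%:E + (K / (1 - q))%:E)%E); last by rewrite -EFinD ltry.
rewrite leeD2l//; apply: lime_le; first by apply: is_cvg_nneseries => j _ _; exact: integral_ge0.
apply: nearW => n; rewrite big_mkord.
apply: (@le_trans _ _ (\sum_(j < n) (K * q ^+ j)%:E)%E); last first.
  rewrite sumEFin lee_fin; have := geometric_le_lim n K0 q0 q1.
  by rewrite /series/= big_mkord.
apply: lee_sum => j _.
rewrite ge0_integralZl//; last 2 first.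
- by apply/measurable_EFinP; exact: measurable_indic.
- by rewrite lee_fin invr_ge0 exprn_ge0// ltW.
rewrite integral_indic// setIT.
apply: (@le_trans _ _ (((r j.+1) ^- 2)%:E * (C * r j `^ beta * r j)%:E)%E).
  by rewrite lee_wpmul2l ?he// lee_fin invr_ge0 exprn_ge0// ltW.
rewrite -EFinM lee_fin le_eqVlt; apply/orP; left; apply/eqP.
have beta0 : 0 < beta by rewrite (lt_trans ltr01).
have -> : r j `^ beta = r j * r j `^ (beta - 1) by rewrite mulr_powRB1// ltW.
have -> : r j `^ (beta - 1) = (e / 2) `^ (beta - 1) * q ^+ j.
  rewrite /r powRM; [|lra|by rewrite exprn_ge0]; congr (_ * _).
  have -> : 2^-1 ^+ j = 2^-1 `^ j%:R :> R by rewrite powR_mulrn.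
  have -> : q ^+ j = q `^ j%:R by rewrite powR_mulrn// ltW.
  by rewrite /q powRAC.
rewrite /K rS; have := r0 j; move: (r j) (_ `^ _) (q ^+ j) => x y z x0.
by field; rewrite gt_eqF.
Qed.

End density_tail.

(** * Covariances around the conditional mean *)

Section geometric_bounds.
Context {R : realType}.

Lemma geometric_sum_le (a : R) n : 0 < a < 1 -> \sum_(0 <= k < n) a ^+ k <= (1 - a)^-1.
Proof.
move=> /andP[a0 a1].
have := @geometric_le_lim R n 1 a ler01 a0; rewrite (ger0_norm (ltW a0)) => /(_ a1).
by rewrite div1r /series/=; under eq_bigr do rewrite mul1r.
Qed.

(** In truncated subtraction [(j - k) + (k - j)] is the distance of j and k. *)
Lemma two_sided_geometric_sum_le (a : R) n j : 0 < a < 1 -> (j < n)%N ->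
  \sum_(k < n) a ^+ ((j - k) + (k - j)) <= 2 * (1 - a)^-1.
Proof.
move=> a01 jn; have /andP[a0 a1] := a01.
rewrite -(big_mkord xpredT (fun k => a ^+ ((j - k) + (k - j)))).
rewrite (@big_cat_nat _ _ _ j)//=; last exact: ltnW.
rewrite mulr_natl mulr2n lerD//.
  rewrite big_nat_rev/= add0n (le_trans _ (geometric_sum_le j a01))//.
  rewrite big_nat [leRHS]big_nat; apply: ler_sum => k /andP[_ kj].
  have -> : (j - (j - k.+1) + (j - k.+1 - j) = k.+1)%N by lia.
  by rewrite exprS ler_piMl ?exprn_ge0// ltW.
rewrite -{1}(add0n j) big_addn (le_trans _ (geometric_sum_le (n - j) a01))//.
by apply: ler_sum => k _; rewrite addnK subnDA; have -> : (j - k - j = 0)%N by lia.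
Qed.

End geometric_bounds.

Section inar_second_moments.
Context d (T : measurableType d) (R : realType) (P : probability T R).
Variables (lambda : R) (alpha : {RV P >-> R}) (X0 : {RV P >-> nat})
  (xi : nat -> nat -> {RV P >-> nat}) (eps : nat -> {RV P >-> nat}).
Hypothesis lambda0 : 0 < lambda.
Hypothesis inarP : randomized_inar P lambda alpha X0 xi eps.
Hypothesis fin : (\int[P]_w (((1 - alpha w)^-1) ^+ 2)%:E < +oo)%E.

Local Notation X := (inar X0 xi eps).
Local Notation M := (fun w => inar_mean lambda (alpha w)).
Local Notation L1 := (fun f : T -> R => P.-integrable setT (EFin \o f)).

Let a01 w : 0 < alpha w < 1. Proof. exact: (inar_alpha01 inarP). Qed.
Let ma : measurable_fun setT alpha. Proof. exact: measurable_funPT. Qed.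
Let mM : measurable_fun setT M.
Proof. by apply: measurableT_comp => //; exact: measurable_inar_mean. Qed.
Let mX k : measurable_fun setT (fun w => (X k w)%:R : R).
Proof. exact: measurable_natr (adapted_measurable (@adapted_inar _ _ _ _ alpha X0 xi eps k)). Qed.
Let M0 w : 0 < M w. Proof. exact: (inar_mean_gt0 lambda0 inarP). Qed.

Lemma L2_inar_mean : L2fun P M.
Proof.
split=> //; have i2 : L1 (fun w => ((1 - alpha w)^-1) ^+ 2).
  apply: ge0_L1 => //; last by move=> w; exact: sqr_ge0.
  apply: measurable_funX; apply: (@measurableT_comp _ _ _ _ _ _ (@GRing.inv R)).
    exact: measurable_invr.
  exact: measurable_funB.
by apply: eq_L1 (L1_Z (lambda ^+ 2) i2) => w; rewrite /inar_mean exprMn.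
Qed.

Lemma L2_inar k : L2fun P (fun w => (X k w)%:R).
Proof.
split=> //; apply: ge0_L1; [exact: measurable_funX|by move=> w; exact: sqr_ge0|].
have := expec_inar_sqr lambda0 inarP k (h := fun=> 1) (measurable_cst _) (fun=> ler01).
under eq_integral do rewrite mul1r; move=> ->.
under eq_integral do rewrite mul1r.
apply: L1_lty; last by move=> w; rewrite addr_ge0 ?sqr_ge0// ltW.
by apply: L1_D; [exact: L2_sqr L2_inar_mean|exact: L2_L1 L2_inar_mean].
Qed.

Lemma mean_inar k : \int[P]_w (X k w)%:R = \int[P]_w M w.
Proof.
have := expec_inar lambda0 inarP k (h := fun=> 1) (measurable_cst _) (fun=> ler01).
under eq_integral do rewrite mul1r; rewrite /Rintegral => ->.
by under [in LHS]eq_integral do rewrite mul1r.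
Qed.

Lemma L1_pow_mean m : L1 (fun w => alpha w ^+ m * M w).
Proof.
apply: L1_le (L2_L1 L2_inar_mean); first by apply: measurable_funM => //; exact: measurable_funX.
move=> w; have /andP[/ltW a0 /ltW a1] := a01 w; have /ltW M0w := M0 w.
rewrite ger0_norm; last by rewrite mulr_ge0// exprn_ge0.
by rewrite ler_piMl// exprn_ile1.
Qed.

Definition inar_deviation k w : R := (X k w)%:R - M w.

Lemma L2_inar_deviation k : L2fun P (inar_deviation k).
Proof. exact: L2_B (L2_inar k) L2_inar_mean. Qed.

(** The deviation of X_k from its conditional mean is orthogonal to the functions
    of alpha, which leaves the conditional covariance alpha^m M. *)
Lemma deviation_covariance k m :
  \int[P]_w (inar_deviation k w * inar_deviation (k + m)%N w) =
  \int[P]_w (alpha w ^+ m * M w).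
Proof.
have iX j := L2_inar j; have iM := L2_inar_mean.
have MX j : \int[P]_w (M w * (X j w)%:R) = \int[P]_w (M w ^+ 2).
  rewrite /Rintegral (expec_inar lambda0 inarP j (measurable_inar_mean lambda))//.
  by move=> w; exact: ltW.
have iaM := L1_pow_mean m.
have XX : \int[P]_w ((X k w)%:R * (X (k + m)%N w)%:R) =
    \int[P]_w (M w ^+ 2) + \int[P]_w (alpha w ^+ m * M w).
  rewrite -expecD//; last exact: L2_sqr.
  have := expec_inarM lambda0 inarP k m (h := fun=> 1) (measurable_cst _) (fun=> ler01).
  under eq_integral do rewrite mul1r; rewrite /Rintegral => ->.
  by under [in LHS]eq_integral do rewrite mul1r.
transitivity (\int[P]_w ((X k w)%:R * (X (k + m)%N w)%:R - M w * (X k w)%:R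
    - (M w * (X (k + m)%N w)%:R - M w ^+ 2))).
  by apply: expec_eq => w; rewrite /inar_deviation; ring.
rewrite !expecB ?XX ?MX//; try by [exact: L2_M|exact: L2_sqr].
- by rewrite subrr subr0 addrAC subrr add0r.
- by apply: L1_B; exact: L2_M.
- by apply: L1_B; [exact: L2_M|exact: L2_sqr].
Qed.

(** Each of the n rows of the covariance matrix adds up to at most
    2 M / (1 - alpha), before the expectation over alpha: the growth is linear in
    n, not quadratic. *)
Lemma deviation_sum_second_moment n :
  \int[P]_w ((\sum_(k < n) inar_deviation k.+1 w) ^+ 2) <=
  n%:R * (2 * lambda * \int[P]_w (((1 - alpha w)^-1) ^+ 2)).
Proof.
have iaM := L1_pow_mean.
have i2 : L1 (fun w => ((1 - alpha w)^-1) ^+ 2).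
  apply: eq_L1 (L1_Z (lambda ^- 2) (L2_sqr L2_inar_mean)) => w.
  by rewrite /inar_mean; field; rewrite !gt_eqF//; have /andP[_] := a01 w; rewrite subr_gt0.
have iDD j k : L1 (fun w => inar_deviation j w * inar_deviation k w).
  by apply: L2_M; exact: L2_inar_deviation.
have -> : \int[P]_w ((\sum_(k < n) inar_deviation k.+1 w) ^+ 2) =
    \int[P]_w (\sum_(j < n) \sum_(k < n) inar_deviation j.+1 w * inar_deviation k.+1 w).
  by apply: expec_eq => w; rewrite expr2 mulr_suml; apply: eq_bigr => j _; rewrite mulr_sumr.
rewrite expec_sum; last by move=> j; exact: L1_sum.
rewrite mulr_natl -[n in leRHS]card_ord -sumr_const; apply: ler_sum => j _.
rewrite expec_sum//.
have cov k : \int[P]_w (inar_deviation j.+1 w * inar_deviation k.+1 w) =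
    \int[P]_w (alpha w ^+ ((j - k) + (k - j)) * M w).
  have [jk|kj] := leqP j k.
    have -> : (j - k + (k - j) = k - j)%N by lia.
    by rewrite -(deviation_covariance j.+1); have -> : (j.+1 + (k - j) = k.+1)%N by lia.
  have -> : (j - k + (k - j) = j - k)%N by lia.
  rewrite -(deviation_covariance k.+1); have -> : (k.+1 + (j - k) = j.+1)%N by lia.
  by apply: expec_eq => w; rewrite mulrC.
under eq_bigr do rewrite cov.
rewrite -expec_sum// -expecZ//; apply: le_expec.
- exact: L1_sum.
- exact: L1_Z.
move=> w; rewrite -mulr_suml.
have h := two_sided_geometric_sum_le (a01 w) (ltn_ord j).
apply: (le_trans (ler_wpM2r (ltW (M0 w)) h)).
by rewrite le_eqVlt; apply/orP; left; apply/eqP; rewrite /inar_mean expr2; ring.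
Qed.

End inar_second_moments.

(** * Mean square convergence *)

Section mean_square_convergence.
Context d (T : measurableType d) (R : realType) (P : probability T R).
Local Notation L1 := (fun f : T -> R => P.-integrable setT (EFin \o f)).

Lemma expec_sqrD_le (f g : T -> R) : L2fun P f -> L2fun P g ->
  \int[P]_w ((f w + g w) ^+ 2) <= 2 * \int[P]_w (f w ^+ 2) + 2 * \int[P]_w (g w ^+ 2).
Proof.
move=> hf hg; have if2 := L2_sqr hf; have ig2 := L2_sqr hg.
rewrite -!expecZ// -expecD; [|exact: L1_Z..].
apply: le_expec; [exact: L2_sqr (L2_D hf hg)|by apply: L1_D; exact: L1_Z|].
by move=> w; have := sqr_ge0 (f w - g w); lra.
Qed.

Lemma expec_sqrZ (c : R) (f : T -> R) : L2fun P f ->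
  \int[P]_w ((c * f w) ^+ 2) = c ^+ 2 * \int[P]_w (f w ^+ 2).
Proof.
move=> hf; rewrite -expecZ; last exact: L2_sqr.
by apply: expec_eq => w; rewrite exprMn.
Qed.

Lemma mean_square_cvg0D (f g : nat -> T -> R) :
  (forall n, L2fun P (f n)) -> (forall n, L2fun P (g n)) ->
  \int[P]_w (f n w ^+ 2) @[n --> \oo] --> (0 : R) ->
  \int[P]_w (g n w ^+ 2) @[n --> \oo] --> (0 : R) ->
  \int[P]_w ((f n w + g n w) ^+ 2) @[n --> \oo] --> (0 : R).
Proof.
move=> hf hg f0 g0.
apply: (@cvg_normr_le _ _ (fun n => 2 * \int[P]_w (f n w ^+ 2) + 2 * \int[P]_w (g n w ^+ 2))).
  apply: nearW => n; rewrite subr0 ger0_norm; last by apply: expec_ge0 => w; exact: sqr_ge0.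
  exact: expec_sqrD_le.
rewrite -(addr0 0) -(mulr0 2); apply: cvgD; apply: cvgMr; exact.
Qed.

Lemma mean_square_cvg0_sum m (u : 'I_m -> R) (f : 'I_m -> nat -> T -> R) :
  (forall i n, L2fun P (f i n)) ->
  (forall i, \int[P]_w (f i n w ^+ 2) @[n --> \oo] --> (0 : R)) ->
  \int[P]_w ((\sum_(i < m) u i * f i n w) ^+ 2) @[n --> \oo] --> (0 : R).
Proof.
elim: m u f => [|m ih] u f hf f0.
  under eq_fun do under expec_eq do rewrite big_ord0 expr0n.
  by under eq_fun do rewrite expec_cst; exact: cvg_cst.
under eq_fun do under expec_eq do rewrite big_ord_recr/=.
apply: mean_square_cvg0D.
- by move=> n; apply: L2_sum => i; exact: L2_Z.
- by move=> n; exact: L2_Z.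
- by apply: (ih (fun i => u (widen_ord (leqnSn m) i)) (fun i => f (widen_ord (leqnSn m) i))).
- under eq_fun do rewrite expec_sqrZ//.
  by rewrite -(mulr0 (u ord_max ^+ 2)); apply: cvgMr.
Qed.

(** |f^2 - g^2| <= (f - g)^2 + (f - g)^2 / s + s g^2 for every s > 0.  With
    s_n = sqrt e_n + 1 / (n + 1), where e_n = E (f_n - g)^2, all terms vanish in
    the limit; the summand 1 / (n + 1) keeps s_n positive. *)
Lemma mean_square_cvg_sqr (f : nat -> T -> R) (g : T -> R) :
  (forall n, L2fun P (f n)) -> L2fun P g ->
  \int[P]_w ((f n w - g w) ^+ 2) @[n --> \oo] --> (0 : R) ->
  \int[P]_w (f n w ^+ 2) @[n --> \oo] --> \int[P]_w (g w ^+ 2).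
Proof.
move=> hf hg fg.
pose e n := \int[P]_w ((f n w - g w) ^+ 2).
have e0 n : 0 <= e n by apply: expec_ge0 => w; exact: sqr_ge0.
pose s n := Num.sqrt (e n) + n.+1%:R^-1.
have s0 n : 0 < s n by rewrite ltr_wpDl ?sqrtr_ge0// invr_gt0.
have sqrt0 : Num.sqrt (e n) @[n --> \oo] --> (0 : R).
  rewrite -[X in _ --> X]sqrtr0; apply: (continuous_cvg _ _ fg).
  exact: sqrt_continuous.
have s_cvg : s n @[n --> \oo] --> (0 : R).
  by rewrite -(addr0 0); apply: cvgD => //; exact: cvg_harmonic.
have hd n : L2fun P (fun w => f n w - g w) by exact: L2_B.
apply: (@cvg_normr_le _ _ (fun n => e n + Num.sqrt (e n) + s n * \int[P]_w (g w ^+ 2))).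
  apply: nearW => n.
  rewrite -expecB; [|exact: L2_sqr..].
  apply: (@le_trans _ _ (\int[P]_w ((f n w - g w) ^+ 2 + ((s n)^-1 * (f n w - g w) ^+ 2 + s n * g w ^+ 2)))).
    apply: normr_expec_le.
    - by apply: L1_B; exact: L2_sqr.
    - apply: L1_D; first exact: L2_sqr.
      by apply: L1_D; apply: L1_Z; exact: L2_sqr.
    move=> w; rewrite (_ : f n w ^+ 2 - g w ^+ 2 = (f n w - g w) ^+ 2 + 2 * (f n w - g w) * g w); last by ring.
    rewrite (le_trans (ler_normD _ _))// ger0_norm ?sqr_ge0// lerD2l.
    set x := f n w - g w; move: x (g w) (s n) (s0 n) => x y z z0.
    have h : 0 <= z * (z^-1 * x - y) ^+ 2 by rewrite mulr_ge0 ?sqr_ge0// ltW.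
    have h' : 0 <= z * (z^-1 * x + y) ^+ 2 by rewrite mulr_ge0 ?sqr_ge0// ltW.
    have E : z * (z^-1 * x - y) ^+ 2 = z^-1 * x ^+ 2 + z * y ^+ 2 - 2 * x * y by field; rewrite gt_eqF.
    have E' : z * (z^-1 * x + y) ^+ 2 = z^-1 * x ^+ 2 + z * y ^+ 2 + 2 * x * y by field; rewrite gt_eqF.
    by rewrite ler_norml; apply/andP; split; lra.
  rewrite expecD; [|exact: L2_sqr|by apply: L1_D; apply: L1_Z; exact: L2_sqr].
  rewrite expecD; [|by apply: L1_Z; exact: L2_sqr..].
  rewrite !expecZ; [|exact: L2_sqr..].
  rewrite -/(e n) addrA lerD2r lerD2l ler_pdivrMl//.
  rewrite -{1}(sqr_sqrtr (e0 n)) expr2 ler_wpM2r ?sqrtr_ge0//.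
  by rewrite lerDl invr_ge0.
rewrite -(addr0 0) -{1}(addr0 0); apply: cvgD; first exact: cvgD.
by rewrite -(mul0r (\int[P]_w (g w ^+ 2))); apply: cvgMl.
Qed.

Lemma normr_cosB_le (a b : R) : `|cos a - cos b| <= `|a - b|.
Proof.
pose x := (a + b) / 2; pose y := (a - b) / 2.
have -> : a = x + y by rewrite /x /y; field.
have -> : b = x - y by rewrite /x /y; field.
rewrite cosD cosB (_ : _ - _ - _ = - (2 * (sin x * sin y))); last by ring.
rewrite normrN (normrM 2) (_ : x + y - (x - y) = 2 * y); last by ring.
rewrite (normrM (sin x)) (normrM 2 y).
apply: ler_wpM2l => //; apply: le_trans (normr_sin_le y); apply: ler_piMl => //.
by rewrite ler_norml sin_geN1 sin_le1.
Qed.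

Lemma mean_square_cvg_cos (f : nat -> T -> R) (g : T -> R) (c : R) :
  (forall n, L2fun P (f n)) -> L2fun P g ->
  \int[P]_w ((f n w - g w) ^+ 2) @[n --> \oo] --> (0 : R) ->
  \int[P]_w cos (f n w + c) @[n --> \oo] --> \int[P]_w cos (g w + c).
Proof.
move=> hf hg fg.
pose e n := \int[P]_w ((f n w - g w) ^+ 2).
have sqrt0 : Num.sqrt (e n) @[n --> \oo] --> (0 : R).
  rewrite -[X in _ --> X]sqrtr0; apply: (continuous_cvg _ _ fg).
  exact: sqrt_continuous.
apply: (@cvg_normr_le _ _ (fun n => Num.sqrt (e n))) => //.
apply: nearW => n.
have hd : L2fun P (fun w => f n w - g w) by exact: L2_B.
have ic h : L2fun P h -> L1 (fun w => cos (h w + c)).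
  by move=> [mh _]; apply: L1_cos; exact: measurable_funD.
rewrite -expecB; [|exact: ic..].
apply: (@le_trans _ _ (\int[P]_w `|f n w - g w|)).
  apply: normr_expec_le; [by apply: L1_B; exact: ic|exact: integrable_norm (L2_L1 hd)|].
  move=> w; rewrite (le_trans (normr_cosB_le _ _))// (_ : _ + c - _ = f n w - g w)//; ring.
have n0 : 0 <= \int[P]_w `|f n w - g w| by apply: expec_ge0 => w.
have -> : \int[P]_w `|f n w - g w| = Num.sqrt ((\int[P]_w `|f n w - g w|) ^+ 2).
  by rewrite sqrtr_sqr ger0_norm.
by rewrite ler_wsqrtr// normr_expec_sqr_le.
Qed.

End mean_square_convergence.

(** * Functionals of the independent copies *)

(** The generators of the sigma-algebra [path_sigma_algebra], named so that the
    space of paths becomes a measurable type. *)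
Definition path_generator (R : realType) : set (set (R * (nat -> nat))) :=
  [set C | (exists2 A : set R, measurable A & C = fst @^-1` A) \/
           (exists k (B : set nat), C = [set z | B (z.2 k)])].

Definition path_space (R : realType) : Type := g_sigma_algebraType (@path_generator R).

Section path_measurability.
Context {R : realType}.

Lemma measurable_path_fst : measurable_fun setT (fun z : path_space R => z.1).
Proof.
move=> _ A mA; rewrite setTI; apply: sub_sigma_algebra; left; by exists A.
Qed.

Lemma measurable_path_snd k : measurable_fun setT (fun z : path_space R => (z.2 k)%:R : R).
Proof.
apply: measurable_natr => _ B mB; rewrite setTI; apply: sub_sigma_algebra; right.
by exists k, B.
Qed.

Lemma measurable_alpha_path d (T : measurableType d) (alpha : T -> R) (X : nat -> T -> nat) :
  measurable_fun setT alpha -> (forall k, measurable_fun setT (X k)) ->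
  measurable_fun setT (alpha_path alpha X : T -> path_space R).
Proof.
move=> ma mX; apply: (@measurability _ _ T (path_space R) setT _ (@path_generator R)) => // _ [C [[A mA ->]|[k [B ->]]] <-].
  exact: ma.
exact: mX.
Qed.

End path_measurability.

Section copies.
Context d0 (T0 : measurableType d0) d (T : measurableType d) (R : realType).
Variables (P0 : probability T0 R) (alpha : T0 -> R) (X : nat -> T0 -> nat).
Variables (P : probability T R) (alphas : nat -> {RV P >-> R}) (Xs : nat -> nat -> {RV P >-> nat}).
Hypothesis ma : measurable_fun setT alpha.
Hypothesis mX : forall k, measurable_fun setT (X k).
Hypothesis copiesP : independent_copies P0 alpha X P alphas Xs.

(** Functionals of the path are the common currency between the copies and the
    original process: their laws agree, and the copies of one functional are
    independent. *)
Definition copy (phi : path_space R -> R) (j : nat) (w : T) : R :=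
  phi (alpha_path (alphas j) (Xs j) w).

Definition original (phi : path_space R -> R) (w : T0) : R := phi (alpha_path alpha X w).

Lemma measurable_copy phi j : measurable_fun setT phi -> measurable_fun setT (copy phi j).
Proof.
move=> mphi; apply: (measurableT_comp mphi); apply: measurable_alpha_path => [|k].
  exact: measurable_funPT.
exact: measurable_funPT.
Qed.

Lemma measurable_original phi : measurable_fun setT phi -> measurable_fun setT (original phi).
Proof. by move=> mphi; apply: (measurableT_comp mphi); exact: measurable_alpha_path. Qed.

Lemma path_preimage (phi : path_space R -> R) (B : set R) : measurable_fun setT phi -> measurable B ->
  path_sigma_algebra (phi @^-1` B).
Proof. by move=> mphi mB; have := mphi measurableT B mB; rewrite setTI. Qed.

Lemma law_copy phi j B : measurable_fun setT phi -> measurable B ->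
  P (copy phi j @^-1` B) = P0 (original phi @^-1` B).
Proof. by move=> mphi mB; exact: (copies_law copiesP j (path_preimage mphi mB)). Qed.

Lemma integral_copy phi (g : R -> R) j : measurable_fun setT phi -> measurable_fun setT g ->
  (\int[P]_w (g (copy phi j w))%:E = \int[P0]_w (g (original phi w))%:E)%E.
Proof.
move=> mphi mg; apply: eq_law_integral => //.
- exact: measurable_copy.
- exact: measurable_original.
- by move=> A mA; exact: law_copy.
Qed.

Lemma expec_copy phi (g : R -> R) j : measurable_fun setT phi -> measurable_fun setT g ->
  \int[P]_w g (copy phi j w) = \int[P0]_w g (original phi w).
Proof. by move=> mphi mg; rewrite /Rintegral integral_copy. Qed.

Lemma L2_copy phi j : measurable_fun setT phi -> L2fun P0 (original phi) -> L2fun P (copy phi j).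
Proof.
move=> mphi h2; split; first exact: measurable_copy.
apply: ge0_L1; [by apply: measurable_funX; exact: measurable_copy|by move=> w; exact: sqr_ge0|].
rewrite (@integral_copy phi (fun x => x ^+ 2))//.
by apply: L1_lty; [exact: L2_sqr|move=> w; exact: sqr_ge0].
Qed.

Lemma independent_copy phi : measurable_fun setT phi -> mutually_independent P (copy phi).
Proof.
move=> mphi N B mB.
have := copies_indep copiesP (m := N) (i := val) (C := fun k => phi @^-1` B (val k)) val_inj
  (fun k => path_preimage mphi (mB (val k))).
move=> h; rewrite -[RHS]h; congr (P _); apply/seteqP; split=> w /= hw.
  by move=> k; apply: hw.
by move=> k kN; exact: (hw (Ordinal kN)).
Qed.

Section centered_functional.
Variable phi : path_space R -> R.
Hypothesis mphi : measurable_fun setT phi.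
Hypothesis L2phi : L2fun P0 (original phi).
Hypothesis phi0 : \int[P0]_w original phi w = 0.
Let v := \int[P0]_w (original phi w ^+ 2).

Let c0 j : \int[P]_w copy phi j w = 0.
Proof. by rewrite -phi0; exact: (expec_copy j mphi (@measurable_id _ _ _)). Qed.

Let cv j : \int[P]_w (copy phi j w ^+ 2) = v.
Proof. by apply: (@expec_copy phi (fun x => x ^+ 2)) => //; exact: exprn_measurable. Qed.

(** The factor [(0 < N)%:R] accounts for N = 0, where the normalized sum is 0. *)
Lemma copies_sum_second_moment N :
  \int[P]_w (((\sum_(j < N) copy phi j w) / Num.sqrt N%:R) ^+ 2) = (0 < N)%N%:R * v.
Proof.
have L2S : L2fun P (fun w => \sum_(j < N) copy phi j w) by apply: L2_sum => j; exact: L2_copy.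
under expec_eq do rewrite mulrC.
rewrite expec_sqrZ// (expec_sqr_sum (fun j => measurable_copy j mphi) (independent_copy mphi) (v := v))//; last first.
  by move=> j; exact: L2_copy.
rewrite exprVn sqr_sqrtr// mulrA; congr (_ * v).
case: N {L2S} => [|N]; first by rewrite mulr0.
by rewrite mulVf// pnatr_eq0.
Qed.

Lemma copies_central_limit th :
  \int[P]_w cos ((\sum_(j < N) copy phi j w) / Num.sqrt N%:R + th) @[N --> \oo]
    --> cos th * expR (- v / 2).
Proof.
apply: central_limit_cos.
- exact: independent_copy.
- by move=> j; exact: measurable_copy.
- by move=> j g mg; rewrite !expec_copy.
- exact: L2_copy.
- exact: c0.
- exact: cv.
Qed.

End centered_functional.
End copies.

(** * Time averages *)

(** The contribution of one copy to the doubly aggregated sum, up to the factor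
    N^(-1/2); [centered_mean] is its limit in mean square at t = 1. *)
Definition centered_average (R : realType) (mu : R) (n : nat) (t : R) (z : path_space R) : R :=
  n%:R^-1 * \sum_(1 <= k < (Num.truncn (n%:R * t)).+1) ((z.2 k)%:R - mu).

Definition centered_mean (R : realType) (lambda mu : R) (z : path_space R) : R :=
  inar_mean lambda z.1 - mu.

Lemma measurable_centered_average (R : realType) (mu : R) n t :
  measurable_fun setT (centered_average mu n t).
Proof.
apply: measurable_funM => //; apply: measurable_sum => k.
by apply: measurable_funB => //; exact: measurable_path_snd.
Qed.

Lemma measurable_centered_mean (R : realType) (lambda mu : R) :
  measurable_fun setT (centered_mean lambda mu).
Proof.
apply: measurable_funB => //; apply: (measurableT_comp (@measurable_inar_mean _ lambda)).
exact: measurable_path_fst.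
Qed.

Section averages.
Context d (T : measurableType d) (R : realType) (P : probability T R).
Variables (lambda : R) (alpha : {RV P >-> R}) (X0 : {RV P >-> nat})
  (xi : nat -> nat -> {RV P >-> nat}) (eps : nat -> {RV P >-> nat}).
Hypothesis lambda0 : 0 < lambda.
Hypothesis inarP : randomized_inar P lambda alpha X0 xi eps.
Hypothesis fin : (\int[P]_w (((1 - alpha w)^-1) ^+ 2)%:E < +oo)%E.

Local Notation X := (inar X0 xi eps).
Local Notation M := (fun w => inar_mean lambda (alpha w)).
Let mu := \int[P]_w M w.
Local Notation avg n t := (original alpha X (centered_average mu n t)).
Local Notation L := (original alpha X (centered_mean lambda mu)).
Let sigma2 := \int[P]_w (L w ^+ 2).

Let L2M : L2fun P M. Proof. exact: L2_inar_mean. Qed.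
Let L2X k : L2fun P (fun w => (X k w)%:R) := L2_inar lambda0 inarP fin k.

Lemma L2_centered_mean : L2fun P L.
Proof. by apply: L2_B => //; exact: L2_cst. Qed.

Lemma expec_centered_mean : \int[P]_w L w = 0.
Proof.
rewrite /original /centered_mean expecB; [|exact: L2_L1|exact: L1_cst].
by rewrite expec_cst subrr.
Qed.

Lemma centered_averageE n t w : avg n t w =
  n%:R^-1 * \sum_(k < Num.truncn (n%:R * t)) ((X k.+1 w)%:R - mu).
Proof. by rewrite /original /centered_average big_add1 big_mkord. Qed.

Lemma L2_centered_average n t : L2fun P (avg n t).
Proof.
apply: eq_L2 (fun w => esym (centered_averageE n t w)) _.
by apply: L2_Z; apply: L2_sum => k; apply: L2_B => //; exact: L2_cst.
Qed.

Lemma expec_centered_average n t : \int[P]_w avg n t w = 0.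
Proof.
have i k : P.-integrable setT (EFin \o (fun w => (X k w)%:R - mu)).
  by apply: L1_B; [exact: L2_L1|exact: L1_cst].
under expec_eq do rewrite centered_averageE.
rewrite expecZ; last exact: L1_sum.
rewrite expec_sum// big1 ?mulr0// => k _.
rewrite expecB; [|exact: L2_L1|exact: L1_cst].
by rewrite expec_cst (mean_inar lambda0 inarP) subrr.
Qed.

Let c := 2 * lambda * \int[P]_w (((1 - alpha w)^-1) ^+ 2).

Let c0 : 0 <= c.
Proof.
rewrite !mulr_ge0 ?(ltW lambda0)//; apply: expec_ge0 => w; exact: sqr_ge0.
Qed.

Let s0 : 0 <= sigma2. Proof. by apply: expec_ge0 => w; exact: sqr_ge0. Qed.

(** The error splits into the average of the deviations from the conditional
    mean, controlled by [deviation_sum_second_moment], and the effect of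
    truncating n t to an integer. *)
Lemma centered_average_error n t : 0 <= t ->
  \int[P]_w ((avg n.+1 t w - t * L w) ^+ 2) <= (2 * c * t + 2 * sigma2) / n.+1%:R.
Proof.
move=> t0; set m := Num.truncn (n.+1%:R * t).
have n0 : 0 < n.+1%:R :> R by [].
have nt0 : 0 <= n.+1%:R * t by rewrite mulr_ge0.
have /andP[mle mgt] := truncn_itv nt0; rewrite -/m in mle mgt.
pose D k := inar_deviation lambda alpha X0 xi eps k.
have L2D k : L2fun P (D k) by exact: (L2_inar_deviation lambda0 inarP fin).
have E w : avg n.+1 t w - t * L w =
    n.+1%:R^-1 * \sum_(k < m) D k.+1 w + (m%:R / n.+1%:R - t) * L w.
  rewrite centered_averageE -/m.
  have -> : \sum_(k < m) ((X k.+1 w)%:R - mu) = \sum_(k < m) D k.+1 w + m%:R * L w.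
    rewrite mulr_natl -[in _ *+ m](card_ord m) -sumr_const -big_split/=.
    by apply: eq_bigr => k _; rewrite /D /inar_deviation /original /centered_mean/= addrA subrK.
  by field; rewrite gt_eqF.
under expec_eq do rewrite E.
have h1 : L2fun P (fun w => \sum_(k < m) D k.+1 w) by exact: L2_sum.
have h2 := L2_centered_mean.
apply: (le_trans (expec_sqrD_le (L2_Z _ h1) (L2_Z _ h2))).
rewrite !expec_sqrZ//.
have dev := deviation_sum_second_moment lambda0 inarP fin m; rewrite -/c in dev.
have r1 : (m%:R / n.+1%:R - t) ^+ 2 <= n.+1%:R^-1.
  have -> : m%:R / n.+1%:R - t = - ((n.+1%:R * t - m%:R) / n.+1%:R) by field; rewrite gt_eqF.
  rewrite sqrrN expr_div_n expr2 ler_pdivrMr ?exprn_gt0// expr2 mulrA mulVf ?gt_eqF// mul1r.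
  have y0 : 0 <= n.+1%:R * t - m%:R by rewrite subr_ge0.
  have y1 : n.+1%:R * t - m%:R <= 1 by rewrite -natr1 in mgt; lra.
  apply: (@le_trans _ _ 1); last by rewrite ler1n.
  exact: mulr_ile1.
have r2 : n.+1%:R^-1 ^+ 2 * \int[P]_w ((\sum_(k < m) D k.+1 w) ^+ 2) <= c * t / n.+1%:R.
  rewrite (_ : c * t / n.+1%:R = n.+1%:R^-1 ^+ 2 * (n.+1%:R * t * c)); last by field; rewrite gt_eqF.
  by rewrite ler_wpM2l ?sqr_ge0// (le_trans dev)// ler_wpM2r.
have r3 := ler_wpM2r s0 r1.
rewrite (_ : (2 * c * t + 2 * sigma2) / n.+1%:R = 2 * (c * t / n.+1%:R) + 2 * (n.+1%:R^-1 * sigma2)); last by ring.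
by apply: lerD; rewrite ler_pM2l.
Qed.

Lemma centered_average_cvg t : 0 <= t ->
  \int[P]_w ((avg n t w - t * L w) ^+ 2) @[n --> \oo] --> (0 : R).
Proof.
move=> t0; rewrite -cvg_shiftS/=.
apply: (@cvg_normr_le _ _ (fun n => (2 * c * t + 2 * sigma2) / n.+1%:R)).
  apply: nearW => n; rewrite subr0 ger0_norm; last by apply: expec_ge0 => w; exact: sqr_ge0.
  exact: centered_average_error.
by have := cvg_invn (2 * c * t + 2 * sigma2); rewrite -cvg_shiftS.
Qed.

Lemma centered_average_bounded t : 0 <= t ->
  exists2 K, t ^+ 2 * sigma2 <= K & forall n, \int[P]_w (avg n t w ^+ 2) <= K.
Proof.
move=> t0.
have p1 : 0 <= t ^+ 2 * sigma2 by rewrite mulr_ge0 ?sqr_ge0.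
have p2 : 0 <= c * t by rewrite mulr_ge0.
have p3 : 0 <= sigma2 by exact: s0.
exists (2 * (2 * c * t + 2 * sigma2) + 2 * (t ^+ 2 * sigma2)); first by lra.
case=> [|n].
  under expec_eq do rewrite centered_averageE invr0 mul0r expr0n.
  by rewrite expec_cst /=; lra.
have h1 : L2fun P (fun w => avg n.+1 t w - t * L w).
  by apply: L2_B; [exact: L2_centered_average|apply: L2_Z; exact: L2_centered_mean].
have h2 : L2fun P (fun w => t * L w) by apply: L2_Z; exact: L2_centered_mean.
have -> : \int[P]_w (avg n.+1 t w ^+ 2) = \int[P]_w ((avg n.+1 t w - t * L w + t * L w) ^+ 2).
  by apply: expec_eq => w; rewrite subrK.
apply: (le_trans (expec_sqrD_le h1 h2)).
rewrite expec_sqrZ; last exact: L2_centered_mean.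
rewrite lerD2r ler_pM2l//; apply: (le_trans (centered_average_error n t0)).
have q0 : 0 <= 2 * c * t + 2 * sigma2 by lra.
by rewrite ler_pdivrMr// ler_peMr// ler1n.
Qed.

Lemma linear_combination_cvg m (t u : 'I_m -> R) : (forall i, 0 <= t i) ->
  \int[P]_w ((\sum_(i < m) u i * avg n (t i) w - (\sum_(i < m) u i * t i) * L w) ^+ 2)
    @[n --> \oo] --> (0 : R).
Proof.
move=> t0.
under eq_fun do under expec_eq do rewrite mulr_suml -sumrB.
have := @mean_square_cvg0_sum _ _ _ P m u (fun i n w => avg n (t i) w - t i * L w).
move=> h.
suff : \int[P]_w ((\sum_(i < m) u i * (avg n (t i) w - t i * L w)) ^+ 2) @[n --> \oo] --> (0 : R).
  apply: cvg_trans; apply: near_eq_cvg; apply: nearW => n; apply: expec_eq => w.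
  by congr (_ ^+ 2); apply: eq_bigr => i _; ring.
apply: h => [i n|i]; last exact: centered_average_cvg.
by apply: L2_B; [exact: L2_centered_average|apply: L2_Z; exact: L2_centered_mean].
Qed.

(** L is lambda times the centred variable 1 / (1 - alpha). *)
Lemma variance_inv : lambda ^+ 2 * fine ('V_P[(fun w => (1 - alpha w)^-1)%R])%E = sigma2.
Proof.
pose Y w := (1 - alpha w)^-1.
have L2Y : L2fun P Y.
  apply: eq_L2 (L2_Z lambda^-1 L2M) => w.
  by rewrite /Y /inar_mean mulrA mulVf ?mul1r// gt_eqF.
have YE : \int[P]_w Y w = lambda^-1 * mu.
  rewrite -expecZ; last exact: L2_L1.
  by apply: expec_eq => w; rewrite /Y /inar_mean mulrA mulVf ?mul1r// gt_eqF.
pose c' := fine ('E_P[Y])%E.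
have c'E : c' = lambda^-1 * mu by rewrite /c' expectationE ?YE//; exact: L2_L1.
have L2c : L2fun P (fun w => Y w - c') by apply: L2_B => //; exact: L2_cst.
have -> : ('V_P[Y] = (\int[P]_w ((Y w - c') ^+ 2))%:E)%E.
  rewrite -expectationE; last exact: L2_sqr.
  by rewrite /variance unlock.
rewrite /= -expec_sqrZ//; apply: expec_eq => w; congr (_ ^+ 2).
rewrite c'E /Y /original /centered_mean /inar_mean /=.
by rewrite mulrBr mulrA mulfV ?mul1r// gt_eqF.
Qed.

End averages.

(** * The two iterated limits *)

(** A linear combination of partial sums is one linear combination of the terms,
    the form in which the Gaussian sequence is specified. *)
Lemma sum_partial_sums (R : realType) m (u : 'I_m -> R) (N : 'I_m -> nat) (r : R) (y : nat -> R) :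
  \sum_(i < m) u i * (r * \sum_(k < N i) y k) =
  \sum_(k < \max_(i < m) N i) (\sum_(i < m) u i * r * (k < N i)%N%:R) * y k.
Proof.
under [RHS]eq_bigr do rewrite mulr_suml.
rewrite exchange_big/=; apply: eq_bigr => i _.
rewrite (big_ord_widen (\max_(i < m) N i) y); last exact: leq_bigmax.
rewrite mulrA mulr_sumr big_mkcond/=; apply: eq_bigr => k _.
by case: ifP => _; rewrite ?mulr1 // mulr0 mul0r.
Qed.

Section iterated_limits.
Context (R : realType) (lambda : R).
Context (d0 : measure_display) (T0 : measurableType d0) (P0 : probability T0 R).
Context (alpha : {RV P0 >-> R}) (X0 : {RV P0 >-> nat}).
Context (xi : nat -> nat -> {RV P0 >-> nat}) (eps : nat -> {RV P0 >-> nat}).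
Context (d : measure_display) (T : measurableType d) (P : probability T R).
Context (alphas : nat -> {RV P >-> R}) (Xs : nat -> nat -> {RV P >-> nat}).
Context (dW : measure_display) (TW : measurableType dW) (Q : probability TW R).
Context (W : {RV Q >-> R}).
Hypothesis lambda0 : 0 < lambda.
Hypothesis inarP : randomized_inar P0 lambda alpha X0 xi eps.
Hypothesis fin : (\int[P0]_w (((1 - alpha w)^-1) ^+ 2)%:E < +oo)%E.
Hypothesis noatom : forall x, P0 (alpha @^-1` [set x]) = 0%E.
Hypothesis copiesP : independent_copies P0 alpha (inar X0 xi eps) P alphas Xs.

Local Notation X := (inar X0 xi eps).
Let mu := \int[P0]_w inar_mean lambda (alpha w).
Local Notation average := (centered_average mu).
Local Notation mean := (centered_mean lambda mu).
Local Notation avg n t := (original alpha X (average n t)).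
Local Notation L := (original alpha X mean).
Local Notation copy := (copy alphas Xs).
Let sigma2 := \int[P0]_w (L w ^+ 2).
Hypothesis normW : normally_distributed Q W 0 sigma2.

Let ma : measurable_fun setT alpha. Proof. exact: measurable_funPT. Qed.
Let mX k : measurable_fun setT (X k).
Proof. exact: (adapted_measurable (@adapted_inar _ _ _ _ alpha X0 xi eps k)). Qed.
Let mavg n t : measurable_fun setT (average n t). Proof. exact: measurable_centered_average. Qed.
Let mmean : measurable_fun setT mean. Proof. exact: measurable_centered_mean. Qed.
Let L2avg n t : L2fun P0 (avg n t) := L2_centered_average lambda0 inarP fin n t.
Let L2L : L2fun P0 L. Proof. exact: L2_centered_mean. Qed.
Let avg0 n t : \int[P0]_w avg n t w = 0. Proof. exact: expec_centered_average. Qed.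
Let L0 : \int[P0]_w L w = 0. Proof. exact: expec_centered_mean. Qed.
Let sigma2_ge0 : 0 <= sigma2. Proof. by apply: expec_ge0 => w; exact: sqr_ge0. Qed.

Lemma expec_copy_path j k : fine ('E_P[fun w => (Xs j k w)%:R])%E = mu.
Proof.
have mp := @measurable_path_snd R k.
have h2 : L2fun P0 (original alpha X (fun z => (z.2 k)%:R)) by exact: (L2_inar lambda0 inarP fin k).
have h := L2_copy ma mX copiesP j mp h2.
rewrite expectationE/=; last exact: (L2_L1 h).
rewrite -[RHS](mean_inar lambda0 inarP k).
exact: (expec_copy ma mX copiesP j mp (@measurable_id _ _ _)).
Qed.

Lemma normalized_sumE N n t w : normalized_sum Xs N n t w =
  (\sum_(j < N) copy (average n t) j w) / Num.sqrt N%:R.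
Proof.
rewrite /= powRN powR12_sqrt// mulrAC [RHS]mulrC [RHS]mulrC; congr (_ / _).
rewrite /aggregated_sum mulr_sumr; apply: eq_bigr => j _.
rewrite /copy /centered_average/=; congr (_ * _); apply: eq_bigr => k _.
by rewrite expec_copy_path.
Qed.

(** The copies of alpha are independent with a common law without atoms, so that
    one transform suits them all. *)
Lemma standard_normals_exist : exists Z : nat -> T -> R,
  [/\ forall k, measurable_fun setT (Z k), mutually_independent P Z &
      forall k A, measurable A -> P (Z k @^-1` A) = normal_prob 0 1 A].
Proof.
have mf := @measurable_path_fst R.
have na x : P (alphas 0%N @^-1` [set x]) = 0%E.
  rewrite -(noatom x).
  have mx : measurable [set x] by exact: measurable_set1.
  exact: (law_copy copiesP 0%N mf mx).
have [g mg gP] := gaussian_transform na.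
have mgf : measurable_fun setT (fun z : path_space R => g z.1) by exact: measurableT_comp.
exists (copy (fun z => g z.1)); split.
- by move=> k; exact: measurable_copy.
- exact: (independent_copy copiesP).
- move=> k A mA; rewrite (law_copy copiesP k mgf mA) -gP//.
  by rewrite -(law_copy copiesP 0%N mgf mA).
Qed.

(** g is a Gaussian sequence with the covariances of the X_(k+1) - mu. *)
Lemma gaussian_average_exists : exists2 g : nat -> T -> R, forall k, measurable_fun setT (g k) &
  forall m (t u : 'I_m -> R) n c,
    \int[P]_w cos (\sum_(i < m) u i * (n%:R^-1 * \sum_(k < Num.truncn (n%:R * t i)) g k w) + c) =
    cos c * expR (- (\int[P0]_w ((\sum_(i < m) u i * avg n (t i) w) ^+ 2)) / 2).
Proof.
have [Z [mZ iZ nZ]] := standard_normals_exist.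
pose Y k w := (X k.+1 w)%:R - mu.
have L2Y k : L2fun P0 (Y k).
  by apply: L2_B; [exact: (L2_inar lambda0 inarP fin)|exact: L2_cst].
have [qE pG] := second_moment_positive_kernel L2Y.
have [g mg gE] := gaussian_sequence_exists mZ iZ nZ pG.
exists g => // m t u n c.
pose N i := Num.truncn (n%:R * t i).
transitivity (\int[P]_w cos (\sum_(k < \max_(i < m) N i) (\sum_(i < m) u i * n%:R^-1 * (k < N i)%N%:R) * g k w + c)).
  by apply: expec_eq => w; rewrite -(sum_partial_sums u N n%:R^-1 (fun k => g k w)).
rewrite (gE _ (fun k => \sum_(i < m) u i * n%:R^-1 * (k < N i)%N%:R)) qE; congr (_ * expR (- _ / 2)).
apply: expec_eq => w; congr (_ ^+ 2); rewrite -(sum_partial_sums u N n%:R^-1 (fun k => Y k w)).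
by apply: eq_bigr => i _; rewrite centered_averageE.
Qed.

Lemma linear_limit_cos m (t u : 'I_m -> R) c :
  \int[Q]_w cos (\sum_(i < m) u i * linear_process W (t i) w + c) =
  cos c * expR (- (sigma2 * (\sum_(i < m) u i * t i) ^+ 2) / 2).
Proof.
rewrite -(normal_expec_cos _ sigma2_ge0 _ _ normW); last exact: measurable_funPT.
apply: expec_eq => w; congr (cos (_ + _)); rewrite mulr_suml.
by apply: eq_bigr => i _ /=; ring.
Qed.

Lemma L2_limit t : L2fun Q (linear_process W t) /\
  \int[Q]_w (linear_process W t w ^+ 2) <= t ^+ 2 * sigma2.
Proof.
have [hW eW] : L2fun Q W /\ \int[Q]_w (W w ^+ 2) <= sigma2.
  apply: second_moment_charf => [|u]; first exact: measurable_funPT.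
  have := normal_expec_cos (@measurable_funPT _ _ _ _ W) sigma2_ge0 u 0 normW.
  by rewrite cos0 mul1r => <-; apply: expec_eq => w; rewrite addr0.
have E w : linear_process W t w = t * W w by rewrite /= mulrC.
split; first exact: eq_L2 (fun w => esym (E w)) (L2_Z t hW).
under expec_eq do rewrite E.
by rewrite expec_sqrZ// ler_wpM2l ?sqr_ge0.
Qed.

Lemma L2_copies_sum phi N : measurable_fun setT phi -> L2fun P0 (original alpha X phi) ->
  L2fun P (fun w => (\sum_(j < N) copy phi j w) / Num.sqrt N%:R).
Proof.
move=> mphi hphi; have h : L2fun P (fun w => \sum_(j < N) copy phi j w).
  by apply: L2_sum => j; exact: (L2_copy ma mX copiesP).
by apply: eq_L2 (L2_Z (Num.sqrt N%:R)^-1 h) => w; rewrite mulrC.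
Qed.

Lemma normalized_sum_L2 N n t : L2fun P (normalized_sum Xs N n t).
Proof.
have h := L2_copies_sum N (mavg n t) (L2avg n t).
by apply: eq_L2 h => w; rewrite [RHS]normalized_sumE.
Qed.

Lemma bool_natr_mul_le (b : bool) (x : R) : 0 <= x -> b%:R * x <= x.
Proof. by case: b => x0; rewrite ?mul1r ?mul0r. Qed.

Lemma normalized_sum_second_moment N n t :
  \int[P]_w (normalized_sum Xs N n t w ^+ 2) = (0 < N)%N%:R * \int[P0]_w (avg n t w ^+ 2).
Proof.
under expec_eq do rewrite normalized_sumE.
exact: (copies_sum_second_moment ma mX copiesP (mavg n t)).
Qed.

Section many_copies_first.
Variable g : nat -> T -> R.
Hypothesis mg : forall k, measurable_fun setT (g k).
Hypothesis gE : forall m (t u : 'I_m -> R) n c,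
  \int[P]_w cos (\sum_(i < m) u i * (n%:R^-1 * \sum_(k < Num.truncn (n%:R * t i)) g k w) + c) =
  cos c * expR (- (\int[P0]_w ((\sum_(i < m) u i * avg n (t i) w) ^+ 2)) / 2).

Program Definition gaussian_average (n : nat) : process R :=
  @Process R d T P (fun t w => n%:R^-1 * \sum_(k < Num.truncn (n%:R * t)) g k w) _.
Next Obligation. by move=> n t _; apply: measurable_funM => //; exact: measurable_sum. Qed.

Lemma gaussian_average_second_moment n t : L2fun P (gaussian_average n t) /\
  \int[P]_w (gaussian_average n t w ^+ 2) <= \int[P0]_w (avg n t w ^+ 2).
Proof.
have mga : measurable_fun setT (fun w : T => n%:R^-1 * \sum_(k < Num.truncn (n%:R * t)) g k w).
  by apply: measurable_funM => //; exact: measurable_sum.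
apply: (second_moment_charf mga) => u.
have := gE (fun _ : 'I_1 => t) (fun=> u) n 0; rewrite cos0 mul1r.
under expec_eq do rewrite big_ord1 addr0.
move=> ->; congr (expR (- _ / 2)).
under expec_eq do rewrite big_ord1.
by rewrite expec_sqrZ// mulrC.
Qed.

(** A linear combination of the values of the process at several times is a
    normalized sum of copies of one centred functional of the path, to which the
    one-dimensional central limit theorem applies. *)
Lemma many_copies_limit n : Df_lim (fun N => normalized_sum Xs N n) (gaussian_average n).
Proof.
apply: Df_lim_criterion => [t t0|m t u c t0].
  have [h1 h2] := gaussian_average_second_moment n t.
  exists (\int[P0]_w (avg n t w ^+ 2)); split=> // [N|N]; first exact: normalized_sum_L2.
  rewrite [leLHS]normalized_sum_second_moment bool_natr_mul_le//.
  by apply: expec_ge0 => w; exact: sqr_ge0.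
rewrite [X in _ --> X]gE.
pose phi z := \sum_(i < m) u i * average n (t i) z.
have mphi : measurable_fun setT phi by apply: measurable_sum => i; exact: measurable_funM.
have L2phi : L2fun P0 (original alpha X phi).
  apply: (@L2_sum _ T0 R P0 _ (index_enum 'I_m) (fun i w => u i * avg n (t i) w)) => i.
  exact: L2_Z.
have phi0 : \int[P0]_w original alpha X phi w = 0.
  have i1 i : P0.-integrable setT (EFin \o avg n (t i)) by exact: (L2_L1 (L2avg n (t i))).
  rewrite [LHS](@expec_sum _ T0 R P0 _ (index_enum 'I_m) (fun i w => u i * avg n (t i) w)); last by move=> i; exact: (L1_Z (u i) (i1 i)).
  by rewrite big1// => i _; rewrite expecZ ?avg0 ?mulr0//; exact: i1.
have := copies_central_limit ma mX copiesP mphi L2phi phi0 (th := c).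
apply: cvg_trans; apply: near_eq_cvg; apply: nearW => N; apply: expec_eq => w.
congr (cos (_ + _)); rewrite /copy /phi exchange_big/= mulr_suml; apply: eq_bigr => i _.
rewrite -[RHS]/(u i * normalized_sum Xs N n (t i) w) normalized_sumE.
by rewrite mulrA mulr_sumr.
Qed.

(** Gaussian characteristic functions converge with their variances, and the
    variances converge because the time averages do in mean square. *)
Lemma gaussian_average_limit : Df_lim gaussian_average (linear_process W).
Proof.
apply: Df_lim_criterion => [t t0|m t u c t0].
  have [K K1 K2] := centered_average_bounded lambda0 inarP fin t0.
  have [h1 h2] := L2_limit t.
  have h3 n := gaussian_average_second_moment n t.
  exists K; split=> [n|n||].
  - by have [] := h3 n.
  - by have [_ h4] := h3 n; exact: le_trans h4 (K2 n).
  - exact: h1.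
  - exact: le_trans h2 K1.
rewrite [X in _ --> X]linear_limit_cos.
have h2 : \int[P0]_w ((\sum_(i < m) u i * avg n (t i) w) ^+ 2) @[n --> \oo] -->
    sigma2 * (\sum_(i < m) u i * t i) ^+ 2.
  rewrite mulrC -(expec_sqrZ _ L2L).
  apply: (mean_square_cvg_sqr (P := P0) (f := fun n w => \sum_(i < m) u i * avg n (t i) w)
    (g := fun w => (\sum_(i < m) u i * t i) * L w)).
  - by move=> n; apply: L2_sum => i; exact: L2_Z.
  - exact: L2_Z.
  - exact: linear_combination_cvg.
suff : cos c * expR (- (\int[P0]_w ((\sum_(i < m) u i * avg n (t i) w) ^+ 2)) / 2) @[n --> \oo]
    --> cos c * expR (- (sigma2 * (\sum_(i < m) u i * t i) ^+ 2) / 2).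
  by apply: cvg_trans; apply: near_eq_cvg; apply: nearW => n; rewrite -gE.
apply: cvgMr.
have h3 : - (\int[P0]_w ((\sum_(i < m) u i * avg n (t i) w) ^+ 2)) / 2 @[n --> \oo] -->
    - (sigma2 * (\sum_(i < m) u i * t i) ^+ 2) / 2.
  by apply: cvgMl; exact: cvgN.
by apply: (cvg_comp _ _ h3); exact: continuous_expR.
Qed.

End many_copies_first.

Section long_time_first.

Program Definition average_mean (N : nat) : process R :=
  @Process R d T P (fun t w => t * ((\sum_(j < N) copy mean j w) / Num.sqrt N%:R)) _.
Next Obligation.
move=> N t _; apply: measurable_funM => //; apply: measurable_funM => //.
by apply: measurable_sum => j; exact: measurable_copy.
Qed.

Lemma average_mean_L2 N t : L2fun P (average_mean N t).
Proof. exact: (L2_Z t (L2_copies_sum N mmean L2L)). Qed.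

Lemma average_mean_second_moment N t :
  \int[P]_w (average_mean N t w ^+ 2) <= t ^+ 2 * sigma2.
Proof.
have h := L2_copies_sum N mmean L2L.
rewrite [leLHS]expec_sqrZ// (copies_sum_second_moment ma mX copiesP mmean L2L L0).
by rewrite ler_wpM2l ?sqr_ge0// bool_natr_mul_le.
Qed.

(** For fixed N the convergence takes place in mean square on the space of the
    copies: the error is a normalized sum of copies of a centred functional that
    tends to 0 in mean square. *)
Lemma long_time_limit N : Df_lim (fun n => normalized_sum Xs N n) (average_mean N).
Proof.
apply: Df_lim_criterion => [t t0|m t u c t0].
  have [K K1 K2] := centered_average_bounded lambda0 inarP fin t0.
  exists K; split=> [n|n||].
  - exact: normalized_sum_L2.
  - rewrite [leLHS]normalized_sum_second_moment (le_trans _ (K2 n))// bool_natr_mul_le//.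
    by apply: expec_ge0 => w; exact: sqr_ge0.
  - exact: average_mean_L2.
  - exact: le_trans (average_mean_second_moment N t) K1.
apply: (mean_square_cvg_cos (P := P) (f := fun n w => \sum_(i < m) u i * normalized_sum Xs N n (t i) w)
  (g := fun w => \sum_(i < m) u i * average_mean N (t i) w)).
- by move=> n; apply: L2_sum => i; apply: L2_Z; exact: normalized_sum_L2.
- by apply: L2_sum => i; apply: L2_Z; exact: average_mean_L2.
pose delta n z := \sum_(i < m) u i * average n (t i) z - (\sum_(i < m) u i * t i) * mean z.
have mdelta n : measurable_fun setT (delta n).
  apply: measurable_funB; last exact: measurable_funM.
  by apply: measurable_sum => i; exact: measurable_funM.
have i1 n i : P0.-integrable setT (EFin \o avg n (t i)) by exact: (L2_L1 (L2avg n (t i))).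
have L2delta n : L2fun P0 (original alpha X (delta n)).
  apply: L2_B; last exact: L2_Z.
  apply: (@L2_sum _ T0 R P0 _ (index_enum 'I_m) (fun i w => u i * avg n (t i) w)) => i.
  exact: L2_Z.
have delta0 n : \int[P0]_w original alpha X (delta n) w = 0.
  have i2 : P0.-integrable setT (EFin \o (fun w => \sum_(i < m) u i * avg n (t i) w)).
    by apply: L1_sum => i; exact: (L1_Z (u i) (i1 n i)).
  rewrite [LHS](expecB i2 (L1_Z (\sum_(i < m) u i * t i) (L2_L1 L2L))).
  rewrite (expecZ _ (L2_L1 L2L)) L0 mulr0 subr0.
  rewrite (@expec_sum _ T0 R P0 _ (index_enum 'I_m) (fun i w => u i * avg n (t i) w)); last by move=> i; exact: (L1_Z (u i) (i1 n i)).
  by rewrite big1// => i _; rewrite expecZ ?avg0 ?mulr0//; exact: i1.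
have E n w : \sum_(i < m) u i * normalized_sum Xs N n (t i) w -
    \sum_(i < m) u i * average_mean N (t i) w =
    (\sum_(j < N) copy (delta n) j w) / Num.sqrt N%:R.
  rewrite /copy /delta [in RHS]sumrB mulrBl; congr (_ - _).
    rewrite exchange_big/= mulr_suml; apply: eq_bigr => i _.
    rewrite -[LHS]/(u i * normalized_sum Xs N n (t i) w) normalized_sumE.
    by rewrite mulrA mulr_sumr.
  by rewrite -mulr_sumr mulr_suml mulr_suml; apply: eq_bigr => i _ /=; rewrite !mulrA.
under eq_fun do under expec_eq do rewrite E.
under eq_fun do rewrite (copies_sum_second_moment ma mX copiesP (mdelta _) (L2delta _) (delta0 _)).
rewrite -(mulr0 (0 < N)%N%:R); apply: cvgMr.
exact: linear_combination_cvg.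
Qed.

(** At each N the process is a random line, so this is the central limit theorem
    for the copies of L alone. *)
Lemma average_mean_limit : Df_lim average_mean (linear_process W).
Proof.
apply: Df_lim_criterion => [t t0|m t u c t0].
  have [h1 h2] := L2_limit t.
  exists (t ^+ 2 * sigma2); split=> // N; first exact: average_mean_L2.
  exact: average_mean_second_moment.
rewrite [X in _ --> X]linear_limit_cos.
pose s := \sum_(i < m) u i * t i.
pose phi z := s * mean z.
have mphi : measurable_fun setT phi by exact: measurable_funM.
have L2phi : L2fun P0 (original alpha X phi) by exact: L2_Z.
have phi0 : \int[P0]_w original alpha X phi w = 0.
  by rewrite expecZ ?L0 ?mulr0//; exact: L2_L1.
have := copies_central_limit ma mX copiesP mphi L2phi phi0 (th := c).
rewrite [\int[P0]_w _](expec_sqrZ s L2L) (mulrC (s ^+ 2)).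
apply: cvg_trans; apply: near_eq_cvg; apply: nearW => N; apply: expec_eq => w.
congr (cos (_ + _)); rewrite /copy /phi -mulr_sumr /s mulr_suml mulr_suml.
by apply: eq_bigr => i _ /=; rewrite !mulrA.
Qed.

End long_time_first.
End iterated_limits.

(** * Conclusion *)

Theorem theorem4p13 (R : realType) (lambda beta psi1 : R) (psi : R -> R)
  (* the randomized INAR(1) process *)
  (d0 : measure_display) (T0 : measurableType d0) (P0 : probability T0 R)
  (alpha : {RV P0 >-> R}) (X0 : {RV P0 >-> nat})
  (xi : nat -> nat -> {RV P0 >-> nat}) (eps : nat -> {RV P0 >-> nat})
  (* the independent copies *)
  (d : measure_display) (T : measurableType d) (P : probability T R)
  (alphas : nat -> {RV P >-> R}) (Xs : nat -> nat -> {RV P >-> nat})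
  (* the random variable W *)
  (dW : measure_display) (TW : measurableType dW) (Q : probability TW R)
  (W : {RV Q >-> R}) :
  0 < lambda ->
  randomized_inar P0 lambda alpha X0 xi eps ->
  has_density P0 alpha `]0, 1[ (fun x => psi x * (1 - x) `^ beta) ->
  0 < psi1 -> psi x @[x --> 1^'-] --> psi1 ->
  independent_copies P0 alpha (inar X0 xi eps) P alphas Xs ->
  1 < beta ->
  normally_distributed Q W 0
    (lambda ^+ 2 * fine ('V_P0[(fun w => (1 - alpha w)^-1)%R])%E) ->
  iterated_Df_lim (fun n N => normalized_sum Xs N n) (linear_process W) /\
  iterated_Df_lim (fun N n => normalized_sum Xs N n) (linear_process W).
Proof.
move=> lambda0 inarP dens psi1_gt0 psi_cvg copiesP beta1 normW.
have a01 := inar_alpha01 inarP.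
have fin := integrable_inv_sqr dens a01 psi_cvg psi1_gt0 beta1.
have noatom := density_noatom dens.
rewrite (variance_inv X0 xi eps lambda0 fin) in normW.
split.
  have [g mg gE] := gaussian_average_exists lambda0 inarP fin noatom copiesP.
  exists (gaussian_average P mg); split=> [n _|].
    exact: (many_copies_limit lambda0 inarP fin copiesP gE).
  exact: (gaussian_average_limit lambda0 inarP fin normW mg gE).
eexists; split=> [N _|].
  exact: (long_time_limit lambda0 inarP fin copiesP).
exact: (average_mean_limit fin copiesP normW).
Qed.
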